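(* Let $P=\mathbb P(\mathcal O\oplus\mathcal O(-1))\to\mathbb P^1$ be the blow-up of $\mathbb P^2$ at one point. Let $\vartheta:=z\frac d{dz}$ and let $\mathcal S_0(P)$ be the space of master functions of $P$ at $0\in H^\bullet(P,\mathbb C)$, that is, the space of functions $\Phi\in\mathcal O(\widetilde{\mathbb C^*})$ solving the differential equation $$(283z-24)\vartheta^4\Phi+(283z^2-590z+24)\vartheta^3\Phi+z(-2264z^2+192z+3)\vartheta^2\Phi-4z^2(2547z^2+350z-104)\vartheta\Phi+z^2(-3113z^3-9924z^2+1476z+192)\Phi=0.$$ Let $\Upsilon_1,\Upsilon_2\in\mathcal O(\widetilde{\mathbb C^*})$ be the functions $$\Upsilon_1(z)=\sum_{k=0}^\infty\frac{z^{2k}}{(k!)^2},\qquad\Upsilon_2(z)=\sum_{k=0}^\infty(\log z-H_k)\frac{z^{2k}}{(k!)^2},\qquad H_k:=\sum_{m=1}^k\frac1m,$$ and set $\boldsymbol\alpha=\left(-4,\frac12\right)$, $\boldsymbol\beta=\left(-\frac12,1\right)$. Then $\mathcal S_0(P)$ admits the following $\mathbb C$-basis: $$\mathscr B_{\boldsymbol\alpha,\boldsymbol\beta}[\Upsilon_1,\mathcal E_0],\qquad\mathscr B_{\boldsymbol\alpha,\boldsymbol\beta}[\Upsilon_2,\mathcal E_0],\qquad\mathscr B_{\boldsymbol\alpha,\boldsymbol\beta}[\Upsilon_1,\mathcal E_1],\qquad4\mathscr B_{\boldsymbol\alpha,\boldsymbol\beta}[\Upsilon_2,\mathcal E_1]+\mathscr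 B_{\boldsymbol\alpha,\boldsymbol\beta}[\Upsilon_1,\mathcal E_2].$$
   Context: $\widetilde{\mathbb C^*}$ is the universal cover of $\mathbb C^*$ and $\mathcal O(\widetilde{\mathbb C^*})$ its ring of holomorphic functions. The functions $\Upsilon_1,\Upsilon_2$ form a basis of the space of solutions of $\vartheta^2\Upsilon=4z^2\Upsilon$ (the space of master functions of $\mathbb P^1$ at $0$). **Borel multitransform.** For $\boldsymbol\alpha,\boldsymbol\beta\in(\mathbb C^* )^2$ and $\Phi_1,\Phi_2\in\mathcal O(\widetilde{\mathbb C^*})$, $$\mathscr B_{\boldsymbol\alpha,\boldsymbol\beta}[\Phi_1,\Phi_2](z)=\frac1{2\pi\sqrt{-1}}\int_{\mathfrak H}\prod_{j=1}^2\Phi_j\Big(z^{\frac1{\alpha_j\beta_j}}\lambda^{-\beta_j}\Big)e^\lambda\frac{d\lambda}\lambda,$$ where $\mathfrak H$ is a Hankel contour: it comes from $-\infty$, circles the origin once in the positive direction and returns to $-\infty$ (with $|\arg\lambda|<\pi$). For the given $\boldsymbol\alpha,\boldsymbol\beta$ this reads $$\mathscr B_{\boldsymbol\alpha,\boldsymbol\beta}[\Phi_1,\Phi_2](z)=\frac1{2\pi\sqrt{-1}}\int_{\mathfrak H}\Phi_1\big(z^{1/2}\lambda^{1/2}\big)\Phi_2\big(z^2\lambda^{-1}\big)e^\lambda\frac{d\lambda}\lambda.$$ **The functions $\mathcal E_k$.** $\mathcal E(s,z)=\sum_{m=0}^\infty\frac{z^{m+s}}{\Gamma(1+m+s)}$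 for $(s,z)\in\mathbb C\times\widetilde{\mathbb C^*}$, and $\mathcal E_k(z)=\frac{\partial^k}{\partial s^k}\mathcal E(s,z)\big|_{s=0}$ for $k\ge0$. **Master functions of $P$ at $0$.** These are the functions $z^{-\dim_{\mathbb C}P/2}\int_P\varsigma(z)$, where $\varsigma\colon\widetilde{\mathbb C^*}\to H^\bullet(P,\mathbb C)$ solves the quantum differential equation $\frac d{dz}\varsigma=(\mathcal U+\frac1z\mu)\varsigma$, with $\mathcal U$ the quantum multiplication by $c_1(P)$ at $0\in H^\bullet(P,\mathbb C)$ (Novikov variables set to $1$) and $\mu(v)=\frac12(\deg v-\dim_{\mathbb C}P)v$ for $v$ homogeneous of real degree $\deg v$. They are exactly the solutions of the scalar differential equation displayed in the claim. *)

(* Defs.v *)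
(* Real and complex numbers: Stdlib's R and Coquelicot's C. *)
From Stdlib Require Import Reals Factorial Lra.
From Coquelicot Require Import Coquelicot.
Open Scope C_scope.

(** ** Complex analysis not provided by Coquelicot *)

Definition Cexp (w : C) : C :=
  (exp (Re w) * cos (Im w), exp (Re w) * sin (Im w))%R.

(* Principal logarithm.  The half-angle formula gives the argument in (-PI,PI)
   on the slit plane C \ (-oo,0]; the value on the slit is irrelevant. *)
Definition Clog (x : C) : C :=
  (ln (Cmod x), 2 * atan (Im x / (Re x + Cmod x)))%R.

(* Limits and sums of complex sequences, taken componentwise; as for Lim_seq
   and Series, the value is meaningful when the limit exists. *)
Definition CLim_seq (u : nat -> C) : C :=
  (real (Lim_seq (fun n => Re (u n))), real (Lim_seq (fun n => Im (u n)))).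

Definition CSeries (a : nat -> C) : C :=
  (Series (fun n => Re (a n)), Series (fun n => Im (a n))).

Fixpoint Cprod (a : nat -> C) (n : nat) : C :=
  match n with
  | O => 1
  | S n' => Cprod a n' * a n'
  end.

Fixpoint C_derive_n (f : C -> C) (k : nat) : C -> C :=
  match k with
  | O => f
  | S k' => C_derive (C_derive_n f k')
  end.

(* The entire function 1/Gamma, by Gauss's formula
   Gamma s = lim n! n^s / (s (s+1) ... (s+n)). *)
Definition rGamma (s : C) : C :=
  CLim_seq (fun n =>
    Cprod (fun j => s + INR j) (S n) / (INR (fact n) * Cexp (s * ln (INR n)))).

(** ** Functions on the universal cover of C^*

    The universal cover of C^* is Cexp : C -> C^*, and its points are given by
    the global coordinate w = log z.  A function on the cover is thus a function
    of w : C, with z = Cexp w and z^a = Cexp (a * w); the point z^a of the cover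
    is a * w; the derivation theta = z d/dz is d/dw; and O(cover) is the ring of
    entire functions of w. *)

Definition holomorphic (Phi : C -> C) : Prop :=
  forall w : C, ex_derive (K := C_AbsRing) (V := C_NormedModule) Phi w.

Definition harmonic (k : nat) : R := sum_n_m (fun m => / INR m)%R 1 k.

Definition Upsilon1 (w : C) : C :=
  CSeries (fun k => Cexp w ^ (2 * k) / INR (fact k) ^ 2).

Definition Upsilon2 (w : C) : C :=
  CSeries (fun k => (w - harmonic k) * (Cexp w ^ (2 * k) / INR (fact k) ^ 2)).

Definition Efun (s w : C) : C :=
  CSeries (fun m => Cexp ((INR m + s) * w) * rGamma (1 + INR m + s)).

Definition E_ (k : nat) (w : C) : C :=
  C_derive_n (fun s => Efun s w) k 0.

(** ** Hankel contours

    A C^1 path in the slit plane C \ (-oo,0] (that is, |arg| < PI), coming from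
    -oo below the slit and returning to -oo above it; as the path avoids the
    slit, it circles the origin exactly once, in the positive direction.  The
    bound on the imaginary part expresses that both ends go to infinity inside
    a sector strictly contained in the left half-plane.  Piecewise C^1 contours are covered by
    stopping at their corners. *)
Record hankel_contour := HankelContour {
  hpath : R -> C;
  hvel : R -> C;
  hpath_derive : forall t : R,
    is_derive (K := R_AbsRing) (V := C_R_NormedModule) hpath t (hvel t);
  hvel_continuous : forall t : R,
    continuous (T := R_UniformSpace) (U := C_UniformSpace) hvel t;
  hpath_slit : forall t : R, (0 < Re (hpath t))%R \/ Im (hpath t) <> 0%R;
  hpath_start : is_lim (fun t => Re (hpath t)) m_infty m_infty;
  hpath_end : is_lim (fun t => Re (hpath t)) p_infty m_infty;
  hpath_below : Rbar_locally m_infty (fun t => (Im (hpath t) < 0)%R);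
  hpath_above : Rbar_locally p_infty (fun t => (0 < Im (hpath t))%R);
  hpath_sector : exists M : R, forall t : R,
    (Rabs (Im (hpath t)) <= M * (1 + Rabs (Re (hpath t))))%R
}.

(* The integral along H of f(x) dx. *)
Definition hankel_integral (H : hankel_contour) (f : C -> C) : C :=
  RInt_gen (V := C_R_CompleteNormedModule)
    (fun t => f (hpath H t) * hvel H t)
    (Rbar_locally m_infty) (Rbar_locally p_infty).

Definition borel_multitransform (H : hankel_contour) (alpha beta : C * C)
    (Phi1 Phi2 : C -> C) (w : C) : C :=
  / (2 * PI * Ci) *
  hankel_integral H (fun x =>
    Phi1 (w / (fst alpha * fst beta) - fst beta * Clog x) *
    Phi2 (w / (snd alpha * snd beta) - snd beta * Clog x) *
    Cexp x / x).

(** ** The master functions of the blow-up of P^2 at one point *)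

(* T k is theta^k Phi. *)
Definition master_space_P (Phi : C -> C) : Prop :=
  holomorphic Phi /\
  exists T : nat -> C -> C,
    (forall w, T 0%nat w = Phi w) /\
    (forall k w, (k < 4)%nat ->
       is_derive (K := C_AbsRing) (V := C_NormedModule) (T k) w (T (S k) w)) /\
    (forall w, let z := Cexp w in
      (283 * z - 24) * T 4%nat w
      + (283 * z ^ 2 - 590 * z + 24) * T 3%nat w
      + z * (- (2264) * z ^ 2 + 192 * z + 3) * T 2%nat w
      - 4 * z ^ 2 * (2547 * z ^ 2 + 350 * z - 104) * T 1%nat w
      + z ^ 2 * (- (3113) * z ^ 3 - 9924 * z ^ 2 + 1476 * z + 192) * T 0%nat w
      = 0).

(** ** Bases of spaces of functions *)

Definition lincomb4 (b1 b2 b3 b4 : C -> C) (c1 c2 c3 c4 w : C) : C :=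
  c1 * b1 w + c2 * b2 w + c3 * b3 w + c4 * b4 w.

Definition is_C_basis4 (V : (C -> C) -> Prop) (b1 b2 b3 b4 : C -> C) : Prop :=
  (V b1 /\ V b2 /\ V b3 /\ V b4) /\
  (forall c1 c2 c3 c4 : C,
    (forall w, lincomb4 b1 b2 b3 b4 c1 c2 c3 c4 w = 0) ->
    c1 = 0 /\ c2 = 0 /\ c3 = 0 /\ c4 = 0) /\
  (forall Phi, V Phi ->
    exists c1 c2 c3 c4 : C, forall w, Phi w = lincomb4 b1 b2 b3 b4 c1 c2 c3 c4 w).

(** ** Hankel contours exist: the parabola (1 + i t)^2 *)

Lemma hankel_contour_inhabited : inhabited hankel_contour.
Proof.
apply inhabits.
refine (@HankelContour (fun t : R => (1 - t ^ 2, 2 * t)%R)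
  (fun t : R => (- 2 * t, 2)%R) _ _ _ _ _ _ _ _); cbn [Re Im fst snd].
- intros t.
  assert (H1 : is_derive (fun t : R => (1 - t ^ 2)%R) t (- 2 * t)%R)
    by (auto_derive; [exact I | ring]).
  assert (H2 : is_derive (fun t : R => (2 * t)%R) t 2%R)
    by (auto_derive; [exact I | ring]).
  apply (is_derive_scal_l (V := C_R_NormedModule) _ _ _ (1, 0)%R) in H1.
  apply (is_derive_scal_l (V := C_R_NormedModule) _ _ _ (0, 1)%R) in H2.
  assert (H := is_derive_plus _ _ _ _ _ H1 H2).
  replace (- 2 * t, 2)%R with
    (plus (scal (- 2 * t)%R ((1, 0)%R : C_R_NormedModule))
          (scal 2%R ((0, 1)%R : C_R_NormedModule))).
  + revert H; apply is_derive_ext; intros u.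
    apply injective_projections; cbn; unfold scal, plus, mult; cbn;
      unfold mult; cbn; ring.
  + apply injective_projections; cbn; unfold scal, plus, mult; cbn;
      unfold mult; cbn; ring.
- intros t.
  apply filterlim_locally; intros eps.
  assert (Hc : continuous (fun t : R => (- 2 * t)%R) t)
    by (apply (ex_derive_continuous (V := R_NormedModule)); auto_derive; exact I).
  generalize (proj1 (filterlim_locally _ _) Hc eps); apply filter_imp.
  intros u Hu; split; [exact Hu | apply ball_center].
- intros t; destruct (Req_dec t 0) as [-> | Ht]; [left | right]; lra.
- apply (is_lim_ext (fun t : R => 1 - t * t)%R); [intros; ring |].
  apply (is_lim_minus (fun _ => 1%R) (fun t => t * t)%R _ 1%R p_infty);
    [apply is_lim_const | | reflexivity].
  apply (is_lim_mult (fun t => t) (fun t => t) _ m_infty m_infty);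
    [apply is_lim_id | apply is_lim_id | exact I].
- apply (is_lim_ext (fun t : R => 1 - t * t)%R); [intros; ring |].
  apply (is_lim_minus (fun _ => 1%R) (fun t => t * t)%R _ 1%R p_infty);
    [apply is_lim_const | | reflexivity].
  apply (is_lim_mult (fun t => t) (fun t => t) _ p_infty p_infty);
    [apply is_lim_id | apply is_lim_id | exact I].
- exists 0%R; intros; lra.
- exists 0%R; intros; lra.
- exists 2%R; intros t.
  assert (Ht : (t ^ 2 - 1 <= Rabs (1 - t ^ 2))%R)
    by (rewrite Rabs_minus_sym; apply Rle_abs).
  assert (0 <= Rabs (1 - t ^ 2))%R by apply Rabs_pos.
  apply Rabs_le; split; nra.
Qed.

(* Main.v *)
Require Import Defs.
From Stdlib Require Import Reals Lra Lia Factorial Classical FunctionalExtensionality.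
From Coquelicot Require Import Coquelicot.

(** In the coordinates [w = log z] and [u = log x], where [x] is the variable of
    the Hankel contour, the integrand of the Borel multitransform is
    [p ((w + u) / 2) * q (2 w - u) * exp (e^u) du], with [p] one of the functions
    Upsilon and [q] one of the functions E.  Write [theta1] and [theta2] for the
    derivations acting on the first factor, divided by 2, and on the second.  Then
    [z d/dz] is [theta1 + 2 theta2] and [d/du] is [theta1 - theta2]; the equation of
    Upsilon is [theta1^2 p = z x p], and [E_0' = e^b E_0] gives
    [theta2 q = (z^2 / x) q] for [q = E_0].  Integration by parts against [exp x]
    replaces multiplication by [x] with [theta2 - theta1], so that the integral [F]
    satisfies [theta1^2 F = z (theta2 - theta1) F] and
    [theta2 (theta2 - theta1) F = z^2 F].  This is a system of rank four for [F],
    [theta1 F], [theta2 F] and [theta1 theta2 F] ([system], [hankel_family_sys]);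
    the scalar equation of the master functions is its elimination
    ([theta_power_ode]).

    For [E_1] and [E_2] the equation has a defect: [E_k' = e^b E_k + rho_k] with
    [rho_1 = 1] and [rho_2 = 2 (b + gamma)], where [gamma] is the first derivative of
    [1 / Gamma (1 + s)] at 0.  The system still holds if the integrals of
    [x p rho_k] and [x (theta1 p) rho_k] vanish, as they do when these integrands
    are single valued, hence entire, in [x] ([hankel_x_pser]).  This is the case for
    Upsilon_1 with [rho_1], while Upsilon_2 with [rho_1] and Upsilon_1 with [rho_2] produce a multiple of
    [log x]; the combination [4 B[Upsilon_2, E_1] + B[Upsilon_1, E_2]] is the one
    where these terms cancel ([system_4]).

    If a linear combination of the four functions vanishes, then so do its images
    under [theta1], [theta2] and [theta1 theta2], because [F] is a cyclic vector of
    the system away from [283 z = 24] ([system_cyclic]).  As [z] tends to 0 the four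
    components of the four solutions tend to constants or are multiplied by the
    coefficients already known to vanish, the Hankel integral of a constant [c]
    being [2 i PI c]; this triangular scheme gives the independence
    ([leading_combination]).  Conversely a solution of the scalar equation that
    vanishes to order four at one regular point is zero, by Gronwall's inequality
    along segments that avoid the singular points ([tower_unique]); hence four
    independent solutions span ([spanning]).

    The analysis behind this avoids contour deformation: the integrand has an entire
    primitive in [u], which has a limit at infinity on each side of the slit, and
    the Hankel integral is the difference of the two limits ([hankel_value]). *)

Open Scope C_scope.

(** * Differentiation *)

(** The derivative of [f] relative to the coordinate [i].  Taking for [i] the
    identity of [C] or the inclusion of [R] gives the complex derivative and the
    derivative of a path, so that both share the rules of calculus. *)
Definition deriv_along {D : Type} (i f : D -> C) (x : D) (l : C) : Prop :=
  forall eps : R, (0 < eps)%R -> exists d : R, (0 < d)%R /\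
    forall y : D, (Cmod (i y - i x) < d)%R ->
      (Cmod (f y - f x - (i y - i x) * l) <= eps * Cmod (i y - i x))%R.

Notation cder := (deriv_along (fun z : C => z)).
Notation rder := (deriv_along RtoC).

Ltac use_Rmin := repeat match goal with
  | _ : context [Rmin ?a ?b] |- _ => lazymatch goal with
    | _ : (Rmin a b <= a)%R |- _ => fail
    | _ => assert (Rmin a b <= a)%R by apply Rmin_l; assert (Rmin a b <= b)%R by apply Rmin_r
    end end.

Lemma C_eq (x y : C) : Re x = Re y -> Im x = Im y -> x = y.
Proof. intros H1 H2; apply injective_projections; assumption. Qed.

Lemma cder_is_derive (f : C -> C) (x l : C) :
  is_derive (K := C_AbsRing) (V := C_NormedModule) f x l <-> cder f x l.
Proof.
split.
- intros [_ H] eps Heps.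
  specialize (H x (fun P HP => HP) (mkposreal eps Heps)).
  destruct H as [d Hd]; exists d; split; [apply cond_pos |].
  intros y Hy.
  specialize (Hd y Hy); revert Hd.
  change (norm _) with (Cmod (f y - f x - (y - x) * l)) at 1.
  change (norm _) with (Cmod (y - x)) at 1; intros Hd; exact Hd.
- intros H; split.
  + apply is_linear_scal_l.
  + intros y Hy.
    assert (Hxy : x = y).
    { apply (is_filter_lim_unique (V := AbsRing_NormedModule C_AbsRing) (F := locally (T := AbsRing_NormedModule C_AbsRing) x)); [| exact Hy].
      intros P HP; exact HP. }
    subst y; intros eps.
    destruct (H eps (cond_pos eps)) as [d [Hd Hd']].
    exists (mkposreal d Hd); intros y Hy'; apply (Hd' y Hy').
Qed.

Lemma rder_is_derive (f : R -> C) (t : R) (l : C) :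
  is_derive (K := R_AbsRing) (V := C_R_NormedModule) f t l <-> rder f t l.
Proof.
assert (E : forall y, minus (minus (f y) (f t)) (scal (minus y t) l : C_R_NormedModule)
   = f y - f t - RtoC (y - t) * l).
{ intros y; apply C_eq; unfold minus, plus, opp, scal; simpl; unfold minus, plus, opp, scal, mult; simpl; unfold minus, mult, plus, opp; simpl; ring. }
assert (N : forall c : C, norm (V:=C_R_NormedModule) c = Cmod c).
{ intros c; unfold norm; simpl; unfold prod_norm, Cmod; f_equal; unfold norm; simpl; unfold abs; simpl.
  rewrite !Rmult_1_r. rewrite <- (Rabs_mult (fst c)), <- (Rabs_mult (snd c)).
  f_equal; apply Rabs_pos_eq; nra. }
assert (T : forall y, Cmod (RtoC y - RtoC t) = Rabs (y - t)) by (intros y; rewrite <- RtoC_minus; apply Cmod_R).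
split.
- intros [_ H] eps Heps.
  specialize (H t (fun P HP => HP) (mkposreal eps Heps)).
  destruct H as [d Hd]; exists d; split; [apply cond_pos |].
  intros y Hy.
  assert (Hd' : (norm (V := C_R_NormedModule) (minus (minus (f y) (f t))
     (scal (minus y t) l : C_R_NormedModule)) <= eps * Rabs (y - t))%R).
  { apply (Hd y). rewrite T in Hy; exact Hy. }
  rewrite N, E in Hd'. rewrite T, <- RtoC_minus; exact Hd'.
- intros H; split.
  + apply is_linear_scal_l.
  + intros y Hy.
    assert (Hxy : t = y).
    { apply (is_filter_lim_unique (V := AbsRing_NormedModule R_AbsRing) (F := locally (T := AbsRing_NormedModule R_AbsRing) t)); [| exact Hy].
      intros P HP; exact HP. }
    subst y; intros eps.
    destruct (H eps (cond_pos eps)) as [d [Hd Hd']].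
    exists (mkposreal d Hd); intros y Hy'.
  change (norm (V := C_R_NormedModule) (minus (minus (f y) (f t))
     (scal (minus y t) l : C_R_NormedModule)) <= eps * Rabs (y - t))%R.
  rewrite N, E, RtoC_minus, <- T; apply Hd'. rewrite T; exact Hy'.
Qed.

Section Rules.
Context {D : Type} {i : D -> C}.
Implicit Types (f g : D -> C) (x : D) (l m c : C).

Lemma deriv_ext f g x l : (forall y, f y = g y) -> deriv_along i f x l -> deriv_along i g x l.
Proof.
intros E H eps He; destruct (H eps He) as [d [Hd K]]; exists d; split; [exact Hd|].
intros y Hy; rewrite <- !E; auto.
Qed.

Lemma deriv_ext_loc f g x l r : (0 < r)%R ->
  (forall y, (Cmod (i y - i x) < r)%R -> f y = g y) -> deriv_along i f x l -> deriv_along i g x l.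
Proof.
intros Hr E H eps He; destruct (H eps He) as [d [Hd K]]; exists (Rmin d r); split; [apply Rmin_pos; auto|].
intros y Hy; use_Rmin. rewrite <- !E; [apply K; lra | | lra].
replace (i x - i x) with (RtoC 0) by ring; rewrite Cmod_0; lra.
Qed.

Lemma deriv_eq f x l m : l = m -> deriv_along i f x l -> deriv_along i f x m.
Proof. intros ->; auto. Qed.

Lemma deriv_const c x : deriv_along i (fun _ => c) x 0.
Proof.
intros eps He; exists 1%R; split; [lra|]; intros y _.
replace (c - c - (i y - i x) * 0) with (RtoC 0) by ring; rewrite Cmod_0.
assert (H := Cmod_ge_0 (i y - i x)); nra.
Qed.

Lemma deriv_coord x : deriv_along i i x 1.
Proof.
intros eps He; exists 1%R; split; [lra|]; intros y _.
replace (i y - i x - (i y - i x) * 1) with (RtoC 0) by ring; rewrite Cmod_0.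
assert (H := Cmod_ge_0 (i y - i x)); nra.
Qed.

Lemma deriv_plus f g x l m : deriv_along i f x l -> deriv_along i g x m ->
  deriv_along i (fun y => f y + g y) x (l + m).
Proof.
intros H1 H2 eps He.
destruct (H1 (eps/2)%R) as [d1 [Hd1 K1]]; [lra|].
destruct (H2 (eps/2)%R) as [d2 [Hd2 K2]]; [lra|].
exists (Rmin d1 d2); split; [apply Rmin_pos; auto|]; intros y Hy; use_Rmin.
specialize (K1 y ltac:(lra)); specialize (K2 y ltac:(lra)).
replace (f y + g y - (f x + g x) - (i y - i x) * (l + m))
  with ((f y - f x - (i y - i x) * l) + (g y - g x - (i y - i x) * m)) by ring.
eapply Rle_trans; [apply Cmod_triangle|]; lra.
Qed.

Lemma deriv_lip f x l : deriv_along i f x l -> exists K d, (0 < K)%R /\ (0 < d)%R /\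
  forall y, (Cmod (i y - i x) < d)%R -> (Cmod (f y - f x) <= K * Cmod (i y - i x))%R.
Proof.
intros H; destruct (H 1%R Rlt_0_1) as [d [Hd K]].
exists (1 + Cmod l)%R, d; assert (A := Cmod_ge_0 l); split; [lra|split; [exact Hd|]].
intros y Hy; specialize (K y Hy).
replace (f y - f x) with ((f y - f x - (i y - i x) * l) + (i y - i x) * l) by ring.
eapply Rle_trans; [apply Cmod_triangle|]; rewrite Cmod_mult; lra.
Qed.

Lemma deriv_scal c f x l : deriv_along i f x l -> deriv_along i (fun y => c * f y) x (c * l).
Proof.
intros H eps He. assert (Pc := Cmod_ge_0 c).
destruct (H (eps / (1 + Cmod c))%R) as [d [Hd K]]; [apply Rdiv_lt_0_compat; lra|].
exists d; split; [exact Hd|]; intros y Hy; specialize (K y Hy).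
replace (c * f y - c * f x - (i y - i x) * (c * l)) with (c * (f y - f x - (i y - i x) * l)) by ring.
rewrite Cmod_mult.
apply Rle_trans with ((1 + Cmod c) * (eps / (1 + Cmod c) * Cmod (i y - i x)))%R.
- apply Rmult_le_compat; try apply Cmod_ge_0; lra.
- right; field; lra.
Qed.

Lemma deriv_opp f x l : deriv_along i f x l -> deriv_along i (fun y => - f y) x (- l).
Proof.
intros H; apply deriv_eq with (- (1) * l); [ring|].
apply deriv_ext with (fun y => - (1) * f y); [intros; ring | apply deriv_scal, H].
Qed.

Lemma deriv_minus f g x l m : deriv_along i f x l -> deriv_along i g x m ->
  deriv_along i (fun y => f y - g y) x (l - m).
Proof. intros H1 H2; apply (deriv_plus f (fun y => - g y)); [exact H1 | apply deriv_opp, H2]. Qed.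

(** The outer function is differentiated with respect to the complex variable. *)
Lemma deriv_comp (F : C -> C) g x l m : deriv_along i g x m -> cder F (g x) l ->
  deriv_along i (fun y => F (g y)) x (l * m).
Proof.
intros H2 H1 eps He.
destruct (deriv_lip _ _ _ H2) as [K [d0 [HK [Hd0 L]]]].
assert (Pl := Cmod_ge_0 l).
destruct (H1 (eps/(2*K))%R) as [d1 [Hd1 K1]]; [apply Rdiv_lt_0_compat; lra|].
destruct (H2 (eps/(2*(1+Cmod l)))%R) as [d2 [Hd2 K2]]; [apply Rdiv_lt_0_compat; lra|].
assert (Hd3 : (0 < d1 / K)%R) by (apply Rdiv_lt_0_compat; lra).
exists (Rmin (d1/K) (Rmin d0 d2)); split; [repeat apply Rmin_pos; auto|]; intros y Hy; use_Rmin.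
specialize (L y ltac:(lra)); specialize (K2 y ltac:(lra)).
set (h := Cmod (i y - i x)) in *; assert (Hh : (0 <= h)%R) by apply Cmod_ge_0.
assert (B : (Cmod (g y - g x) < d1)%R).
{ eapply Rle_lt_trans; [exact L|]. apply Rlt_le_trans with (K * (d1/K))%R.
  - apply Rmult_lt_compat_l; lra.
  - right; field; lra. }
specialize (K1 (g y) B).
replace (F (g y) - F (g x) - (i y - i x) * (l * m)) with
  ((F (g y) - F (g x) - (g y - g x) * l) + (g y - g x - (i y - i x) * m) * l) by ring.
eapply Rle_trans; [apply Cmod_triangle|]; rewrite Cmod_mult.
assert (E1 : (Cmod (F (g y) - F (g x) - (g y - g x) * l) <= eps/2 * h)%R).
{ eapply Rle_trans; [exact K1|].
  apply Rle_trans with (eps/(2*K) * (K * h))%R.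
  - apply Rmult_le_compat_l; [left; apply Rdiv_lt_0_compat; lra | exact L].
  - right; field; lra. }
assert (E2 : (Cmod (g y - g x - (i y - i x) * m) * Cmod l <= eps/2 * h)%R).
{ apply Rle_trans with (eps/(2*(1+Cmod l)) * h * (1 + Cmod l))%R.
  - apply Rmult_le_compat; try apply Cmod_ge_0; [exact K2|lra].
  - right; field; lra. }
lra.
Qed.

End Rules.

Lemma cder_id (x : C) : cder (fun y => y) x 1.
Proof. apply (deriv_coord (i := fun z : C => z)). Qed.

Lemma cder_square (x : C) : cder (fun y => y * y) x (2 * x).
Proof.
intros eps He; exists eps; split; [exact He|]; intros y Hy.
replace (y * y - x * x - (y - x) * (2 * x)) with ((y - x) * (y - x)) by ring.
rewrite Cmod_mult. apply Rmult_le_compat_r; [apply Cmod_ge_0 | lra].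
Qed.

(** By polarization, [f g = ((f + g)^2 - (f - g)^2) / 4]. *)
Lemma deriv_mult {D : Type} {i : D -> C} (f g : D -> C) x l m :
  deriv_along i f x l -> deriv_along i g x m ->
  deriv_along i (fun y => f y * g y) x (l * g x + f x * m).
Proof.
intros H1 H2.
assert (P := deriv_comp _ _ _ _ _ (deriv_plus _ _ _ _ _ H1 H2) (cder_square _)).
assert (M := deriv_comp _ _ _ _ _ (deriv_minus _ _ _ _ _ H1 H2) (cder_square _)).
eapply deriv_eq; [|eapply deriv_ext; [|exact (deriv_scal (/ 4) _ _ _ (deriv_minus _ _ _ _ _ P M))]].
- cbv beta; field.
- intros y; cbv beta; field.
Qed.

Lemma deriv_pow {D : Type} {i : D -> C} (f : D -> C) x l n : deriv_along i f x l ->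
  deriv_along i (fun y => f y ^ n) x (INR n * f x ^ (n - 1) * l).
Proof.
intros H; induction n as [|n IH].
- apply deriv_eq with (RtoC 0); [simpl; ring | apply (deriv_const 1)].
- apply deriv_eq with (l * f x ^ n + f x * (INR n * f x ^ (n - 1) * l)).
  + rewrite S_INR, RtoC_plus. destruct n as [|n]; simpl; [ring|].
    rewrite Nat.sub_0_r; ring.
  + apply (deriv_mult f (fun y => f y ^ n)); assumption.
Qed.

(* The composition rule is left out of [deriv_rules]: its higher-order pattern
   would match any goal.  Compositions are differentiated through the hints. *)
Create HintDb deriv.
Ltac deriv_step := first [ eassumption | solve [eauto 2 with deriv] | apply deriv_const | apply cder_id
  | apply deriv_plus | apply deriv_minus | apply deriv_opp | apply deriv_pow | apply deriv_mult ].
Ltac deriv_rules := repeat deriv_step.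
Ltac derivative := eapply deriv_eq; [|deriv_rules]; cbv beta.

Lemma rder_line (a b : C) t : rder (fun s => a + RtoC s * b) t b.
Proof.
apply deriv_eq with (0 + b * 1); [ring|].
apply deriv_ext with (fun s => a + b * RtoC s); [intros; ring|].
apply deriv_plus; [apply deriv_const | apply deriv_scal, deriv_coord].
Qed.

Lemma Im_le_Cmod (c : C) : (Rabs (Im c) <= Cmod c)%R.
Proof. eapply Rle_trans; [apply Rmax_r|apply Rmax_Cmod]. Qed.

Lemma Cmod_le_ReIm (c : C) : (Cmod c <= Rabs (Re c) + Rabs (Im c))%R.
Proof.
replace c with (RtoC (Re c) + Ci * RtoC (Im c)) at 1.
- eapply Rle_trans; [apply Cmod_triangle|]; rewrite Cmod_mult, Cmod_Ci, !Cmod_R; lra.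
- destruct c; apply C_eq; simpl; ring.
Qed.

(** The common argument for the real and the imaginary part. *)
Lemma rder_projection (p : C -> R) f t l :
  (forall c, (Rabs (p c) <= Cmod c)%R) -> (forall c d, p (c - d) = (p c - p d)%R) ->
  (forall (r : R) c, p (r * c) = (r * p c)%R) -> rder f t l -> is_derive (fun s => p (f s)) t (p l).
Proof.
intros Hp Hm Hr H; apply is_derive_Reals; intros eps He.
destruct (H (eps/2)%R) as [d [Hd K]]; [lra|].
exists (mkposreal d Hd); intros h Hh0 Hh.
specialize (K (t + h)%R). rewrite <- RtoC_minus in K.
replace (t + h - t)%R with h in K by ring. rewrite Cmod_R in K. specialize (K Hh).
assert (A := Hp (f (t + h)%R - f t - RtoC h * l)). rewrite !Hm, Hr in A.
replace ((p (f (t + h)%R) - p (f t)) / h - p l)%R with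
  ((p (f (t + h)%R) - p (f t) - h * p l) / h)%R by (field; auto).
rewrite Rabs_div by auto. assert (P := Rabs_pos_lt h Hh0).
apply Rmult_lt_reg_r with (Rabs h); [auto|].
unfold Rdiv; rewrite Rmult_assoc, Rinv_l by lra; nra.
Qed.

Lemma rder_Re f t l : rder f t l -> is_derive (fun s => Re (f s)) t (Re l).
Proof. apply rder_projection; [apply re_le_Cmod | |]; intros; unfold Re; simpl; ring. Qed.

Lemma rder_Im f t l : rder f t l -> is_derive (fun s => Im (f s)) t (Im l).
Proof. apply rder_projection; [apply Im_le_Cmod | |]; intros; unfold Im; simpl; ring. Qed.

Lemma mono_le (f df : R -> R) a b : (a <= b)%R ->
  (forall t, (a <= t <= b)%R -> is_derive f t (df t)) ->
  (forall t, (a <= t <= b)%R -> (0 <= df t)%R) -> (f a <= f b)%R.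
Proof.
intros Hab H1 H2.
destruct (MVT_gen f a b df) as [c [Hc E]].
- intros x Hx; rewrite Rmin_left, Rmax_right in Hx by auto; apply H1; lra.
- intros x Hx; rewrite Rmin_left, Rmax_right in Hx by auto.
  apply continuity_pt_filterlim. apply (ex_derive_continuous (V := R_NormedModule)).
  eexists; apply H1; lra.
- rewrite Rmin_left, Rmax_right in Hc by auto. specialize (H2 c Hc). nra.
Qed.

(** The mean value inequality fails to give a point for complex values; it is
    applied to the real and to the imaginary part, which costs a factor 2. *)
Lemma rder_dominated (f df : R -> C) (g dg : R -> R) a b : (a <= b)%R ->
  (forall t, (a <= t <= b)%R -> rder f t (df t)) ->
  (forall t, (a <= t <= b)%R -> is_derive g t (dg t)) ->
  (forall t, (a <= t <= b)%R -> (Cmod (df t) <= dg t)%R) ->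
  (Cmod (f b - f a) <= 2 * (g b - g a))%R.
Proof.
intros Hab Hf Hg Hd.
assert (key : forall (phi dphi : R -> R),
  (forall t, (a <= t <= b)%R -> is_derive phi t (dphi t)) ->
  (forall t, (a <= t <= b)%R -> (Rabs (dphi t) <= dg t)%R) ->
  (Rabs (phi b - phi a) <= g b - g a)%R).
{ intros phi dphi H1 H2.
  assert (A : (g a - phi a <= g b - phi b)%R).
  { apply (mono_le (fun t => g t - phi t)%R (fun t => dg t - dphi t)%R); auto.
    - intros t Ht; apply (is_derive_minus (V := R_NormedModule)); auto.
    - intros t Ht; specialize (H2 t Ht). assert (Q := Rle_abs (dphi t)); lra. }
  assert (B : (g a + phi a <= g b + phi b)%R).
  { apply (mono_le (fun t => g t + phi t)%R (fun t => dg t + dphi t)%R); auto.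
    - intros t Ht; apply (is_derive_plus (V := R_NormedModule)); auto.
    - intros t Ht; specialize (H2 t Ht). assert (Q := Rabs_maj2 (dphi t)); lra. }
  apply Rabs_le; lra. }
eapply Rle_trans; [apply Cmod_le_ReIm|].
assert (A := key (fun t => Re (f t)) (fun t => Re (df t))).
assert (B := key (fun t => Im (f t)) (fun t => Im (df t))).
replace (Re (f b - f a)) with (Re (f b) - Re (f a))%R by (unfold Re, Im; simpl; ring).
replace (Im (f b - f a)) with (Im (f b) - Im (f a))%R by (unfold Re, Im; simpl; ring).
assert (A' := A (fun t Ht => rder_Re _ _ _ (Hf t Ht))
  (fun t Ht => Rle_trans _ _ _ (re_le_Cmod _) (Hd t Ht))).
assert (B' := B (fun t Ht => rder_Im _ _ _ (Hf t Ht))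
  (fun t Ht => Rle_trans _ _ _ (Im_le_Cmod _) (Hd t Ht))).
lra.
Qed.

Definition seg (x y : C) (t : R) : C := x + RtoC t * (y - x).

Lemma cder_mean_value f df x y M :
  (forall t, (0 <= t <= 1)%R -> cder f (seg x y t) (df (seg x y t))) ->
  (forall t, (0 <= t <= 1)%R -> (Cmod (df (seg x y t)) <= M)%R) ->
  (Cmod (f y - f x) <= 2 * M * Cmod (y - x))%R.
Proof.
intros H1 H2.
assert (A := rder_dominated (fun t => f (seg x y t)) (fun t => df (seg x y t) * (y - x))
  (fun t => M * Cmod (y - x) * t)%R (fun t => M * Cmod (y - x))%R 0 1 Rle_0_1).
cbv beta in A.
replace (seg x y 1) with y in A by (unfold seg; ring).
replace (seg x y 0) with x in A by (unfold seg; ring).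
assert (B : (Cmod (f y - f x) <= 2 * (M * Cmod (y - x) * 1 - M * Cmod (y - x) * 0))%R).
{ apply A.
  - intros t Ht; apply (deriv_comp f (seg x y)); [apply rder_line | auto].
  - intros t Ht; auto_derive; [exact I | ring].
  - intros t Ht; rewrite Cmod_mult; apply Rmult_le_compat_r; [apply Cmod_ge_0 | auto]. }
lra.
Qed.

(** The mean value inequality for [f v - v * f1 x], whose derivative is bounded
    by the mean value inequality for [f1]. *)
Lemma cder_taylor f f1 f2 x y M :
  (forall t, (0 <= t <= 1)%R -> cder f (seg x y t) (f1 (seg x y t))) ->
  (forall t, (0 <= t <= 1)%R -> cder f1 (seg x y t) (f2 (seg x y t))) ->
  (forall t, (0 <= t <= 1)%R -> (Cmod (f2 (seg x y t)) <= M)%R) ->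
  (Cmod (f y - f x - (y - x) * f1 x) <= 4 * M * Cmod (y - x) ^ 2)%R.
Proof.
intros H1 H2 H3.
assert (HM : (0 <= M)%R) by (eapply Rle_trans; [apply Cmod_ge_0 | apply (H3 0%R); lra]).
assert (A := cder_mean_value (fun v => f v - v * f1 x) (fun v => f1 v - 1 * f1 x) x y
  (2 * M * Cmod (y - x))).
replace (f y - f x - (y - x) * f1 x) with (f y - y * f1 x - (f x - x * f1 x)) by ring.
assert (P := Cmod_ge_0 (y - x)).
assert (B : (Cmod (f y - y * f1 x - (f x - x * f1 x)) <= 2 * (2 * M * Cmod (y - x)) * Cmod (y - x))%R).
{ apply A.
  - intros t Ht; apply deriv_minus; [auto|].
    apply deriv_eq with (1 * f1 x + seg x y t * 0); [ring|].
    apply (deriv_mult (fun v => v) (fun _ => f1 x)); [apply cder_id | apply deriv_const].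
  - intros t Ht. replace (f1 (seg x y t) - 1 * f1 x) with (f1 (seg x y t) - f1 x) by ring.
    assert (S : forall s, seg x (seg x y t) s = seg x y (s * t)).
    { intros s; unfold seg; rewrite RtoC_mult; ring. }
    eapply Rle_trans.
    + apply (cder_mean_value f1 f2 x (seg x y t) M).
      * intros s Hs; rewrite S; apply H2; nra.
      * intros s Hs; rewrite S; apply H3; nra.
    + replace (seg x y t - x) with (RtoC t * (y - x)) by (unfold seg; ring).
      rewrite Cmod_mult, Cmod_R, Rabs_pos_eq by lra.
      apply Rmult_le_compat_l; nra. }
replace (4 * M * Cmod (y - x) ^ 2)%R with (2 * (2 * M * Cmod (y - x)) * Cmod (y - x))%R by ring.
exact B.
Qed.

(** * Exponential and logarithm *)

Lemma Cexp_0 : Cexp 0 = 1.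
Proof. unfold Cexp; simpl; rewrite exp_0, cos_0, sin_0; apply C_eq; simpl; ring. Qed.

Lemma Cexp_plus a b : Cexp (a + b) = Cexp a * Cexp b.
Proof.
destruct a as [a1 a2], b as [b1 b2]; apply C_eq; simpl; rewrite exp_plus, ?cos_plus, ?sin_plus; ring.
Qed.

Lemma Cexp_RtoC r : Cexp (RtoC r) = RtoC (exp r).
Proof. unfold Cexp; simpl; rewrite cos_0, sin_0; apply C_eq; simpl; ring. Qed.

Lemma Cmod_Cexp a : Cmod (Cexp a) = exp (Re a).
Proof.
unfold Cmod, Cexp; simpl.
replace (_ + _)%R with (exp (Re a) ^ 2)%R.
- apply sqrt_pow2; left; apply exp_pos.
- assert (H := sin2_cos2 (Im a)); unfold Rsqr in H.
  transitivity (exp (Re a) ^ 2 * (sin (Im a) * sin (Im a) + cos (Im a) * cos (Im a)))%R; [rewrite H|]; ring.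
Qed.

Lemma Cexp_neq0 (a : C) : Cexp a <> 0.
Proof.
intros H; assert (A := Cmod_Cexp a); rewrite H, Cmod_0 in A.
assert (B := exp_pos (Re a)); lra.
Qed.

Lemma Cexp_opp a : Cexp (- a) * Cexp a = 1.
Proof. rewrite <- Cexp_plus; replace (- a + a) with (RtoC 0) by ring; apply Cexp_0. Qed.

Lemma Cexp_pow a n : Cexp a ^ n = Cexp (INR n * a).
Proof.
induction n as [|n IH].
- simpl; replace (0 * a) with (RtoC 0) by ring; rewrite Cexp_0; reflexivity.
- rewrite S_INR, RtoC_plus. change (Cexp a ^ S n) with (Cexp a * Cexp a ^ n).
  rewrite IH, <- Cexp_plus; f_equal; ring.
Qed.

Lemma derive_bound (f : R -> R) l : is_derive f 0%R l -> forall eps, (0 < eps)%R ->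
  exists d, (0 < d)%R /\ forall h, (Rabs h < d)%R -> (Rabs (f h - f 0 - h * l) <= eps * Rabs h)%R.
Proof.
intros H eps He.
destruct H as [_ H]; specialize (H 0%R (fun P HP => HP) (mkposreal eps He)).
destruct H as [d Hd]; exists d; split; [apply cond_pos|]; intros h Hh.
assert (A : (norm (minus (minus (f h) (f 0)) (scal (minus h 0) l)) <= eps * norm (minus h 0))%R).
{ apply Hd. change (Rabs (h - 0) < d)%R. rewrite Rminus_0_r; exact Hh. }
change (Rabs (f h - f 0 - (h - 0) * l) <= eps * Rabs (h - 0))%R in A.
rewrite !Rminus_0_r in A; exact A.
Qed.

(** From the derivatives of [exp], [cos] and [sin] at 0, with remainders bounded
    by [e] times the increment. *)
Lemma cder_Cexp_0 : cder Cexp 0 1.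
Proof.
intros eps He; set (e := Rmin 1 (eps / 8)%R).
assert (He' : (0 < e)%R) by (apply Rmin_pos; lra).
assert (E1 := Rmin_l 1 (eps / 8)); assert (E2 := Rmin_r 1 (eps / 8)); fold e in E1, E2.
destruct (derive_bound exp 1) with (eps := e) as [d1 [Hd1 K1]]; [auto_derive; [exact I|rewrite exp_0; ring] | auto |].
destruct (derive_bound cos 0) with (eps := e) as [d2 [Hd2 K2]]; [auto_derive; [exact I|rewrite sin_0; ring] | auto |].
destruct (derive_bound sin 1) with (eps := e) as [d3 [Hd3 K3]]; [auto_derive; [exact I|rewrite cos_0; ring] | auto |].
exists (Rmin (Rmin 1 (e/2)) (Rmin d1 (Rmin d2 d3))).
split; [repeat apply Rmin_pos; lra|]; intros y Hy.
rewrite Cexp_0. replace (y - 0) with y in * by ring.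
use_Rmin.
assert (A := re_le_Cmod y); assert (B := Im_le_Cmod y).
destruct y as [a b]; simpl in A, B.
set (m := Cmod (a, b)) in *.
specialize (K1 a ltac:(lra)); specialize (K2 b ltac:(lra)); specialize (K3 b ltac:(lra)).
rewrite exp_0 in K1; rewrite cos_0 in K2; rewrite sin_0 in K3.
assert (Pa := Rabs_pos a); assert (Pb := Rabs_pos b).
assert (Q1 : (Rabs (exp a - 1) <= 2 * Rabs a)%R).
{ replace (exp a - 1)%R with ((exp a - 1 - a * 1) + a)%R by ring.
  eapply Rle_trans; [apply Rabs_triang|]; nra. }
assert (Q2 : (Rabs (sin b) <= 2 * Rabs b)%R).
{ replace (sin b)%R with ((sin b - 0 - b * 1) + b)%R by ring.
  eapply Rle_trans; [apply Rabs_triang|]; nra. }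
assert (Q3 : (0 < exp a <= 3)%R).
{ split; [apply exp_pos|]. assert (T := Rle_abs (exp a - 1)); lra. }
eapply Rle_trans; [apply Cmod_le_ReIm|].
simpl.
replace (exp a * cos b + - (1) + - (a * 1 - b * 0))%R with (exp a * (cos b - 1 - b * 0) + (exp a - 1 - a * 1))%R by ring.
replace (exp a * sin b + - 0 + - (a * 0 + b * 1))%R with ((exp a - 1) * sin b + (sin b - 0 - b * 1))%R by ring.
assert (T1 := Rabs_triang (exp a * (cos b - 1 - b * 0)) (exp a - 1 - a * 1)).
assert (T2 := Rabs_triang ((exp a - 1) * sin b) (sin b - 0 - b * 1)).
rewrite Rabs_mult in T1; rewrite Rabs_mult in T2. rewrite (Rabs_pos_eq (exp a)) in T1 by lra.
assert (U1 : (exp a * Rabs (cos b - 1 - b * 0) <= 3 * (e * Rabs b))%R).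
{ apply Rmult_le_compat; try apply Rabs_pos; lra. }
assert (U2 : (Rabs (exp a - 1) * Rabs (sin b) <= (2 * (e/2)) * (2 * Rabs b))%R).
{ apply Rmult_le_compat; try apply Rabs_pos; lra. }
assert (V1 : (e * Rabs a <= eps / 8 * m)%R) by (apply Rmult_le_compat; lra).
assert (V2 : (e * Rabs b <= eps / 8 * m)%R) by (apply Rmult_le_compat; lra).
assert (V3 : (0 <= eps * m)%R) by (apply Rmult_le_pos; lra).
lra.
Qed.

Lemma cder_Cexp x : cder Cexp x (Cexp x).
Proof.
apply deriv_ext with (fun y => Cexp x * Cexp (y - x)).
{ intros y; rewrite <- Cexp_plus; f_equal; ring. }
apply deriv_eq with (Cexp x * (1 * (1 - 0))); [ring|].
apply deriv_scal, deriv_comp with (F := Cexp) (g := fun y => y - x).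
- apply deriv_minus; [apply cder_id | apply deriv_const].
- replace (x - x) with (RtoC 0) by ring; apply cder_Cexp_0.
Qed.

Lemma cder_Cexp_comp f x l : cder f x l -> cder (fun y => Cexp (f y)) x (Cexp (f x) * l).
Proof. intros H; apply deriv_comp; [exact H | apply cder_Cexp]. Qed.

#[export] Hint Resolve cder_Cexp cder_Cexp_comp : deriv.

Lemma Cmod_sub_ge x y : (Cmod y >= Cmod x - Cmod (y - x))%R.
Proof.
assert (H := Cmod_triangle y (x - y)). replace (y + (x - y)) with x in H by ring.
replace (x - y) with (- (y - x)) in H by ring; rewrite Cmod_opp in H; lra.
Qed.

Lemma cder_inv (x : C) : x <> 0 -> cder (fun y => / y) x (- / (x * x)).
Proof.
intros Hx eps He. assert (Hm := proj1 (Cmod_gt_0 x) Hx). set (m := Cmod x) in *.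
assert (Hm3 : (0 < m * m * m)%R) by (repeat apply Rmult_lt_0_compat; auto).
exists (Rmin (m/2) (eps * (m*m*m) / 2)); split; [apply Rmin_pos; [lra|]; assert (0 < eps * (m*m*m))%R by (apply Rmult_lt_0_compat; auto); lra|].
intros y Hy.
use_Rmin.
assert (Hym := Cmod_sub_ge x y); fold m in Hym.
assert (Hy0 : y <> 0) by (apply Cmod_gt_0; lra).
replace (/ y - / x - (y - x) * - / (x * x)) with ((y - x) * ((y - x) / (x * x * y))) by (field; auto).
rewrite Cmod_mult, Cmod_div, !Cmod_mult by (repeat apply Cmult_neq_0; auto).
fold m. rewrite Rmult_comm; apply Rmult_le_compat_r; [apply Cmod_ge_0|].
apply Rle_div_l; [apply Rmult_lt_0_compat; nra|].
assert (Q : (eps * (m * m * (m / 2)) <= eps * (m * m * Cmod y))%R).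
{ apply Rmult_le_compat_l; [lra|]. apply Rmult_le_compat_l; nra. }
lra.
Qed.

Lemma cder_inv_comp (f : C -> C) (x l : C) : f x <> 0 -> cder f x l -> cder (fun y => / f y) x (- / (f x * f x) * l).
Proof. intros H0 H; apply (deriv_comp (fun y => / y)); [exact H | apply cder_inv, H0]. Qed.

Definition slit (x : C) : Prop := (0 < Re x)%R \/ Im x <> 0%R.

Lemma slit_pos x : slit x -> (0 < Re x + Cmod x)%R.
Proof.
intros H. assert (A := re_le_Cmod x). assert (B := Cmod2_alt x). assert (P := Cmod_ge_0 x).
destruct H as [H|H].
- lra.
- assert (Q : (0 < Im x ^ 2)%R) by (apply pow2_gt_0; auto).
  assert (T := Rcomplements.Rabs_le_between (Re x) (Cmod x)). apply T in A.
  destruct (Req_dec (Re x + Cmod x) 0) as [E|E]; [|lra].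
  assert (E' : Re x = (- Cmod x)%R) by lra. rewrite E' in B. nra.
Qed.

Lemma slit_neq0 (x : C) : slit x -> x <> 0.
Proof. intros [H|H] ->; simpl in H; lra. Qed.

(** With [t = tan (arg / 2) = Im x / (Re x + |x|)], the half-angle formulas give
    [cos arg = (1 - t^2) / (1 + t^2)] and [sin arg = 2 t / (1 + t^2)]. *)
Lemma Cexp_Clog x : slit x -> Cexp (Clog x) = x.
Proof.
intros H. assert (P := slit_pos x H). assert (N := proj1 (Cmod_gt_0 x) (slit_neq0 x H)).
assert (E := Cmod2_alt x).
unfold Cexp, Clog; simpl. rewrite exp_ln by auto.
set (a := Re x) in *; set (b := Im x) in *; set (r := Cmod x) in *.
set (t := (b / (a + r))%R).
rewrite cos_2a, sin_2a, cos_atan, sin_atan.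
assert (S : (1 + t² = 2 * r / (a + r))%R).
{ unfold Rsqr, t. apply Rmult_eq_reg_r with ((a + r) * (a + r))%R; [|nra].
  field_simplify; [|lra|lra]. nra. }
assert (S0 : (0 < 1 + t²)%R) by (assert (Q := Rle_0_sqr t); lra).
assert (Q := sqrt_sqrt (1 + t²) ltac:(lra)).
assert (Qp := sqrt_lt_R0 _ S0).
set (q := sqrt (1 + t²)) in *.
apply C_eq; simpl; fold a b.
- replace (1 / q * (1 / q) - t / q * (t / q))%R with ((1 - t * t) / (q * q))%R by (field; lra).
  rewrite Q, S. unfold t.
  replace (1 - b / (a + r) * (b / (a + r)))%R with (((a + r) * (a+r) - b * b) / ((a + r) * (a+r)))%R by (field; lra).
  replace ((a + r) * (a + r) - b * b)%R with (2 * a * (a + r))%R by nra.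
  field; lra.
- replace (2 * (t / q) * (1 / q))%R with (2 * t / (q * q))%R by (field; lra).
  rewrite Q, S. unfold t. field; lra.
Qed.

Lemma Clog_Im_bound x : (- PI < Im (Clog x) < PI)%R.
Proof. unfold Clog; simpl. assert (H := atan_bound (Im x / (Re x + Cmod x))). lra. Qed.

Lemma Clog_1 : Clog 1 = 0.
Proof.
unfold Clog. rewrite Cmod_1, ln_1. simpl. replace (0 / (1 + 1))%R with 0%R by field.
rewrite atan_0. apply C_eq; simpl; ring.
Qed.

Notation CA := (AbsRing_UniformSpace C_AbsRing).

Lemma lip_continuous (f : C -> R) x : (forall y, (Rabs (f y - f x) <= Cmod (y - x))%R) ->
  continuous (T := CA) (U := R_UniformSpace) f x.
Proof.
intros H; apply filterlim_locally; intros eps.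
exists eps; intros y Hy.
change (Rabs (f y - f x) < eps)%R. change (Cmod (y - x) < eps)%R in Hy.
specialize (H y); lra.
Qed.

Lemma Clog_continuous x : slit x -> forall eps, (0 < eps)%R -> exists d, (0 < d)%R /\
  forall y, (Cmod (y - x) < d)%R -> (Cmod (Clog y - Clog x) < eps)%R.
Proof.
intros H eps He. assert (P := slit_pos x H). assert (N := proj1 (Cmod_gt_0 x) (slit_neq0 x H)).
assert (CR : continuous (T := CA) (U := R_UniformSpace) Re x).
{ apply lip_continuous; intros y. replace (Re y - Re x)%R with (Re (y - x)) by (unfold Re; simpl; ring). apply re_le_Cmod. }
assert (CI : continuous (T := CA) (U := R_UniformSpace) Im x).
{ apply lip_continuous; intros y. replace (Im y - Im x)%R with (Im (y - x)) by (unfold Im; simpl; ring). apply Im_le_Cmod. }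
assert (CM : continuous (T := CA) (U := R_UniformSpace) Cmod x).
{ apply lip_continuous; intros y. apply Rabs_le. assert (A := Cmod_sub_ge x y).
  assert (B := Cmod_sub_ge y x). replace (x - y) with (- (y - x)) in B by ring; rewrite Cmod_opp in B. lra. }
assert (C1 : continuous (T := CA) (U := R_UniformSpace) (fun y => ln (Cmod y)) x).
{ apply (continuous_comp (U := CA) (V := R_UniformSpace) (W := R_UniformSpace) Cmod ln); [exact CM|].
  apply (ex_derive_continuous (V := R_NormedModule)). auto_derive; auto. }
assert (C2 : continuous (T := CA) (U := R_UniformSpace) (fun y => 2 * atan (Im y / (Re y + Cmod y)))%R x).
{ apply (continuous_comp (U := CA) (V := R_UniformSpace) (W := R_UniformSpace) (fun y => Im y / (Re y + Cmod y))%R (fun s => 2 * atan s)%R).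
  - apply (continuous_mult (U := CA) (K := R_AbsRing) Im (fun y => / (Re y + Cmod y))%R); [exact CI|].
    apply (continuous_comp (U := CA) (V := R_UniformSpace) (W := R_UniformSpace) (fun y => Re y + Cmod y)%R Rinv).
    + apply (continuous_plus (U := CA) (V := R_NormedModule) Re Cmod); [exact CR | exact CM].
    + apply (ex_derive_continuous (V := R_NormedModule)). auto_derive. lra.
  - apply (ex_derive_continuous (V := R_NormedModule)). auto_derive. exact I. }
assert (F1 := proj1 (filterlim_locally _ _) C1 (mkposreal (eps/2) ltac:(lra))).
assert (F2 := proj1 (filterlim_locally _ _) C2 (mkposreal (eps/2) ltac:(lra))).
destruct F1 as [d1 F1]; destruct F2 as [d2 F2].
exists (Rmin d1 d2); split; [apply Rmin_pos; apply cond_pos|]; intros y Hy.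
use_Rmin.
specialize (F1 y ltac:(change (Cmod (y - x) < d1)%R; lra)).
specialize (F2 y ltac:(change (Cmod (y - x) < d2)%R; lra)).
change (Rabs (ln (Cmod y) - ln (Cmod x)) < eps/2)%R in F1.
change (Rabs (2 * atan (Im y / (Re y + Cmod y)) - 2 * atan (Im x / (Re x + Cmod x))) < eps/2)%R in F2.
eapply Rle_lt_trans; [apply Cmod_le_ReIm|].
unfold Clog; simpl. unfold Rminus in F1, F2. lra.
Qed.

Lemma slit_open x : slit x -> exists d, (0 < d)%R /\ forall y, (Cmod (y - x) < d)%R -> slit y.
Proof.
intros [H|H].
- exists (Re x); split; [exact H|]; intros y Hy; left.
  assert (A := re_le_Cmod (y - x)). replace (Re (y - x)) with (Re y - Re x)%R in A by (unfold Re; simpl; ring).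
  apply Rcomplements.Rabs_le_between in A; lra.
- exists (Rabs (Im x)); split; [apply Rabs_pos_lt, H|]; intros y Hy; right; intros E.
  assert (A := Im_le_Cmod (y - x)). replace (Im (y - x)) with (Im y - Im x)%R in A by (unfold Im; simpl; ring).
  rewrite E, Rminus_0_l, Rabs_Ropp in A; lra.
Qed.

(** [Clog] is a continuous right inverse of [Cexp]. *)
Lemma cder_Clog x : slit x -> cder Clog x (/ x).
Proof.
intros H eps He. assert (N := proj1 (Cmod_gt_0 x) (slit_neq0 x H)). assert (Hx0 := slit_neq0 x H).
set (m := Cmod x) in *.
destruct (slit_open x H) as [d1 [Hd1 S]].
set (eta := Rmin (1/2) (eps * m / 2)).
assert (Heta : (0 < eta)%R) by (apply Rmin_pos; [lra|]; assert (0 < eps * m)%R by (apply Rmult_lt_0_compat; auto); lra).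
assert (E1 := Rmin_l (1/2) (eps * m / 2)); assert (E2 := Rmin_r (1/2) (eps * m / 2)); fold eta in E1, E2.
destruct (cder_Cexp_0 eta Heta) as [d2 [Hd2 K]].
destruct (Clog_continuous x H d2 Hd2) as [d3 [Hd3 L]].
exists (Rmin d1 d3); split; [apply Rmin_pos; auto|]; intros y Hy.
use_Rmin.
specialize (S y ltac:(lra)); specialize (L y ltac:(lra)).
set (k := Clog y - Clog x) in *.
specialize (K k). replace (k - 0) with k in K by ring. specialize (K L).
assert (Ey : y = x * Cexp k).
{ rewrite <- (Cexp_Clog x H) at 1. rewrite <- Cexp_plus. unfold k.
  replace (Clog x + (Clog y - Clog x)) with (Clog y) by ring. symmetry; apply Cexp_Clog, S. }
rewrite Cexp_0 in K.
assert (Eq : (y - x) * / x = Cexp k - 1) by (rewrite Ey; field; auto).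
rewrite Eq.
assert (Eh : (Cmod (Cexp k - 1) = Cmod (y - x) / m)%R).
{ rewrite <- Eq, Cmod_mult, Cmod_inv by auto. reflexivity. }
replace (k - (Cexp k - 1)) with (- (Cexp k - 1 - k * 1)) by ring. rewrite Cmod_opp.
assert (B : (Cmod k <= 2 * (Cmod (y - x) / m))%R).
{ assert (T := Cmod_triangle (Cexp k - 1) (- (Cexp k - 1 - k * 1))).
  replace (Cexp k - 1 + - (Cexp k - 1 - k * 1)) with k in T by ring. rewrite Cmod_opp in T.
  assert (Pk := Cmod_ge_0 k). nra. }
eapply Rle_trans; [exact K|].
assert (Ph := Cmod_ge_0 (y - x)).
apply Rle_trans with (eps * m / 2 * (2 * (Cmod (y - x) / m)))%R.
- apply Rmult_le_compat; try apply Cmod_ge_0; lra.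
- right; field; lra.
Qed.

(** * Complex series *)

(* The components of a complex equation are sometimes terms of a structure on [R]
   that [ring] does not unfold. *)
Ltac rring := lazymatch goal with |- @eq _ ?a ?b => let H := fresh in assert (H : @eq R a b); [ring | exact H] end.

Definition csum (a : nat -> C) (l : C) : Prop :=
  is_series (fun n => Re (a n)) (Re l) /\ is_series (fun n => Im (a n)) (Im l).

Lemma csum_unique a l : csum a l -> CSeries a = l.
Proof.
intros [H1 H2]; unfold CSeries; apply C_eq; simpl; apply is_series_unique; assumption.
Qed.

Lemma csum_dom a b : (forall n, (Cmod (a n) <= b n)%R) -> ex_series b -> csum a (CSeries a).
Proof.
intros H1 H2; split; unfold CSeries; simpl; apply Series_correct;
  apply (ex_series_le (K := R_AbsRing) (V := R_CompleteNormedModule)) with b; auto; intros n;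
  (eapply Rle_trans; [|apply H1]).
- apply (re_le_Cmod (a n)).
- apply (Im_le_Cmod (a n)).
Qed.

Lemma csum_eq a l m : l = m -> csum a l -> csum a m.
Proof. intros ->; auto. Qed.

Lemma csum_ext a b l : (forall n, a n = b n) -> csum a l -> csum b l.
Proof.
intros E [H1 H2]; split.
- revert H1; apply is_series_ext; intros n; rewrite E; reflexivity.
- revert H2; apply is_series_ext; intros n; rewrite E; reflexivity.
Qed.

Lemma csum_plus a b l m : csum a l -> csum b m -> csum (fun n => a n + b n) (l + m).
Proof.
intros [H1 H2] [H3 H4]; split.
- apply (is_series_plus (K := R_AbsRing) (V := R_NormedModule)); assumption.
- apply (is_series_plus (K := R_AbsRing) (V := R_NormedModule)); assumption.
Qed.

Lemma is_series_lin (p q : R) (a b : nat -> R) (l m : R) : is_series a l -> is_series b m ->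
  is_series (fun n => p * a n + q * b n)%R (p * l + q * m)%R.
Proof.
intros H1 H2.
exact (is_series_plus _ _ _ _ (is_series_scal_l (K := R_AbsRing) p _ _ H1)
  (is_series_scal_l (K := R_AbsRing) q _ _ H2)).
Qed.

Lemma csum_scal c a l : csum a l -> csum (fun n => c * a n) (c * l).
Proof.
intros [H1 H2]; split.
- replace (Re (c * l)) with (Re c * Re l + (- Im c) * Im l)%R by (unfold Re, Im; simpl; ring).
  eapply is_series_ext; [|apply is_series_lin; eassumption].
  intros n; unfold Re, Im; simpl; ring.
- replace (Im (c * l)) with (Re c * Im l + Im c * Re l)%R by (unfold Re, Im; simpl; ring).
  eapply is_series_ext; [|apply is_series_lin; eassumption].
  intros n; unfold Re, Im; simpl; ring.
Qed.

Lemma csum_minus a b l m : csum a l -> csum b m -> csum (fun n => a n - b n) (l - m).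
Proof.
intros H1 H2. apply csum_eq with (l + - (1) * m); [ring|].
apply csum_ext with (fun n => a n + - (1) * b n); [intros; ring|].
apply csum_plus; [|apply csum_scal]; assumption.
Qed.

Lemma csum_bound a b l s : csum a l -> (forall n, (Cmod (a n) <= b n)%R) -> is_series b s ->
  (Cmod l <= 2 * s)%R.
Proof.
intros [H1 H2] H3 H4.
assert (key : forall f x, is_series f x -> (forall n, (Rabs (f n) <= b n)%R) -> (Rabs x <= s)%R).
{ intros f x Hf Hb.
  assert (E : ex_series (fun n => Rabs (f n))).
  { apply (ex_series_le (K := R_AbsRing) (V := R_CompleteNormedModule)) with b; [|exists s; exact H4].
    intros n; change (Rabs (Rabs (f n)) <= b n)%R; rewrite Rabs_Rabsolu; auto. }
  rewrite <- (is_series_unique _ _ Hf), <- (is_series_unique _ _ H4).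
  eapply Rle_trans; [apply Series_Rabs, E|].
  apply Series_le; [|exists s; exact H4]. intros n; split; [apply Rabs_pos | auto]. }
eapply Rle_trans; [apply Cmod_le_ReIm|].
assert (A := key _ _ H1 (fun n => Rle_trans _ _ _ (re_le_Cmod _) (H3 n))).
assert (B := key _ _ H2 (fun n => Rle_trans _ _ _ (Im_le_Cmod _) (H3 n))).
lra.
Qed.

Lemma csum_cons a l : csum (fun n => a (S n)) l <-> csum a (a O + l).
Proof.
split; intros [H1 H2]; split.
- apply (is_series_decr_1 (K := R_AbsRing) (V := R_NormedModule)).
  apply (eq_rect _ (is_series _) H1).
  unfold Re, plus, opp; simpl; rring.
- apply (is_series_decr_1 (K := R_AbsRing) (V := R_NormedModule)).
  apply (eq_rect _ (is_series _) H2).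
  unfold Im, plus, opp; simpl; rring.
- apply (is_series_incr_1 (K := R_AbsRing) (V := R_NormedModule) (fun n => Re (a n))).
  apply (eq_rect _ (is_series _) H1).
  unfold Re, plus; simpl; rring.
- apply (is_series_incr_1 (K := R_AbsRing) (V := R_NormedModule) (fun n => Im (a n))).
  apply (eq_rect _ (is_series _) H2).
  unfold Im, plus; simpl; rring.
Qed.

Fixpoint psum (a : nat -> C) (n : nat) : C :=
  match n with O => 0 | S k => psum a k + a k end.

Lemma csum_tail a l N : csum a l -> csum (fun n => a (N + n)%nat) (l - psum a N).
Proof.
intros H; induction N as [|N IH]; simpl.
- apply csum_eq with l; [ring | exact H].
- apply csum_ext with (fun n => a (N + S n)%nat); [intros n; f_equal; lia|].
  apply (csum_cons (fun n => a (N + n)%nat)).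
  apply csum_eq with (l - psum a N); [rewrite Nat.add_0_r; ring | exact IH].
Qed.

Lemma cder_psum (f f' : nat -> C -> C) x N : (forall n, cder (f n) x (f' n x)) ->
  cder (fun y => psum (fun n => f n y) N) x (psum (fun n => f' n x) N).
Proof.
intros H; induction N as [|N IH]; simpl; [apply deriv_const | apply deriv_plus; auto].
Qed.

Lemma series_tail_small (b : nat -> R) : ex_series b -> forall eps, (0 < eps)%R ->
  exists N s, is_series (fun n => b (N + n)%nat) s /\ (s < eps)%R.
Proof.
intros [l H] eps He.
assert (F := proj1 (filterlim_locally _ _) H (mkposreal eps He)).
destruct F as [N F]. specialize (F N (Nat.le_refl N)).
change (Rabs (sum_n b N - l) < eps)%R in F.
exists (S N), (l - sum_n b N)%R; split.
- apply (is_series_incr_n (K := R_AbsRing) (V := R_NormedModule)); [lia|].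
  assert (E : forall p q : R, plus (p - q)%R q = p) by (intros p q; change (p - q + q = p)%R; ring).
  simpl pred; rewrite E; exact H.
- apply Rcomplements.Rabs_lt_between in F; lra.
Qed.

(** Termwise differentiation under a summable bound [M] of the derivatives.  The
    difference quotients of the terms are bounded by [2 M] as well, hence the
    tails contribute at most [3] times a small tail of [M], with a further
    factor 2 from [csum_bound]; the remaining sum is finite. *)
Lemma cder_series (f f' : nat -> C -> C) (M : nat -> R) (S S' : C -> C) (x : C) (r : R) :
  (0 < r)%R ->
  (forall n y, (Cmod (y - x) < r)%R -> cder (f n) y (f' n y)) ->
  (forall n y, (Cmod (y - x) < r)%R -> (Cmod (f' n y) <= M n)%R) ->
  ex_series M ->
  (forall y, (Cmod (y - x) < r)%R -> csum (fun n => f n y) (S y)) ->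
  csum (fun n => f' n x) (S' x) ->
  cder S x (S' x).
Proof.
intros Hr Hd Hb HM HS HS' eps He.
assert (Hxx : (Cmod (x - x) < r)%R) by (replace (x - x) with (RtoC 0) by ring; rewrite Cmod_0; auto).
destruct (series_tail_small M HM (eps / 12)%R) as [N [s [Hs Hs']]]; [lra|].
destruct (cder_psum f f' x N (fun n => Hd n x Hxx) (eps / 2)%R) as [d [Hd0 K]]; [lra|].
exists (Rmin d r); split; [apply Rmin_pos; auto|]; intros y Hy.
use_Rmin.
specialize (K y ltac:(lra)). assert (Hyr : (Cmod (y - x) < r)%R) by lra.
assert (T := csum_tail _ _ N (csum_minus _ _ _ _ (csum_minus _ _ _ _ (HS y Hyr) (HS x Hxx))
   (csum_scal (y - x) _ _ HS'))).
cbv beta in T.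
assert (B := csum_bound _ (fun n => Cmod (y - x) * 3 * M (N + n)%nat)%R _ (Cmod (y - x) * 3 * s)%R T).
assert (P := Cmod_ge_0 (y - x)).
assert (Ep : psum (fun n => f n y - f n x - (y - x) * f' n x) N =
  psum (fun n => f n y) N - psum (fun n => f n x) N - (y - x) * psum (fun n => f' n x) N).
{ clear; induction N as [|N IH]; simpl; [ring | rewrite IH; ring]. }
rewrite Ep in B.
replace (S y - S x - (y - x) * S' x) with
  ((S y - S x - (y - x) * S' x - (psum (fun n => f n y) N - psum (fun n => f n x) N - (y - x) * psum (fun n => f' n x) N))
  + (psum (fun n => f n y) N - psum (fun n => f n x) N - (y - x) * psum (fun n => f' n x) N)) by ring.
eapply Rle_trans; [apply Cmod_triangle|].
eapply Rle_trans; [apply Rplus_le_compat; [apply B | exact K]|].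
- intros n.
  assert (Hseg : forall t, (0 <= t <= 1)%R -> (Cmod (seg x y t - x) < r)%R).
  { intros t Ht. replace (seg x y t - x) with (RtoC t * (y - x)) by (unfold seg; ring).
    rewrite Cmod_mult, Cmod_R, Rabs_pos_eq by lra. nra. }
  assert (V := cder_mean_value (f (N + n)%nat) (f' (N + n)%nat) x y (M (N + n)%nat)
     (fun t Ht => Hd _ _ (Hseg t Ht)) (fun t Ht => Hb _ _ (Hseg t Ht))).
  assert (W := Hb (N + n)%nat x Hxx).
  eapply Rle_trans; [apply (Cmod_triangle _ (- _))|].
  rewrite Cmod_opp, Cmod_mult. nra.
- apply (is_series_scal_l (K := R_AbsRing) (Cmod (y - x) * 3)%R _ _ Hs).
- nra.
Qed.

(** * Power series of exponential type *)

Lemma exp_series x : is_series (fun k => x ^ k / INR (fact k))%R (exp x).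
Proof.
assert (H := is_exp_Reals x). unfold is_pseries in H. revert H; apply is_series_ext; intros n.
rewrite pow_n_pow. reflexivity.
Qed.

Lemma INR_le_pow2 n : (INR n <= 2 ^ n)%R.
Proof.
induction n as [|n IH]; [simpl; lra|]. rewrite S_INR; simpl.
assert (1 <= 2 ^ n)%R by (apply pow_R1_Rle; lra). lra.
Qed.

Lemma INR_fact_pos n : (0 < INR (fact n))%R.
Proof. apply lt_0_INR, lt_O_fact. Qed.

Definition pser (c : nat -> R) (y : C) : C := CSeries (fun k => RtoC (c k) * y ^ k).

(** The sum of a series with [coef_le A K] is [O(exp (K |y|))].  Under the
    Hankel integral it is multiplied by [exp x] with [Re x] tending to minus
    infinity, and evaluated at [y] proportional to [x]: only [K] arbitrarily
    small ensures convergence there, which is the role of [min_type].  The second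
    factor is evaluated near 0 when [x] is large, and [exp_type] is enough. *)
Definition coef_le (A K : R) (c : nat -> R) : Prop :=
  forall k, (Rabs (c k) <= A * (K ^ k / INR (fact k)))%R.
Definition exp_type (c : nat -> R) : Prop := exists A K, (0 <= A)%R /\ (0 <= K)%R /\ coef_le A K c.
Definition min_type (c : nat -> R) : Prop :=
  forall K, (0 < K)%R -> exists A, (0 <= A)%R /\ coef_le A K c.

Lemma min_type_exp_type c : min_type c -> exp_type c.
Proof. intros H; destruct (H 1%R Rlt_0_1) as [A [HA B]]; exists A, 1%R; repeat split; auto; lra. Qed.

Lemma term_le A K c y k : coef_le A K c ->
  (Cmod (RtoC (c k) * y ^ k) <= A * ((K * Cmod y) ^ k / INR (fact k)))%R.
Proof.
intros H. rewrite Cmod_mult, Cmod_R, Cmod_pow, Rpow_mult_distr.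
specialize (H k). assert (P := pow_le (Cmod y) k (Cmod_ge_0 y)).
apply Rle_trans with (A * (K ^ k / INR (fact k)) * Cmod y ^ k)%R.
- apply Rmult_le_compat_r; auto.
- right; field. apply INR_fact_neq_0.
Qed.

Lemma exp_series_scal A x : is_series (fun k => A * (x ^ k / INR (fact k)))%R (A * exp x)%R.
Proof. apply (is_series_scal_l (K := R_AbsRing) A _ _ (exp_series x)). Qed.

Lemma pser_csum c y : exp_type c -> csum (fun k => RtoC (c k) * y ^ k) (pser c y).
Proof.
intros [A [K [HA [HK H]]]].
apply csum_dom with (fun k => A * ((K * Cmod y) ^ k / INR (fact k)))%R.
- intros n; apply term_le, H.
- eexists; apply exp_series_scal.
Qed.

Lemma pser_bound A K c y : (0 <= A)%R -> (0 <= K)%R -> coef_le A K c ->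
  (Cmod (pser c y) <= 2 * (A * exp (K * Cmod y)))%R.
Proof.
intros HA HK H.
apply csum_bound with (fun k => RtoC (c k) * y ^ k) (fun k => A * ((K * Cmod y) ^ k / INR (fact k)))%R.
- apply pser_csum; exists A, K; auto.
- intros n; apply term_le, H.
- apply exp_series_scal.
Qed.

Lemma pser_unique c y l : csum (fun k => RtoC (c k) * y ^ k) l -> pser c y = l.
Proof. apply csum_unique. Qed.

Lemma pser_ext c d y : (forall k, c k = d k) -> exp_type d -> pser c y = pser d y.
Proof.
intros E H; apply pser_unique. apply csum_ext with (fun k => RtoC (d k) * y ^ k).
- intros n; rewrite E; reflexivity.
- apply pser_csum, H.
Qed.

(** [theta], [shift] and [dcoef] act on the coefficients as [y d/dy],
    multiplication by [y] and [d/dy] act on the sums. *)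
Definition theta (c : nat -> R) (k : nat) : R := (INR k * c k)%R.
Definition shift (c : nat -> R) (k : nat) : R := match k with O => 0%R | S j => c j end.
Definition unshift (c : nat -> R) (k : nat) : R := c (S k).
Definition dcoef (c : nat -> R) : nat -> R := unshift (theta c).

Lemma exp_type_plus c d : exp_type c -> exp_type d -> exp_type (fun k => c k + d k)%R.
Proof.
intros [A [K [HA [HK H]]]] [B [L [HB [HL I]]]].
exists (A + B)%R, (K + L)%R; repeat split; try lra; intros k.
eapply Rle_trans; [apply Rabs_triang|]. specialize (H k); specialize (I k).
assert (P := Rinv_0_lt_compat _ (INR_fact_pos k)).
assert (Q1 := pow_incr K (K + L) k ltac:(lra)). assert (Q2 := pow_incr L (K + L) k ltac:(lra)).
unfold Rdiv in *. rewrite Rmult_plus_distr_r.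
apply Rplus_le_compat; (eapply Rle_trans; [eassumption|]);
  apply Rmult_le_compat_l; auto; apply Rmult_le_compat_r; lra.
Qed.

Lemma coef_le_scal a A K c : coef_le A K c -> coef_le (Rabs a * A) K (fun k => a * c k)%R.
Proof.
intros H k; rewrite Rabs_mult, Rmult_assoc. apply Rmult_le_compat_l; [apply Rabs_pos | apply H].
Qed.

Lemma exp_type_scal a c : exp_type c -> exp_type (fun k => a * c k)%R.
Proof.
intros [A [K [HA [HK H]]]]; exists (Rabs a * A)%R, K.
split; [apply Rmult_le_pos; [apply Rabs_pos | auto] | split; [auto | apply coef_le_scal, H]].
Qed.

Lemma coef_le_theta A K c : (0 <= A)%R -> (0 <= K)%R -> coef_le A K c -> coef_le A (2 * K) (theta c).
Proof.
intros HA HK H k; unfold theta; rewrite Rabs_mult, Rpow_mult_distr.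
rewrite Rabs_pos_eq by apply pos_INR.
apply Rle_trans with (2 ^ k * (A * (K ^ k / INR (fact k))))%R.
- apply Rmult_le_compat; [apply pos_INR | apply Rabs_pos | apply INR_le_pow2 | apply H].
- right; field; apply INR_fact_neq_0.
Qed.

Lemma coef_le_unshift A K c : (0 <= A)%R -> (0 <= K)%R -> coef_le A K c -> coef_le (A * K) K (unshift c).
Proof.
intros HA HK H k; unfold unshift. eapply Rle_trans; [apply H|]. simpl pow. rewrite Rmult_assoc.
apply Rmult_le_compat_l; [auto|]. unfold Rdiv; rewrite Rmult_assoc.
apply Rmult_le_compat_l; [auto|]. apply Rmult_le_compat_l; [apply pow_le; auto|].
apply Rinv_le_contravar; [apply INR_fact_pos|]. apply le_INR; apply fact_le; lia.
Qed.

Lemma exp_type_theta c : exp_type c -> exp_type (theta c).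
Proof.
intros [A [K [HA [HK H]]]]; exists A, (2 * K)%R; repeat split; try lra. apply coef_le_theta; auto.
Qed.

Lemma exp_type_unshift c : exp_type c -> exp_type (unshift c).
Proof.
intros [A [K [HA [HK H]]]]; exists (A * K)%R, K; repeat split; try lra.
- apply Rmult_le_pos; auto.
- apply coef_le_unshift; auto.
Qed.

Lemma exp_type_shift c : exp_type c -> exp_type (shift c).
Proof.
intros [A [K [HA [HK H]]]]; exists A, (2 * (K + 1))%R; repeat split; try lra.
intros [|k]; simpl shift.
- rewrite Rabs_R0; simpl; lra.
- eapply Rle_trans; [apply H|]. apply Rmult_le_compat_l; [auto|].
  assert (P := INR_fact_pos k). rewrite fact_simpl, mult_INR.
  assert (Q := INR_le_pow2 (S k)). assert (QS : (0 < INR (S k))%R) by (apply lt_0_INR; lia).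
  assert (T : (K ^ k <= (K + 1) ^ S k)%R).
  { apply Rle_trans with ((K + 1) ^ k)%R; [apply pow_incr; lra|]. apply Rle_pow; [lra | lia]. }
  apply Rmult_le_reg_r with (INR (S k) * INR (fact k))%R; [apply Rmult_lt_0_compat; auto|].
  unfold Rdiv. replace (K ^ k * / INR (fact k) * (INR (S k) * INR (fact k)))%R with (INR (S k) * K ^ k)%R by (field; lra).
  rewrite Rmult_assoc, Rinv_l, Rmult_1_r by (apply Rgt_not_eq, Rmult_lt_0_compat; auto).
  rewrite Rpow_mult_distr. apply Rmult_le_compat; auto; [lra | apply pow_le; lra].
Qed.

Lemma min_type_theta c : min_type c -> min_type (theta c).
Proof.
intros H K HK; destruct (H (K/2)%R) as [A [HA B]]; [lra|]. exists A; split; [auto|].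
replace K with (2 * (K / 2))%R by field. apply coef_le_theta; auto; lra.
Qed.

Lemma min_type_unshift c : min_type c -> min_type (unshift c).
Proof.
intros H K HK; destruct (H K HK) as [A [HA B]]. exists (A * K)%R; split.
- apply Rmult_le_pos; lra.
- apply coef_le_unshift; auto; lra.
Qed.

Lemma pser_plus c d y : exp_type c -> exp_type d -> pser (fun k => c k + d k)%R y = pser c y + pser d y.
Proof.
intros H1 H2; apply pser_unique.
apply csum_ext with (fun k => RtoC (c k) * y ^ k + RtoC (d k) * y ^ k).
- intros n; rewrite RtoC_plus; ring.
- apply csum_plus; apply pser_csum; auto.
Qed.

Lemma pser_scal a c y : exp_type c -> pser (fun k => a * c k)%R y = a * pser c y.
Proof.
intros H1; apply pser_unique.
apply csum_ext with (fun k => RtoC a * (RtoC (c k) * y ^ k)).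
- intros n; rewrite RtoC_mult; ring.
- apply csum_scal; apply pser_csum; auto.
Qed.

Lemma pser_unshift c y : exp_type c -> pser c y = RtoC (c O) + y * pser (unshift c) y.
Proof.
intros H; apply pser_unique.
replace (RtoC (c O)) with (RtoC (c O) * y ^ 0) by (simpl; ring).
apply (csum_cons (fun k => RtoC (c k) * y ^ k)).
apply csum_ext with (fun k => y * (RtoC (unshift c k) * y ^ k)).
- intros n; unfold unshift; simpl; ring.
- apply csum_scal, pser_csum, exp_type_unshift, H.
Qed.

Lemma pser_shift c y : exp_type c -> pser (shift c) y = y * pser c y.
Proof.
intros H; apply pser_unique.
apply csum_eq with (RtoC (shift c O) * y ^ 0 + y * pser c y); [simpl; ring|].
apply (csum_cons (fun k => RtoC (shift c k) * y ^ k)).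
apply csum_ext with (fun k => y * (RtoC (c k) * y ^ k)).
- intros n; simpl; ring.
- apply csum_scal, pser_csum, H.
Qed.

Lemma pser_theta c y : exp_type c -> pser (theta c) y = y * pser (dcoef c) y.
Proof.
intros H. rewrite pser_unshift by (apply exp_type_theta, H).
replace (theta c O) with 0%R by (unfold theta; simpl; ring). unfold dcoef; ring.
Qed.

Lemma cder_pser c y : exp_type c -> cder (pser c) y (pser (dcoef c) y).
Proof.
intros H. assert (H' := H). destruct H' as [A [K [HA [HK B]]]].
set (rho := (Cmod y + 1)%R). assert (Hrho : (1 <= rho)%R) by (unfold rho; assert (P := Cmod_ge_0 y); lra).
apply (cder_series (fun n y => RtoC (c n) * y ^ n) (fun n y => RtoC (c n) * (INR n * y ^ (n - 1)))
  (fun n => A * ((2 * K * rho) ^ n / INR (fact n)))%R (pser c) (pser (dcoef c)) y 1 Rlt_0_1).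
- intros n v _. derivative; ring.
- intros n v Hv.
  assert (Hv' : (Cmod v <= rho)%R).
  { replace v with ((v - y) + y) by ring. eapply Rle_trans; [apply Cmod_triangle|]. unfold rho; lra. }
  rewrite !Cmod_mult, !Cmod_R, Cmod_pow, (Rabs_pos_eq (INR n)) by apply pos_INR.
  assert (T := coef_le_theta A K c HA HK B n). unfold theta in T. rewrite Rabs_mult, (Rabs_pos_eq (INR n)) in T by apply pos_INR.
  rewrite Rpow_mult_distr.
  apply Rle_trans with ((A * ((2 * K) ^ n / INR (fact n))) * rho ^ n)%R; [|right; field; apply INR_fact_neq_0].
  rewrite <- Rmult_assoc, (Rmult_comm (Rabs (c n))).
  apply Rmult_le_compat; [apply Rmult_le_pos; [apply pos_INR|apply Rabs_pos] | apply pow_le, Cmod_ge_0 | exact T |].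
  apply Rle_trans with (rho ^ (n - 1))%R; [apply pow_incr; split; [apply Cmod_ge_0 | auto]|].
  apply Rle_pow; [auto | lia].
- eexists; apply exp_series_scal.
- intros v _; apply pser_csum, H.
- apply csum_eq with (RtoC (c O) * (INR 0 * y ^ (0 - 1)) + pser (dcoef c) y); [simpl; ring|].
  apply (csum_cons (fun n => RtoC (c n) * (INR n * y ^ (n - 1)))).
  apply csum_ext with (fun n => RtoC (dcoef c n) * y ^ n).
  + intros n; unfold dcoef, unshift, theta. rewrite RtoC_mult. simpl (S n - 1)%nat. rewrite Nat.sub_0_r; ring.
  + apply pser_csum, exp_type_unshift, exp_type_theta, H.
Qed.

(** In a logarithmic coordinate the derivation is [y d/dy]. *)
Lemma cder_pser_exp c (f : C -> C) x l : exp_type c -> cder f x l ->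
  cder (fun v => pser c (Cexp (f v))) x (l * pser (theta c) (Cexp (f x))).
Proof.
intros H Hf. apply deriv_eq with (pser (dcoef c) (Cexp (f x)) * (Cexp (f x) * l)).
- rewrite pser_theta by auto; ring.
- apply (deriv_comp (pser c) (fun v => Cexp (f v))); [apply cder_Cexp_comp, Hf | apply cder_pser, H].
Qed.

(** * The series of the functions Upsilon and E *)

Definition harm2 (k : nat) : R := sum_n_m (fun m => / INR m ^ 2)%R 1 k.

(** [coef_I] and [coef_IH] are the coefficients of [Upsilon1] and of the
    non-logarithmic part of [Upsilon2], as series in [z^2].  The other three come
    from [1 / Gamma (1 + m + s)], whose product with [Gamma (1 + s)] is
    [1 / ((1 + s) ... (m + s))]; up to sign they are its value and first two
    derivatives at [s = 0]. *)
Definition coef_I (k : nat) : R := (/ INR (fact k) ^ 2)%R.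
Definition coef_IH (k : nat) : R := (harmonic k / INR (fact k) ^ 2)%R.
Definition coef_e (k : nat) : R := (/ INR (fact k))%R.
Definition coef_eH (k : nat) : R := (harmonic k / INR (fact k))%R.
Definition coef_eHH (k : nat) : R := ((harmonic k ^ 2 + harm2 k) / INR (fact k))%R.

Lemma harmonic_0 : harmonic 0 = 0%R.
Proof. unfold harmonic; rewrite sum_n_m_zero by lia; reflexivity. Qed.
Lemma harm2_0 : harm2 0 = 0%R.
Proof. unfold harm2; rewrite sum_n_m_zero by lia; reflexivity. Qed.
Lemma harmonic_S k : harmonic (S k) = (harmonic k + / INR (S k))%R.
Proof. unfold harmonic; rewrite sum_n_Sm by lia; reflexivity. Qed.
Lemma harm2_S k : harm2 (S k) = (harm2 k + / INR (S k) ^ 2)%R.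
Proof. unfold harm2; rewrite sum_n_Sm by lia; reflexivity. Qed.

Lemma inv_INR_S_le1 k : (0 < / INR (S k) <= 1)%R.
Proof.
assert (H := pos_INR k). rewrite S_INR. split; [apply Rinv_0_lt_compat; lra|].
rewrite <- Rinv_1. apply Rinv_le_contravar; lra.
Qed.

Lemma harmonic_bound k : (0 <= harmonic k <= INR k)%R.
Proof.
induction k as [|k IH]; [rewrite harmonic_0; simpl; lra|].
rewrite harmonic_S, S_INR. assert (H := inv_INR_S_le1 k). rewrite S_INR in H. lra.
Qed.
Lemma harm2_bound k : (0 <= harm2 k <= INR k)%R.
Proof.
induction k as [|k IH]; [rewrite harm2_0; simpl; lra|].
rewrite harm2_S, S_INR. assert (H := inv_INR_S_le1 k). rewrite S_INR in H.
rewrite <- pow_inv. nra.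
Qed.

Lemma pow_fact_le_exp x k : (0 <= x)%R -> (x ^ k / INR (fact k) <= exp x)%R.
Proof.
intros Hx. set (a := fun k => (x ^ k / INR (fact k))%R).
assert (Ha : forall n, (0 <= a n)%R).
{ intros n; apply Rmult_le_pos; [apply pow_le; auto | left; apply Rinv_0_lt_compat, INR_fact_pos]. }
assert (HS : forall n, (sum_n a n <= exp x)%R).
{ apply is_lim_seq_incr_compare; [exact (exp_series x)|].
  intros n; rewrite sum_Sn. specialize (Ha (S n)). change (sum_n a n <= sum_n a n + a (S n))%R. lra. }
apply Rle_trans with (sum_n a k); [|apply HS].
destruct k as [|k]; [rewrite sum_O; apply Rle_refl|].
rewrite sum_Sn. change (a (S k) <= sum_n a k + a (S k))%R.
assert (P : forall n, (0 <= sum_n a n)%R).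
{ induction n as [|n IH]; [rewrite sum_O; auto | rewrite sum_Sn; change (0 <= sum_n a n + a (S n))%R; specialize (Ha (S n)); lra]. }
specialize (P k); lra.
Qed.

(** [(2 / K)^k / k!] is bounded by [exp (2 / K)], however small [K] is. *)
Lemma min_type_intro c : (forall k, (Rabs (c k) <= 2 ^ k / INR (fact k) ^ 2)%R) -> min_type c.
Proof.
intros H K HK. exists (exp (2 / K)). split; [left; apply exp_pos|]. intros k.
eapply Rle_trans; [apply H|].
assert (A := pow_fact_le_exp (2 / K) k ltac:(left; apply Rdiv_lt_0_compat; lra)).
assert (P := INR_fact_pos k). assert (Q := pow_lt K k HK).
apply Rle_trans with ((2 / K) ^ k / INR (fact k) * (K ^ k / INR (fact k)))%R.
- right. unfold Rdiv; rewrite Rpow_mult_distr, pow_inv. field. split; lra.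
- apply Rmult_le_compat_r; [|exact A]. left; apply Rdiv_lt_0_compat; auto.
Qed.

Lemma min_type_coef_I : min_type coef_I.
Proof.
apply min_type_intro; intros k; unfold coef_I. assert (P := INR_fact_pos k).
assert (Q := pow_lt _ 2 P). assert (I := Rinv_0_lt_compat _ Q).
rewrite Rabs_pos_eq by lra. assert (1 <= 2 ^ k)%R by (apply pow_R1_Rle; lra).
unfold Rdiv; nra.
Qed.

Lemma min_type_coef_IH : min_type coef_IH.
Proof.
apply min_type_intro; intros k; unfold coef_IH. assert (P := INR_fact_pos k).
assert (Q := pow_lt _ 2 P). assert (I := Rinv_0_lt_compat _ Q).
assert (B := harmonic_bound k). assert (D := INR_le_pow2 k).
rewrite Rabs_pos_eq by (apply Rmult_le_pos; lra).
apply Rmult_le_compat_r; lra.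
Qed.

Lemma exp_type_intro c M : (0 <= M)%R -> (forall k, (Rabs (c k) <= M ^ k * / INR (fact k))%R) -> exp_type c.
Proof.
intros HM H; exists 1%R, M; repeat split; try lra. intros k; rewrite Rmult_1_l; apply H.
Qed.

Lemma exp_type_coef_e : exp_type coef_e.
Proof.
apply (exp_type_intro _ 1); [lra|]; intros k; unfold coef_e. assert (I := Rinv_0_lt_compat _ (INR_fact_pos k)).
rewrite pow1, Rabs_pos_eq; lra.
Qed.

Lemma exp_type_coef_eH : exp_type coef_eH.
Proof.
apply (exp_type_intro _ 2); [lra|]; intros k; unfold coef_eH. assert (I := Rinv_0_lt_compat _ (INR_fact_pos k)).
assert (B := harmonic_bound k). assert (D := INR_le_pow2 k).
rewrite Rabs_pos_eq by (apply Rmult_le_pos; lra). apply Rmult_le_compat_r; lra.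
Qed.

Lemma exp_type_coef_eHH : exp_type coef_eHH.
Proof.
apply (exp_type_intro _ 8); [lra|]; intros k; unfold coef_eHH. assert (I := Rinv_0_lt_compat _ (INR_fact_pos k)).
assert (B := harmonic_bound k). assert (B2 := harm2_bound k). assert (D := INR_le_pow2 k).
assert (P : (0 <= harmonic k ^ 2)%R) by (apply pow2_ge_0).
rewrite Rabs_pos_eq by (apply Rmult_le_pos; lra). apply Rmult_le_compat_r; [lra|].
replace (8 ^ k)%R with (2 ^ k * (2 ^ k * 2 ^ k))%R by (rewrite <- !Rpow_mult_distr; f_equal; lra).
destruct k as [|k]; [rewrite harmonic_0, harm2_0; simpl; lra|].
assert (Q : (2 <= 2 ^ S k)%R) by (simpl; assert (1 <= 2 ^ k)%R by (apply pow_R1_Rle; lra); lra).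
set (h := harmonic (S k)) in *; set (t := (2 ^ S k)%R) in *.
assert (h ^ 2 <= t * t)%R by nra. nra.
Qed.

Lemma theta2_coef_I k : theta (theta coef_I) k = shift coef_I k.
Proof.
unfold theta, shift, coef_I. destruct k as [|k]; [simpl; ring|].
rewrite fact_simpl, mult_INR. field. repeat split; first [apply INR_fact_neq_0 | apply not_0_INR; lia].
Qed.

Lemma theta2_coef_IH k : theta (theta coef_IH) k = (shift coef_IH k + theta coef_I k)%R.
Proof.
unfold theta, shift, coef_IH, coef_I. destruct k as [|k]; [simpl; ring|].
rewrite fact_simpl, mult_INR, harmonic_S. field. repeat split; first [apply INR_fact_neq_0 | apply not_0_INR; lia].
Qed.

Lemma theta_coef_e k : theta coef_e k = shift coef_e k.
Proof.
unfold theta, shift, coef_e. destruct k as [|k]; [simpl; ring|].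
rewrite fact_simpl, mult_INR. field. repeat split; first [apply INR_fact_neq_0 | apply not_0_INR; lia].
Qed.

Lemma theta_coef_eH k : theta coef_eH k = (shift coef_eH k + shift (unshift coef_e) k)%R.
Proof.
unfold theta, shift, coef_eH, unshift, coef_e. destruct k as [|k]; [simpl; ring|].
rewrite fact_simpl, mult_INR, harmonic_S. field. repeat split; first [apply INR_fact_neq_0 | apply not_0_INR; lia].
Qed.

Lemma theta_coef_eHH k : theta coef_eHH k = (shift coef_eHH k + 2 * coef_eH k)%R.
Proof.
unfold theta, shift, coef_eH, coef_eHH. destruct k as [|k]; [rewrite harmonic_0, harm2_0; simpl; field|].
rewrite fact_simpl, mult_INR, harmonic_S, harm2_S. field. repeat split; first [apply INR_fact_neq_0 | apply not_0_INR; lia].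
Qed.

Lemma pser_theta2_coef_I y : pser (theta (theta coef_I)) y = y * pser coef_I y.
Proof.
assert (H := min_type_exp_type _ min_type_coef_I).
rewrite <- pser_shift by auto. apply pser_ext; [apply theta2_coef_I | apply exp_type_shift, H].
Qed.

Lemma pser_theta2_coef_IH y : pser (theta (theta coef_IH)) y = y * pser coef_IH y + pser (theta coef_I) y.
Proof.
assert (H := min_type_exp_type _ min_type_coef_I). assert (H' := min_type_exp_type _ min_type_coef_IH).
rewrite <- pser_shift, <- pser_plus by (auto using exp_type_shift, exp_type_theta).
apply pser_ext; [apply theta2_coef_IH | auto using exp_type_plus, exp_type_shift, exp_type_theta].
Qed.

Lemma pser_theta_coef_e y : pser (theta coef_e) y = y * pser coef_e y.
Proof.
rewrite <- pser_shift by apply exp_type_coef_e. apply pser_ext; [apply theta_coef_e | apply exp_type_shift, exp_type_coef_e].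
Qed.

Lemma pser_theta_coef_eH y : pser (theta coef_eH) y = y * pser coef_eH y + pser coef_e y - 1.
Proof.
rewrite (pser_unshift coef_e) by apply exp_type_coef_e.
replace (coef_e O) with 1%R by (unfold coef_e; simpl; field).
transitivity (y * pser coef_eH y + y * pser (unshift coef_e) y); [|ring].
assert (H := exp_type_coef_eH). assert (H' := exp_type_unshift _ exp_type_coef_e).
rewrite <- !pser_shift, <- pser_plus by (auto using exp_type_shift).
apply pser_ext; [apply theta_coef_eH | auto using exp_type_plus, exp_type_shift].
Qed.

Lemma pser_theta_coef_eHH y : pser (theta coef_eHH) y = y * pser coef_eHH y + 2 * pser coef_eH y.
Proof.
assert (H := exp_type_coef_eH). assert (H' := exp_type_coef_eHH).
rewrite <- pser_shift, <- pser_scal, <- pser_plus by (auto using exp_type_shift, exp_type_scal).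
apply pser_ext; [apply theta_coef_eHH | auto using exp_type_plus, exp_type_shift, exp_type_scal].
Qed.

Lemma Upsilon1_pser w : Upsilon1 w = pser coef_I (Cexp (2 * w)).
Proof.
unfold Upsilon1; apply csum_unique.
apply csum_ext with (fun k => RtoC (coef_I k) * Cexp (2 * w) ^ k); [|apply pser_csum, min_type_exp_type, min_type_coef_I].
intros n. unfold coef_I. rewrite RtoC_inv, RtoC_pow by (apply pow_nonzero, INR_fact_neq_0).
rewrite !Cexp_pow, mult_INR, RtoC_mult. simpl (INR 2).
replace (INR n * (2 * w)) with (RtoC (1 + 1) * INR n * w) by (replace (1 + 1)%R with 2%R by ring; ring).
unfold Cdiv. ring.
Qed.

Lemma Upsilon2_pser w : Upsilon2 w = w * pser coef_I (Cexp (2 * w)) - pser coef_IH (Cexp (2 * w)).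
Proof.
unfold Upsilon2; apply csum_unique.
apply csum_ext with (fun k => w * (RtoC (coef_I k) * Cexp (2 * w) ^ k) - RtoC (coef_IH k) * Cexp (2 * w) ^ k);
  [|apply csum_minus; [apply csum_scal|]; apply pser_csum, min_type_exp_type; [apply min_type_coef_I | apply min_type_coef_IH]].
intros n. unfold coef_I, coef_IH, Rdiv. rewrite RtoC_mult, RtoC_inv, RtoC_pow by (apply pow_nonzero, INR_fact_neq_0).
rewrite !Cexp_pow, mult_INR, RtoC_mult. simpl (INR 2).
replace (INR n * (2 * w)) with (RtoC (1 + 1) * INR n * w) by (replace (1 + 1)%R with 2%R by ring; ring).
unfold Cdiv. ring.
Qed.

(** * Primitives of entire functions *)

Lemma norm_CR (c : C) : norm (V := C_R_NormedModule) c = Cmod c.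
Proof.
unfold norm; simpl; unfold prod_norm, Cmod; f_equal; unfold norm; simpl; unfold abs; simpl.
rewrite !Rmult_1_r. rewrite <- (Rabs_mult (fst c)), <- (Rabs_mult (snd c)).
f_equal; apply Rabs_pos_eq; nra.
Qed.

Lemma rder_continuous f t l : rder f t l ->
  continuous (T := R_UniformSpace) (U := C_UniformSpace) f t.
Proof.
intros H. apply (ex_derive_continuous (V := C_R_NormedModule)).
exists l; apply rder_is_derive, H.
Qed.

Definition cint (f : R -> C) (a b : R) (l : C) : Prop :=
  is_RInt (V := C_R_NormedModule) f a b l.

Lemma cint_scal (c : C) f a b l : cint f a b l -> cint (fun t => c * f t) a b (c * l).
Proof.
intros H.
assert (H1 := is_RInt_fct_extend_fst (U := R_NormedModule) (V := R_NormedModule) _ _ _ _ H).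
assert (H2 := is_RInt_fct_extend_snd (U := R_NormedModule) (V := R_NormedModule) _ _ _ _ H).
apply (is_RInt_fct_extend_pair (U := R_NormedModule) (V := R_NormedModule)).
- assert (A := is_RInt_scal _ _ _ (fst c) _ H1). assert (B := is_RInt_scal _ _ _ (- snd c)%R _ H2).
  assert (D := is_RInt_plus _ _ _ _ _ _ A B).
  replace (fst c * fst l - snd c * snd l)%R with (fst c * fst l + - snd c * snd l)%R by ring.
  revert D; apply is_RInt_ext; intros x _. change (fst c * fst (f x) + - snd c * snd (f x) = fst c * fst (f x) - snd c * snd (f x))%R. ring.
- assert (A := is_RInt_scal _ _ _ (fst c) _ H2). assert (B := is_RInt_scal _ _ _ (snd c)%R _ H1).
  assert (D := is_RInt_plus _ _ _ _ _ _ A B).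
  revert D; apply is_RInt_ext; intros x _. reflexivity.
Qed.

Lemma cint_plus f g a b l m : cint f a b l -> cint g a b m -> cint (fun t => f t + g t) a b (l + m).
Proof. intros H1 H2; exact (is_RInt_plus _ _ _ _ _ _ H1 H2). Qed.

Lemma cint_exists f f' a b : (forall t, rder f t (f' t)) ->
  cint f a b (RInt (V := C_R_CompleteNormedModule) f a b).
Proof.
intros H. apply (RInt_correct (V := C_R_CompleteNormedModule)).
apply (ex_RInt_continuous (V := C_R_CompleteNormedModule)).
intros z _; eapply rder_continuous, H.
Qed.

Lemma cint_unique f a b l m : cint f a b l -> cint f a b m -> l = m.
Proof.
intros H1 H2. rewrite <- (is_RInt_unique (V := C_R_CompleteNormedModule) f a b l H1).
apply (is_RInt_unique (V := C_R_CompleteNormedModule)), H2.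
Qed.

Lemma cint_bound f l M : cint f 0 1 l -> (forall t, (0 <= t <= 1)%R -> (Cmod (f t) <= M)%R) ->
  (Cmod l <= M)%R.
Proof.
intros H1 H2. rewrite <- norm_CR.
apply (norm_RInt_le f (fun _ => M) 0 1 l M Rle_0_1).
- intros x Hx; rewrite norm_CR; apply H2, Hx.
- exact H1.
- assert (A := is_RInt_const (V := R_NormedModule) 0 1 M).
  apply (eq_rect _ (is_RInt (V := R_NormedModule) (fun _ => M) 0 1) A).
  change ((1 - 0) * M = M)%R; ring.
Qed.

Lemma rder_ray t u : rder (fun s => RtoC s * u) t u.
Proof. apply deriv_ext with (fun s => 0 + RtoC s * u); [intros; ring | apply rder_line]. Qed.

Lemma rder_RtoC t : rder (fun s => RtoC s) t 1.
Proof. apply deriv_ext with (fun s => 0 + RtoC s * 1); [intros; ring | apply rder_line]. Qed.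

Lemma rder_of_cder (F : C -> C) t l : cder F (RtoC t) l -> rder (fun s => F (RtoC s)) t l.
Proof.
intros H. apply deriv_eq with (l * 1); [ring|].
apply (deriv_comp F (fun s => RtoC s)); [apply rder_RtoC | exact H].
Qed.

(** The primitive is [P u = u * Q u], where [Q u] is the mean of [G] over the
    segment from 0 to [u].  The bound on [G2] allows differentiating [Q] under
    the integral, and integrating the derivative of [t * G (t * u)] from 0 to 1
    gives [u * Q' u = G u - Q u], hence [P' = G]. *)
Lemma plane_primitive (G G1 G2 : C -> C) :
  (forall u, cder G u (G1 u)) -> (forall u, cder G1 u (G2 u)) ->
  (forall rho, exists M, forall u, (Cmod u <= rho)%R -> (Cmod (G2 u) <= M)%R) ->
  exists P, forall u, cder P u (G u).
Proof.
intros HG HG1 HB.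
set (Q := fun u => RInt (V := C_R_CompleteNormedModule) (fun t => G (RtoC t * u)) 0 1).
set (Q1 := fun u => RInt (V := C_R_CompleteNormedModule) (fun t => RtoC t * G1 (RtoC t * u)) 0 1).
assert (cd1 : forall (c : C) u, cder (fun v => v * u) c u).
{ intros c u. apply deriv_eq with (1 * u + c * 0); [ring|]. apply (deriv_mult (fun v => v) (fun _ => u)); [apply cder_id | apply deriv_const]. }
assert (IQ : forall u, cint (fun t => G (RtoC t * u)) 0 1 (Q u)).
{ intros u. apply cint_exists with (fun t => G1 (RtoC t * u) * u).
  intros t. apply (deriv_comp G (fun s => RtoC s * u)); [apply rder_ray | apply HG]. }
assert (IQ1 : forall u, cint (fun t => RtoC t * G1 (RtoC t * u)) 0 1 (Q1 u)).
{ intros u. apply cint_exists with (fun t => 1 * G1 (RtoC t * u) + RtoC t * (G2 (RtoC t * u) * u)).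
  intros t. apply (rder_of_cder (fun c => c * G1 (c * u))).
  apply (deriv_mult (fun c => c) (fun c => G1 (c * u))); [apply cder_id|].
  apply (deriv_comp G1 (fun c => c * u) (RtoC t)); [apply cd1 | apply HG1]. }
assert (DQ : forall u, cder Q u (Q1 u)).
{ intros u eps He. destruct (HB (Cmod u + 1)%R) as [M HM].
  assert (HM0 : (0 <= M)%R) by (eapply Rle_trans; [apply Cmod_ge_0 | apply (HM u); lra]).
  exists (Rmin 1 (eps / (4 * (M + 1)))); split; [apply Rmin_pos; [lra | apply Rdiv_lt_0_compat; lra]|].
  intros y Hy.  use_Rmin.
  set (h := Cmod (y - u)) in *. assert (Hh : (0 <= h)%R) by apply Cmod_ge_0.
  assert (B : (Cmod (Q y + - (1) * Q u + - (y - u) * Q1 u) <= 4 * M * h ^ 2)%R).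
  { apply cint_bound with (fun t => G (RtoC t * y) + - (1) * G (RtoC t * u) + - (y - u) * (RtoC t * G1 (RtoC t * u))).
    - apply cint_plus; [apply cint_plus; [apply IQ | apply cint_scal, IQ] | apply cint_scal, IQ1].
    - intros t Ht.
      replace (G (RtoC t * y) + - (1) * G (RtoC t * u) + - (y - u) * (RtoC t * G1 (RtoC t * u)))
        with (G (RtoC t * y) - G (RtoC t * u) - (RtoC t * y - RtoC t * u) * G1 (RtoC t * u)) by ring.
      eapply Rle_trans; [apply (cder_taylor G G1 G2 _ _ M); intros; auto|].
      + apply HM. unfold seg.
        replace (RtoC t * u + RtoC t0 * (RtoC t * y - RtoC t * u)) with (RtoC t * (u + RtoC t0 * (y - u))) by ring.
        rewrite Cmod_mult, Cmod_R, Rabs_pos_eq by lra.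
        assert (T : (Cmod (u + RtoC t0 * (y - u)) <= Cmod u + 1)%R).
        { eapply Rle_trans; [apply Cmod_triangle|]. rewrite Cmod_mult, Cmod_R, Rabs_pos_eq by lra. fold h. nra. }
        assert (T0 := Cmod_ge_0 (u + RtoC t0 * (y - u))). nra.
      + replace (RtoC t * y - RtoC t * u) with (RtoC t * (y - u)) by ring.
        rewrite Cmod_mult, Cmod_R, Rabs_pos_eq by lra. fold h.
        assert (T : ((t * h) ^ 2 <= h ^ 2)%R) by (apply pow_incr; nra). nra. }
  replace (Q y - Q u - (y - u) * Q1 u) with (Q y + - (1) * Q u + - (y - u) * Q1 u) by ring.
  eapply Rle_trans; [exact B|].
  replace (4 * M * h ^ 2)%R with (4 * M * h * h)%R by ring. apply Rmult_le_compat_r; [auto|].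
  apply Rle_trans with (4 * (M + 1) * (eps / (4 * (M + 1))))%R; [|right; field; lra].
  apply Rmult_le_compat; lra. }
assert (E : forall u, u * Q1 u = G u - Q u).
{ intros u.
  assert (I1 : cint (fun t => G (RtoC t * u) + u * (RtoC t * G1 (RtoC t * u))) 0 1 (Q u + u * Q1 u)).
  { apply cint_plus; [apply IQ | apply cint_scal, IQ1]. }
  assert (R1 : forall t, rder (fun t => RtoC t * G (RtoC t * u)) t (G (RtoC t * u) + u * (RtoC t * G1 (RtoC t * u)))).
  { intros t. apply (rder_of_cder (fun c => c * G (c * u))).
    apply deriv_eq with (1 * G (RtoC t * u) + RtoC t * (G1 (RtoC t * u) * u)); [ring|].
    apply (deriv_mult (fun c => c) (fun c => G (c * u))); [apply cder_id|].
    apply (deriv_comp G (fun c => c * u) (RtoC t)); [apply cd1 | apply HG]. }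
  assert (I2 : cint (fun t => G (RtoC t * u) + u * (RtoC t * G1 (RtoC t * u))) 0 1 (1 * G (1 * u) - 0 * G (0 * u))).
  { apply (is_RInt_derive (V := C_R_CompleteNormedModule) (fun t => RtoC t * G (RtoC t * u))).
    - intros t _; apply rder_is_derive, R1.
    - intros t _. apply rder_continuous with (l := G1 (RtoC t * u) * u + u * (1 * G1 (RtoC t * u) + RtoC t * (G2 (RtoC t * u) * u))).
      apply (rder_of_cder (fun c => G (c * u) + u * (c * G1 (c * u)))).
      apply deriv_plus; [apply (deriv_comp G (fun c => c * u) (RtoC t)); [apply cd1 | apply HG]|].
      apply deriv_scal. apply (deriv_mult (fun c => c) (fun c => G1 (c * u))); [apply cder_id|].
      apply (deriv_comp G1 (fun c => c * u) (RtoC t)); [apply cd1 | apply HG1]. }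
  assert (Z := cint_unique _ _ _ _ _ I1 I2).
  replace (1 * G (1 * u) - 0 * G (0 * u)) with (G u) in Z by (replace (1 * u) with u by ring; ring).
  rewrite <- Z; ring. }
exists (fun u => u * Q u). intros u.
apply deriv_eq with (1 * Q u + u * Q1 u); [rewrite E; ring|].
apply (deriv_mult (fun u => u)); [apply cder_id | apply DQ].
Qed.

(** * Growth in a logarithmic strip *)

(** In terms of [x = Cexp u], away from 0 and with bounded argument, the
    function is [O(exp (eps |x|))] for every [eps > 0].  Such a function is
    negligible against [exp x] in any closed sector of the left half-plane. *)
Definition subexp (g : C -> C) : Prop := forall rho eps, (0 < eps)%R -> exists A, (0 <= A)%R /\
  forall u, (- rho <= Re u)%R -> (Rabs (Im u) <= rho)%R ->
    (Cmod (g u) <= A * exp (eps * exp (Re u)))%R.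

(** Two derivatives: the first provides a primitive of [g * kern], the second a
    bound for its Taylor remainders. *)
Definition admissible (g : C -> C) : Prop := exists g1 g2,
  (forall u, cder g u (g1 u)) /\ (forall u, cder g1 u (g2 u)) /\ subexp g /\ subexp g1 /\ subexp g2.

Lemma exp_ge_1x x : (1 + x <= exp x)%R.
Proof. destruct (Req_dec x 0) as [-> | H]; [rewrite exp_0; lra | left; apply exp_ineq1, H]. Qed.

Lemma exp_le a b : (a <= b)%R -> (exp a <= exp b)%R.
Proof. intros [L|L]; [left; apply exp_increasing, L | rewrite L; lra]. Qed.

Lemma subexp_const c : subexp (fun _ => c).
Proof.
intros rho eps He; exists (Cmod c); split; [apply Cmod_ge_0|]; intros u _ _.
assert (H := exp_ge_1x (eps * exp (Re u))). assert (Q := exp_pos (Re u)). assert (P := Cmod_ge_0 c).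
assert (0 < eps * exp (Re u))%R by (apply Rmult_lt_0_compat; auto). nra.
Qed.

Lemma subexp_plus f g : subexp f -> subexp g -> subexp (fun u => f u + g u).
Proof.
intros H1 H2 rho eps He. destruct (H1 rho eps He) as [A [HA B1]]. destruct (H2 rho eps He) as [B [HB B2]].
exists (A + B)%R; split; [lra|]; intros u Hu Hi. specialize (B1 u Hu Hi); specialize (B2 u Hu Hi).
eapply Rle_trans; [apply Cmod_triangle|]; lra.
Qed.

Lemma subexp_mult f g : subexp f -> subexp g -> subexp (fun u => f u * g u).
Proof.
intros H1 H2 rho eps He. destruct (H1 rho (eps/2)%R) as [A [HA B1]]; [lra|].
destruct (H2 rho (eps/2)%R) as [B [HB B2]]; [lra|].
exists (A * B)%R; split; [apply Rmult_le_pos; auto|]; intros u Hu Hi. specialize (B1 u Hu Hi); specialize (B2 u Hu Hi).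
rewrite Cmod_mult.
replace (eps * exp (Re u))%R with (eps / 2 * exp (Re u) + eps / 2 * exp (Re u))%R by field.
rewrite exp_plus.
set (X := exp (eps / 2 * exp (Re u))) in *.
replace (A * B * (X * X))%R with (A * X * (B * X))%R by ring.
apply Rmult_le_compat; auto; apply Cmod_ge_0.
Qed.

Lemma subexp_scal c f : subexp f -> subexp (fun u => c * f u).
Proof. apply subexp_mult, subexp_const. Qed.

Lemma subexp_Cexp : subexp Cexp.
Proof.
intros rho eps He; exists (/ eps)%R; split; [left; apply Rinv_0_lt_compat; auto|]; intros u _ _.
rewrite Cmod_Cexp. assert (H := exp_ge_1x (eps * exp (Re u))).
apply Rmult_le_reg_l with eps; [auto|]. rewrite <- Rmult_assoc, Rinv_r by lra. lra.
Qed.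

Lemma admissible_subexp f : admissible f -> subexp f.
Proof. intros [f1 [f2 H]]; apply H. Qed.

Lemma admissible_plus f g : admissible f -> admissible g -> admissible (fun u => f u + g u).
Proof.
intros [f1 [f2 [A1 [A2 [A3 [A4 A5]]]]]] [g1 [g2 [B1 [B2 [B3 [B4 B5]]]]]].
exists (fun u => f1 u + g1 u), (fun u => f2 u + g2 u).
repeat split; try (intros; apply deriv_plus; auto); apply subexp_plus; auto.
Qed.

Lemma admissible_scal c f : admissible f -> admissible (fun u => c * f u).
Proof.
intros [f1 [f2 [A1 [A2 [A3 [A4 A5]]]]]].
exists (fun u => c * f1 u), (fun u => c * f2 u).
repeat split; try (intros; apply deriv_scal; auto); apply subexp_scal; auto.
Qed.

Lemma admissible_lin (a b : C) f g : admissible f -> admissible g -> admissible (fun u => a * f u + b * g u).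
Proof. intros; apply admissible_plus; apply admissible_scal; auto. Qed.

(** The factor [exp x] of the Hankel integrand, in the variable [u = log x];
    the factor [dx / x] becomes [du]. *)
Definition kern (u : C) : C := Cexp (Cexp u).

Lemma cder_kern u : cder kern u (kern u * Cexp u).
Proof. apply (cder_Cexp_comp Cexp), cder_Cexp. Qed.

Lemma Cmod_kern u : Cmod (kern u) = exp (exp (Re u) * cos (Im u)).
Proof. unfold kern; rewrite Cmod_Cexp; reflexivity. Qed.

Lemma admissible_primitive g : admissible g -> exists P, forall u, cder P u (g u * kern u).
Proof.
intros [g1 [g2 [A1 [A2 [A3 [A4 A5]]]]]].
apply (plane_primitive (fun u => g u * kern u) (fun u => (g1 u + g u * Cexp u) * kern u)
  (fun u => (g2 u + (g1 u * Cexp u + g u * Cexp u) + (g1 u + g u * Cexp u) * Cexp u) * kern u)).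
- intros u. apply deriv_eq with (g1 u * kern u + g u * (kern u * Cexp u)); [ring|].
  apply (deriv_mult g kern); [apply A1 | apply cder_kern].
- intros u. apply deriv_eq with ((g2 u + (g1 u * Cexp u + g u * Cexp u)) * kern u + (g1 u + g u * Cexp u) * (kern u * Cexp u)); [ring|].
  apply (deriv_mult (fun u => g1 u + g u * Cexp u) kern); [|apply cder_kern].
  apply deriv_plus; [apply A2 | apply (deriv_mult g Cexp); [apply A1 | apply cder_Cexp]].
- intros rho.
  assert (T : subexp (fun u => g2 u + (g1 u * Cexp u + g u * Cexp u) + (g1 u + g u * Cexp u) * Cexp u)).
  { assert (E := subexp_Cexp). repeat first [assumption | apply subexp_plus | apply (subexp_mult _ Cexp)]. }
  destruct (T rho 1%R Rlt_0_1) as [A [HA B]].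
  exists (A * exp (exp rho) * exp (exp rho))%R. intros u Hu.
  assert (R1 := re_le_Cmod u). assert (I1 := Im_le_Cmod u).
  assert (R2 := proj1 (Rcomplements.Rabs_le_between _ _) R1).
  specialize (B u ltac:(lra) ltac:(lra)).
  rewrite Cmod_mult, Cmod_kern.
  assert (X : (exp (Re u) <= exp rho)%R) by (apply exp_le; lra).
  apply Rmult_le_compat; try apply Cmod_ge_0; try (left; apply exp_pos).
  + eapply Rle_trans; [exact B|]. apply Rmult_le_compat_l; [auto|]. apply exp_le; lra.
  + apply exp_le. rewrite <- (Rmult_1_r (exp rho)); apply Rle_trans with (exp (Re u) * 1)%R; [|lra].
    apply Rmult_le_compat_l; [left; apply exp_pos | destruct (COS_bound (Im u)); lra].
Qed.

(** * Limits along the slit *)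

(** The limit at infinity in the closed sectors of the half-planes [Re x < 0] and
    [Im x > 0], for [s = 1], or [Im x < 0], for [s = -1].  Its uniformity in the
    sector is what makes the Hankel integral independent of the contour. *)
Definition sector_lim (P : C -> C) (s : R) (L : C) : Prop :=
  forall kappa eta, (0 < kappa)%R -> (0 < eta)%R -> exists N, forall u, (N <= Re u)%R ->
    (0 <= s * Im u <= PI)%R -> (cos (Im u) <= - kappa)%R -> (Cmod (P u - L) <= eta)%R.

Definition is_sign (s : R) : Prop := s = 1%R \/ s = (-1)%R.

(** The upper or lower side of the slit: the point [- exp r], with argument
    [s * PI]. *)
Definition edge (s r : R) : C := (r, s * PI)%R.

Lemma cos_sPI s : is_sign s -> cos (s * PI) = (-1)%R.
Proof.
intros [-> | ->]; [rewrite Rmult_1_l; apply cos_PI|].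
replace (-1 * PI)%R with (- PI)%R by ring. rewrite cos_neg; apply cos_PI.
Qed.

Lemma edge_range s r : is_sign s -> (0 <= s * Im (edge s r) <= PI)%R.
Proof. intros [-> | ->]; simpl; assert (H := PI_RGT_0); lra. Qed.

Lemma edge_abs s r : is_sign s -> (Rabs (Im (edge s r)) <= PI)%R.
Proof. intros [-> | ->]; simpl; assert (H := PI_RGT_0); apply Rabs_le; lra. Qed.

Lemma sector_lim_plus P Q s L M : sector_lim P s L -> sector_lim Q s M -> sector_lim (fun u => P u + Q u) s (L + M).
Proof.
intros H1 H2 k e Hk He.
destruct (H1 k (e/2)%R) as [N1 K1]; [lra | lra |]. destruct (H2 k (e/2)%R) as [N2 K2]; [lra | lra |].
exists (Rmax N1 N2); intros u Hu Hi Hc.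
assert (A1 := Rmax_l N1 N2); assert (A2 := Rmax_r N1 N2).
specialize (K1 u ltac:(lra) Hi Hc); specialize (K2 u ltac:(lra) Hi Hc).
replace (P u + Q u - (L + M)) with ((P u - L) + (Q u - M)) by ring.
eapply Rle_trans; [apply Cmod_triangle|]; lra.
Qed.

Lemma sector_lim_scal c P s L : sector_lim P s L -> sector_lim (fun u => c * P u) s (c * L).
Proof.
intros H k e Hk He. assert (Pc := Cmod_ge_0 c).
destruct (H k (e / (1 + Cmod c))%R) as [N K]; [lra | apply Rdiv_lt_0_compat; lra |].
exists N; intros u Hu Hi Hc; specialize (K u Hu Hi Hc).
replace (c * P u - c * L) with (c * (P u - L)) by ring. rewrite Cmod_mult.
apply Rle_trans with ((1 + Cmod c) * (e / (1 + Cmod c)))%R; [|right; field; lra].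
apply Rmult_le_compat; try apply Cmod_ge_0; lra.
Qed.

(** The weight [exp (e^r / 2)] of [on_strip] times [|kern|], which is [exp (- e^r)]
    on the slit, is dominated by the derivative of [- 2 exp (- r)]. *)
Lemma exp_decay r : (exp (- (1/2) * exp r) <= 2 * exp (- r))%R.
Proof.
assert (H := exp_ge_1x (1/2 * exp r)). assert (P := exp_pos r).
replace (- (1/2) * exp r)%R with (- (1/2 * exp r))%R by ring.
rewrite !exp_Ropp. apply Rmult_le_reg_r with (exp (1 / 2 * exp r) * exp r)%R; [apply Rmult_lt_0_compat; apply exp_pos|].
assert (Q := exp_pos (1/2 * exp r)).
replace (/ exp (1 / 2 * exp r) * (exp (1 / 2 * exp r) * exp r))%R with (exp r) by (field; lra).
replace (2 * / exp r * (exp (1 / 2 * exp r) * exp r))%R with (2 * exp (1 / 2 * exp r))%R by (field; lra).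
lra.
Qed.

Definition on_strip (A : R) (g : C -> C) : Prop :=
  forall u, (0 <= Re u)%R -> (Rabs (Im u) <= PI)%R -> (Cmod (g u) <= A * exp (1/2 * exp (Re u)))%R.

Lemma edge_increment g P A s a b : is_sign s -> (0 <= A)%R -> on_strip A g ->
  (forall u, cder P u (g u * kern u)) -> (0 <= a <= b)%R ->
  (Cmod (P (edge s b) - P (edge s a)) <= 4 * A * exp (- a))%R.
Proof.
intros Hs HA Hg HP Hab.
assert (D := rder_dominated (fun r => P (edge s r)) (fun r => g (edge s r) * kern (edge s r))
  (fun r => - (2 * A) * exp (- r))%R (fun r => 2 * A * exp (- r))%R a b ltac:(lra)).
cbv beta in D.
assert (Q := exp_pos (- b)).
apply Rle_trans with (2 * (- (2 * A) * exp (- b) - - (2 * A) * exp (- a)))%R; [|nra].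
apply D.
- intros t _. apply deriv_eq with (g (edge s t) * kern (edge s t) * 1); [ring|].
  apply (deriv_comp P (edge s)); [|apply HP].
  apply deriv_ext with (fun r => (0, s * PI)%R + RtoC r * 1); [|apply rder_line].
  intros r; apply C_eq; simpl; ring.
- intros t _; auto_derive; [exact I | ring].
- intros t Ht. rewrite Cmod_mult, Cmod_kern. simpl Re; simpl Im. rewrite cos_sPI by auto.
  assert (G := Hg (edge s t) ltac:(simpl; lra) (edge_abs s t Hs)). simpl Re in G.
  apply Rle_trans with (A * exp (1/2 * exp t) * exp (exp t * -1))%R.
  + apply Rmult_le_compat_r; [left; apply exp_pos | exact G].
  + rewrite Rmult_assoc, <- exp_plus.
    replace (1 / 2 * exp t + exp t * -1)%R with (- (1/2) * exp t)%R by field.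
    assert (X := exp_decay t). nra.
Qed.

Lemma subexp_on_strip g : subexp g -> exists A, (0 <= A)%R /\ on_strip A g.
Proof.
intros H. destruct (H PI (1/2)%R) as [A [HA B]]; [lra|]. exists A; split; [auto|].
intros u H1 H2; apply B; [assert (P := PI_RGT_0); lra | auto].
Qed.

(** The limit exists along the slit, by Cauchy's criterion.  In the sector, a
    point is compared with the point of the slit of the same modulus: on the arc
    between them [cos] is at most [- kappa], so that [g * kern] is
    [O(exp (- kappa |x| / 2))], while the arc has length at most [2 PI] in [u]. *)
Lemma sector_lim_exists g P s : is_sign s -> subexp g -> (forall u, cder P u (g u * kern u)) -> exists L, sector_lim P s L.
Proof.
intros Hs Hg HP.
destruct (subexp_on_strip g Hg) as [A [HA HgA]].
assert (X : exists L : C_R_CompleteNormedModule, filterlim (fun r => P (edge s r)) (Rbar_locally p_infty) (locally L)).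
{ apply (filterlim_locally_cauchy (U := C_R_CompleteNormedModule)). intros eps.
  exists (fun r => (Rmax 0 (16 * A / eps) < r)%R). split; [exists (Rmax 0 (16 * A / eps)); auto|].
  assert (sym : forall u v, (Rmax 0 (16 * A / eps) < u)%R -> (u <= v)%R -> (Cmod (P (edge s v) - P (edge s u)) < eps)%R).
  { intros u v Hu Huv. assert (M1 := Rmax_l 0 (16 * A / eps)); assert (M2 := Rmax_r 0 (16 * A / eps)).
    assert (He := cond_pos eps).
    eapply Rle_lt_trans; [apply (edge_increment g P A s u v); auto; lra|].
    assert (E1 := exp_ge_1x u). assert (Hu0 : (0 < u)%R) by lra.
    rewrite exp_Ropp. apply Rmult_lt_reg_r with (exp u); [apply exp_pos|].
    rewrite Rmult_assoc, Rinv_l by (apply Rgt_not_eq, exp_pos).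
    assert (E2 : (16 * A < eps * u)%R).
    { apply Rmult_lt_reg_r with (/ eps)%R; [apply Rinv_0_lt_compat; auto|].
      replace (eps * u * / eps)%R with u by (field; lra). unfold Rdiv in M2. lra. }
    nra. }
  intros u v Hu Hv. destruct (Rle_dec u v) as [L|L].
  - apply C_NormedModule_mixin_compat1. exact (sym u v Hu L).
  - apply ball_sym. apply C_NormedModule_mixin_compat1. apply sym; [exact Hv | lra]. }
destruct X as [L HL]. exists L.
assert (EL : forall r, (0 <= r)%R -> (Cmod (P (edge s r) - L) <= 4 * A * exp (- r))%R).
{ intros r Hr. apply Rnot_lt_le; intros Habs.
  set (d := (Cmod (P (edge s r) - L) - 4 * A * exp (- r))%R).
  assert (Hd : (0 < d / 2)%R) by (unfold d; lra).
  destruct (proj1 (filterlim_locally _ _) HL (mkposreal _ Hd)) as [N HN].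
  set (v := (Rmax r N + 1)%R). assert (M1 := Rmax_l r N); assert (M2 := Rmax_r r N).
  specialize (HN v ltac:(unfold v; lra)).
  apply C_NormedModule_mixin_compat2 in HN. change (minus (P (edge s v)) L) with (P (edge s v) - L) in HN. simpl in HN.
  assert (I := edge_increment g P A s r v Hs HA HgA HP ltac:(unfold v; lra)).
  assert (T := Cmod_triangle (P (edge s v) - L) (- (P (edge s v) - P (edge s r)))). rewrite Cmod_opp in T.
  replace (P (edge s v) - L + - (P (edge s v) - P (edge s r))) with (P (edge s r) - L) in T by ring.
  assert (S2 : (sqrt 2 < 2)%R).
  { rewrite <- (sqrt_pow2 2) at 2 by lra. apply sqrt_lt_1; lra. }
  assert (sqrt 2 * (d/2) < 2 * (d/2))%R by (apply Rmult_lt_compat_r; auto).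
  unfold d in *; lra. }
intros kappa eta Hk He.
destruct (Hg PI (kappa / 2)%R) as [B [HB HgB]]; [lra|].
set (N := Rmax 1 (Rmax (8 * A / eta) (16 * PI * B / (kappa * eta)))).
exists N. intros u Hu Hi Hc.
assert (M1 := Rmax_l 1 (Rmax (8 * A / eta) (16 * PI * B / (kappa * eta)))).
assert (M2 := Rmax_r 1 (Rmax (8 * A / eta) (16 * PI * B / (kappa * eta)))).
assert (M3 := Rmax_l (8 * A / eta) (16 * PI * B / (kappa * eta))).
assert (M4 := Rmax_r (8 * A / eta) (16 * PI * B / (kappa * eta))).
fold N in M1, M2.
set (r := Re u) in *. assert (PIpos := PI_RGT_0).
assert (Er := exp_ge_1x r).
assert (V : (Cmod (P u - P (edge s r)) <= eta / 2)%R).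
{ apply Rle_trans with (2 * (B * exp (- (kappa / 2) * exp r)) * Cmod (u - edge s r))%R.
  - apply cder_mean_value with (df := fun u => g u * kern u); [intros; apply HP|].
    intros t Ht. set (x := seg (edge s r) u t).
    assert (Rx : Re x = r).
    { unfold x, seg, Re; simpl. fold (Re u); fold r. unfold Re in r; fold r. ring. }
    assert (Ix : Im x = (s * PI + t * (Im u - s * PI))%R).
    { unfold x, seg, Im; simpl. ring. }
    assert (Sx : (s * Im u <= s * Im x <= PI)%R).
    { rewrite Ix. destruct Hs as [-> | ->]; nra. }
    assert (Cx : (cos (Im x) <= - kappa)%R).
    { eapply Rle_trans; [|exact Hc].
      assert (even : forall y, cos (s * y) = cos y).
      { intros y; destruct Hs as [-> | ->]; [f_equal; ring | replace (-1 * y)%R with (- y)%R by ring; apply cos_neg]. }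
      rewrite <- (even (Im x)), <- (even (Im u)). apply cos_decr_1; lra. }
    assert (Ax : (Rabs (Im x) <= PI)%R).
    { apply Rabs_le. destruct Hs as [-> | ->]; lra. }
    rewrite Cmod_mult, Cmod_kern, Rx.
    specialize (HgB x ltac:(rewrite Rx; lra) Ax). rewrite Rx in HgB.
    apply Rle_trans with (B * exp (kappa / 2 * exp r) * exp (exp r * - kappa))%R.
    + apply Rmult_le_compat; [apply Cmod_ge_0 | left; apply exp_pos | exact HgB |].
      apply exp_le, Rmult_le_compat_l; [left; apply exp_pos | exact Cx].
    + rewrite Rmult_assoc, <- exp_plus. right; f_equal; f_equal; field.
  - assert (D : (Cmod (u - edge s r) <= 2 * PI)%R).
    { eapply Rle_trans; [apply Cmod_le_ReIm|].
      replace (Re (u - edge s r)) with 0%R by (unfold Re, r, edge, Re; simpl; ring).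
      replace (Im (u - edge s r)) with (Im u - s * PI)%R by (unfold Im; simpl; ring).
      rewrite Rabs_R0, Rplus_0_l. apply Rabs_le. destruct Hs as [-> | ->]; lra. }
    assert (X1 : (exp (- (kappa / 2) * exp r) <= 2 / (kappa * r))%R).
    { assert (Y := exp_ge_1x (kappa / 2 * exp r)).
      replace (- (kappa / 2) * exp r)%R with (- (kappa / 2 * exp r))%R by ring. rewrite exp_Ropp.
      replace (2 / (kappa * r))%R with (/ (kappa / 2 * r))%R by (field; lra).
      apply Rinv_le_contravar; [apply Rmult_lt_0_compat; lra|]. nra. }
    assert (X2 : (16 * PI * B <= kappa * eta * r)%R).
    { apply Rmult_le_reg_r with (/ (kappa * eta))%R; [apply Rinv_0_lt_compat, Rmult_lt_0_compat; auto|].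
      replace (kappa * eta * r * / (kappa * eta))%R with r by (field; lra). unfold Rdiv in M4; lra. }
    apply Rle_trans with (2 * (B * (2 / (kappa * r))) * (2 * PI))%R.
    + apply Rmult_le_compat; [|apply Cmod_ge_0 | | exact D].
      * assert (0 < exp (- (kappa / 2) * exp r))%R by apply exp_pos. nra.
      * apply Rmult_le_compat_l; [lra|]. apply Rmult_le_compat_l; auto.
    + apply Rmult_le_reg_r with (kappa * r)%R; [apply Rmult_lt_0_compat; lra|].
      replace (2 * (B * (2 / (kappa * r))) * (2 * PI) * (kappa * r))%R with (8 * PI * B)%R by (field; lra).
      lra. }
assert (W := EL r ltac:(lra)).
assert (W2 : (4 * A * exp (- r) <= eta / 2)%R).
{ rewrite exp_Ropp. apply Rmult_le_reg_r with (exp r); [apply exp_pos|].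
  rewrite Rmult_assoc, Rinv_l by (apply Rgt_not_eq, exp_pos).
  assert (8 * A <= eta * r)%R.
  { apply Rmult_le_reg_r with (/ eta)%R; [apply Rinv_0_lt_compat; auto|].
    replace (eta * r * / eta)%R with r by (field; lra). unfold Rdiv in M3; lra. }
  nra. }
replace (P u - L) with ((P u - P (edge s r)) + (P (edge s r) - L)) by ring.
eapply Rle_trans; [apply Cmod_triangle|]; lra.
Qed.

(** * The Hankel functional *)

(** The variable [u = log x] replaces [x], so that the logarithms in the
    integrand become polynomial. *)
Definition hankel (H : hankel_contour) (g : C -> C) : C :=
  hankel_integral H (fun x => g (Clog x) * Cexp x / x).

(** The bound [|Im x| <= M (1 + |Re x|)] on the contour gives
    [|x| <= (1 + 2 M) |Re x|] where [Re x <= -1]. *)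
Lemma hankel_log_sector (H : hankel_contour) : exists kappa, (0 < kappa)%R /\
  forall t, (Re (hpath H t) <= -1)%R -> (cos (Im (Clog (hpath H t))) <= - kappa)%R.
Proof.
destruct (hpath_sector H) as [M HM].
set (M' := Rmax 1 M). assert (Q1 := Rmax_l 1 M); assert (Q2 := Rmax_r 1 M); fold M' in Q1, Q2.
exists (/ (1 + 2 * M'))%R. split; [apply Rinv_0_lt_compat; lra|]. intros t Ht.
specialize (HM t). set (x := hpath H t) in *.
assert (S : slit x) by apply hpath_slit.
assert (E := f_equal Re (Cexp_Clog x S)).
assert (Pm := proj1 (Cmod_gt_0 x) (slit_neq0 x S)).
assert (E' : (Cmod x * cos (Im (Clog x)) = Re x)%R).
{ change (exp (ln (Cmod x)) * cos (Im (Clog x)) = Re x)%R in E. rewrite exp_ln in E; auto. }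
rewrite (Rabs_left (Re x)) in HM by lra.
assert (B : (Cmod x <= (1 + 2 * M') * - Re x)%R).
{ eapply Rle_trans; [apply Cmod_le_ReIm|]. rewrite (Rabs_left (Re x)) by lra.
  assert (M * (1 + - Re x) <= M' * (1 + - Re x))%R by (apply Rmult_le_compat_r; lra). nra. }
apply Rmult_le_reg_l with (Cmod x); [auto|]. rewrite E'.
assert (Y : (Cmod x * / (1 + 2 * M') <= - Re x)%R).
{ apply Rmult_le_reg_r with (1 + 2 * M')%R; [lra|]. rewrite Rmult_assoc, Rinv_l by lra. lra. }
lra.
Qed.

Lemma hankel_log_upper x : slit x -> (0 < Im x)%R -> (0 <= 1 * Im (Clog x) <= PI)%R.
Proof.
intros S Hx. assert (B := Clog_Im_bound x). rewrite Rmult_1_l. split; [|lra].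
apply Rnot_lt_le; intros Hn.
assert (E := f_equal Im (Cexp_Clog x S)). change (exp (Re (Clog x)) * sin (Im (Clog x)) = Im x)%R in E.
assert (Sn : (sin (Im (Clog x)) < 0)%R) by (apply sin_lt_0_var; lra).
assert (P := exp_pos (Re (Clog x))). nra.
Qed.

Lemma hankel_log_lower x : slit x -> (Im x < 0)%R -> (0 <= -1 * Im (Clog x) <= PI)%R.
Proof.
intros S Hx. assert (B := Clog_Im_bound x). split; [|lra].
cut (Im (Clog x) <= 0)%R; [lra|].
apply Rnot_lt_le; intros Hn.
assert (E := f_equal Im (Cexp_Clog x S)). change (exp (Re (Clog x)) * sin (Im (Clog x)) = Im x)%R in E.
assert (Sn : (0 < sin (Im (Clog x)))%R) by (apply sin_gt_0; lra).
assert (P := exp_pos (Re (Clog x))). nra.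
Qed.

Lemma Clog_Re_ge x N : slit x -> (Re x <= - exp N)%R -> (N <= Re (Clog x))%R.
Proof.
intros S Hx. unfold Clog; simpl. assert (A := re_le_Cmod x). assert (P := exp_pos N).
rewrite Rabs_left in A by lra. rewrite <- (ln_exp N). apply Rcomplements.ln_le; lra.
Qed.

(** The integral over a finite part of the contour is a difference of values of
    [P]; the two ends of the contour lie in the two sectors, where [P] has limits.
    Hence the value depends on the integrand alone, and all properties of the
    functional follow from properties of primitives. *)
Lemma hankel_value H g P Lp Lm : admissible g -> (forall u, cder P u (g u * kern u)) ->
  sector_lim P 1 Lp -> sector_lim P (-1) Lm -> hankel H g = Lp - Lm.
Proof.
intros Hg HP H1 H2. unfold hankel, hankel_integral.
apply (is_RInt_gen_unique (V := C_R_CompleteNormedModule)).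
set (U := fun t => Clog (hpath H t)).
assert (HS : forall t, slit (hpath H t)) by (intros t; apply hpath_slit).
assert (Hh : forall t, rder (hpath H) t (hvel H t)) by (intros t; apply rder_is_derive, hpath_derive).
assert (HU : forall t, rder U t (/ hpath H t * hvel H t)).
{ intros t. apply (deriv_comp Clog (hpath H)); [apply Hh | apply cder_Clog, HS]. }
assert (HPU : forall t, rder (fun t => P (U t)) t (g (U t) * Cexp (hpath H t) / hpath H t * hvel H t)).
{ intros t. apply deriv_eq with (g (U t) * kern (U t) * (/ hpath H t * hvel H t)).
  - unfold kern, U; rewrite Cexp_Clog by apply HS. unfold Cdiv; ring.
  - apply (deriv_comp P U); [apply HU | apply HP]. }
destruct Hg as [g1 [g2 [Dg _]]].
assert (HI : forall a b, is_RInt (V := C_R_NormedModule)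
   (fun t => g (Clog (hpath H t)) * Cexp (hpath H t) / hpath H t * hvel H t) a b (P (U b) - P (U a))).
{ intros a b. apply (is_RInt_derive (V := C_R_CompleteNormedModule) (fun t => P (U t))).
  - intros t _. apply rder_is_derive, HPU.
  - intros t _.
    assert (Cf : continuous (T := R_UniformSpace) (U := C_UniformSpace) (fun t => g (Clog (hpath H t)) * Cexp (hpath H t) / hpath H t) t).
    { eapply rder_continuous.
      apply (deriv_comp (fun x => g (Clog x) * Cexp x / x) (hpath H)); [apply Hh|].
      apply (deriv_mult (fun x => g (Clog x) * Cexp x) (fun x => / x)).
      - apply (deriv_mult (fun x => g (Clog x)) Cexp); [|apply cder_Cexp].
        apply (deriv_comp g Clog); [apply cder_Clog, HS | apply Dg].
      - apply cder_inv, slit_neq0, HS. }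
    assert (Cv := hvel_continuous H t).
    assert (fstc : forall f : R -> C, continuous (T := R_UniformSpace) (U := C_UniformSpace) f t ->
      continuous (T := R_UniformSpace) (U := R_UniformSpace) (fun t => fst (f t)) t).
    { intros f Hf. apply (continuous_comp (V := C_UniformSpace) (W := R_UniformSpace) f fst); [exact Hf | apply continuous_fst]. }
    assert (sndc : forall f : R -> C, continuous (T := R_UniformSpace) (U := C_UniformSpace) f t ->
      continuous (T := R_UniformSpace) (U := R_UniformSpace) (fun t => snd (f t)) t).
    { intros f Hf. apply (continuous_comp (V := C_UniformSpace) (W := R_UniformSpace) f snd); [exact Hf | apply continuous_snd]. }
    assert (F1 := fstc _ Cf); assert (F2 := sndc _ Cf); assert (V1 := fstc _ Cv); assert (V2 := sndc _ Cv).
    set (f := fun t => g (Clog (hpath H t)) * Cexp (hpath H t) / hpath H t) in *.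
    set (v := hvel H) in *.
    assert (R1 : continuous (T := R_UniformSpace) (U := R_UniformSpace) (fun t => fst (f t) * fst (v t) - snd (f t) * snd (v t))%R t).
    { apply (continuous_minus (V := R_NormedModule)); apply (continuous_mult (K := R_AbsRing)); assumption. }
    assert (R2 : continuous (T := R_UniformSpace) (U := R_UniformSpace) (fun t => fst (f t) * snd (v t) + snd (f t) * fst (v t))%R t).
    { apply (continuous_plus (V := R_NormedModule)); apply (continuous_mult (K := R_AbsRing)); assumption. }
    apply filterlim_locally; intros eps.
    generalize (filter_and _ _ (proj1 (filterlim_locally _ _) R1 eps) (proj1 (filterlim_locally _ _) R2 eps)).
    apply filter_imp. intros y [B1 B2]; split; [exact B1 | exact B2]. }
destruct (hankel_log_sector H) as [kappa [Hk HK]].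
assert (ends : forall (F : (R -> Prop) -> Prop) s L, Filter F -> is_sign s -> sector_lim P s L ->
  F (fun t => 0 <= s * Im (U t) <= PI)%R -> (forall X, F (fun t => Re (hpath H t) < X)%R) ->
  forall eps, (0 < eps)%R -> F (fun t => (Cmod (P (U t) - L) <= eps)%R)).
{ intros F s L FF Hs HL Hpos Hre eps He.
  destruct (HL kappa eps Hk He) as [N HN].
  generalize (filter_and _ _ Hpos (filter_and _ _ (Hre (-1)%R) (Hre (- exp N)%R))).
  apply filter_imp. intros t [B1 [B2 B3]]. apply HN; auto.
  - apply Clog_Re_ge; [apply HS | lra].
  - apply HK; lra. }
assert (Ep := ends (Rbar_locally p_infty) 1%R Lp _ (or_introl eq_refl) H1).
assert (Em := ends (Rbar_locally m_infty) (-1)%R Lm _ (or_intror eq_refl) H2).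
assert (Ep' : forall eps, (0 < eps)%R -> Rbar_locally p_infty (fun t => (Cmod (P (U t) - Lp) <= eps)%R)).
{ apply Ep.
  - generalize (hpath_above H). apply filter_imp. intros t Ht. apply hankel_log_upper; auto.
  - intros X. assert (E := hpath_end H). apply is_lim_spec in E. apply (E X). }
assert (Em' : forall eps, (0 < eps)%R -> Rbar_locally m_infty (fun t => (Cmod (P (U t) - Lm) <= eps)%R)).
{ apply Em.
  - generalize (hpath_below H). apply filter_imp. intros t Ht. apply hankel_log_lower; auto.
  - intros X. assert (E := hpath_start H). apply is_lim_spec in E. apply (E X). }
intros X [eps HX].
assert (He : (0 < eps / 4)%R) by (assert (Z := cond_pos eps); lra).
apply Filter_prod with (1 := Em' _ He) (2 := Ep' _ He).
intros a b Ha Hb. exists (P (U b) - P (U a)); split; [apply HI|].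
apply HX. apply C_NormedModule_mixin_compat1.
change (Cmod (P (U b) - P (U a) - (Lp - Lm)) < eps)%R.
replace (P (U b) - P (U a) - (Lp - Lm)) with ((P (U b) - Lp) + - (P (U a) - Lm)) by ring.
eapply Rle_lt_trans; [apply Cmod_triangle|]. rewrite Cmod_opp. assert (Z := cond_pos eps); lra.
Qed.

Lemma hankel_primitive H g : admissible g -> exists P Lp Lm, (forall u, cder P u (g u * kern u)) /\
  sector_lim P 1 Lp /\ sector_lim P (-1) Lm /\ hankel H g = Lp - Lm.
Proof.
intros Hg. destruct (admissible_primitive g Hg) as [P HP].
destruct (sector_lim_exists g P 1 (or_introl eq_refl) (admissible_subexp g Hg) HP) as [Lp H1].
destruct (sector_lim_exists g P (-1) (or_intror eq_refl) (admissible_subexp g Hg) HP) as [Lm H2].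
exists P, Lp, Lm; repeat split; auto. eapply hankel_value; eauto.
Qed.

Lemma hankel_ext H f g : (forall u, f u = g u) -> hankel H f = hankel H g.
Proof.
intros E; unfold hankel, hankel_integral. f_equal.
apply functional_extensionality; intros t; rewrite E; reflexivity.
Qed.

Lemma hankel_plus H f g : admissible f -> admissible g -> hankel H (fun u => f u + g u) = hankel H f + hankel H g.
Proof.
intros Hf Hg. destruct (hankel_primitive H f Hf) as [P [Lp [Lm [A1 [A2 [A3 A4]]]]]].
destruct (hankel_primitive H g Hg) as [Q [Mp [Mm [B1 [B2 [B3 B4]]]]]].
rewrite A4, B4.
rewrite (hankel_value H (fun u => f u + g u) (fun u => P u + Q u) (Lp + Mp) (Lm + Mm)); [ring | | | |].
- apply admissible_plus; auto.
- intros u. apply deriv_eq with (f u * kern u + g u * kern u); [ring | apply deriv_plus; auto].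
- apply sector_lim_plus; auto.
- apply sector_lim_plus; auto.
Qed.

Lemma hankel_scal H c f : admissible f -> hankel H (fun u => c * f u) = c * hankel H f.
Proof.
intros Hf. destruct (hankel_primitive H f Hf) as [P [Lp [Lm [A1 [A2 [A3 A4]]]]]].
rewrite A4.
rewrite (hankel_value H (fun u => c * f u) (fun u => c * P u) (c * Lp) (c * Lm)); [ring | | | |].
- apply admissible_scal; auto.
- intros u. apply deriv_eq with (c * (f u * kern u)); [ring | apply deriv_scal; auto].
- apply sector_lim_scal; auto.
- apply sector_lim_scal; auto.
Qed.

Lemma hankel_lin H (a b : C) f g : admissible f -> admissible g ->
  hankel H (fun u => a * f u + b * g u) = a * hankel H f + b * hankel H g.
Proof.
intros Hf Hg. rewrite (hankel_plus H (fun u => a * f u) (fun u => b * g u)), !hankel_scal; auto using admissible_scal.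
Qed.

(** The constant of the next bound: the two sides of the slit, from modulus 1 on,
    contribute [4] each, and the unit circle the remaining term. *)
Definition hankel_norm : R := (8 + 4 * PI * exp 2)%R.

Lemma hankel_norm_pos : (0 < hankel_norm)%R.
Proof. assert (E := exp_pos 2); assert (P := PI_RGT_0); unfold hankel_norm; nra. Qed.

(** The limits of the primitive are compared along the lower side of the slit, the
    unit circle and the upper side. *)
Lemma hankel_bound H g A : admissible g -> (0 <= A)%R -> on_strip A g -> (Cmod (hankel H g) <= hankel_norm * A)%R.
Proof.
intros Hg HA Hs. destruct (hankel_primitive H g Hg) as [P [Lp [Lm [A1 [A2 [A3 A4]]]]]].
rewrite A4. assert (PIpos := PI_RGT_0).
assert (edge_lim : forall s L, is_sign s -> sector_lim P s L -> (Cmod (L - P (edge s 0)) <= 4 * A)%R).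
{ intros s L Hs1 HL. apply Rnot_lt_le; intros Habs.
  set (d := (Cmod (L - P (edge s 0)) - 4 * A)%R). assert (Hd : (0 < d / 2)%R) by (unfold d; lra).
  destruct (HL 1%R (d/2)%R Rlt_0_1 Hd) as [N HN].
  set (b := Rmax 0 N). assert (B1 := Rmax_l 0 N); assert (B2 := Rmax_r 0 N); fold b in B1, B2.
  assert (C1 : (cos (Im (edge s b)) <= - (1))%R) by (simpl; rewrite cos_sPI by auto; lra).
  specialize (HN (edge s b) B2 (edge_range s b Hs1) C1).
  assert (I := edge_increment g P A s 0 b Hs1 HA Hs A1 ltac:(lra)). rewrite Ropp_0, exp_0 in I.
  assert (T := Cmod_triangle (P (edge s b) - P (edge s 0)) (- (P (edge s b) - L))). rewrite Cmod_opp in T.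
  replace (P (edge s b) - P (edge s 0) + - (P (edge s b) - L)) with (L - P (edge s 0)) in T by ring.
  unfold d in *; lra. }
assert (Ep := edge_lim 1%R Lp (or_introl eq_refl) A2).
assert (Em := edge_lim (-1)%R Lm (or_intror eq_refl) A3).
assert (V : (Cmod (P (edge 1 0) - P (edge (-1) 0)) <= 2 * (A * exp 2) * (2 * PI))%R).
{ apply Rle_trans with (2 * (A * exp 2) * Cmod (edge 1 0 - edge (-1) 0))%R.
  - apply cder_mean_value with (df := fun u => g u * kern u); [intros; apply A1|].
    intros t Ht. set (x := seg (edge (-1) 0) (edge 1 0) t).
    assert (Rx : Re x = 0%R) by (unfold x, seg, Re; simpl; ring).
    assert (Ix : Im x = (PI * (2 * t - 1))%R) by (unfold x, seg, Im; simpl; ring).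
    rewrite Cmod_mult, Cmod_kern, Rx, exp_0.
    specialize (Hs x ltac:(lra) ltac:(rewrite Ix; apply Rabs_le; nra)). rewrite Rx, exp_0 in Hs.
    apply Rle_trans with (A * exp (1/2 * 1) * exp 1)%R.
    + apply Rmult_le_compat; [apply Cmod_ge_0 | left; apply exp_pos | exact Hs |].
      apply exp_le. destruct (COS_bound (Im x)); lra.
    + rewrite Rmult_assoc, <- exp_plus. apply Rmult_le_compat_l; [auto|]. apply exp_le; lra.
  - apply Rmult_le_compat_l; [assert (Z := exp_pos 2); nra|].
    eapply Rle_trans; [apply Cmod_le_ReIm|].
    replace (Re (edge 1 0 - edge (-1) 0)) with 0%R by (unfold Re; simpl; ring).
    replace (Im (edge 1 0 - edge (-1) 0)) with (2 * PI)%R by (unfold Im; simpl; ring).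
    rewrite Rabs_R0, Rabs_pos_eq; lra. }
replace (Lp - Lm) with ((Lp - P (edge 1 0)) + (P (edge 1 0) - P (edge (-1) 0)) + - (Lm - P (edge (-1) 0))) by ring.
eapply Rle_trans; [apply Cmod_triangle|]. rewrite Cmod_opp.
eapply Rle_trans; [apply Rplus_le_compat_r, Cmod_triangle|]. unfold hankel_norm. nra.
Qed.

(** The integrand is the derivative of [g * kern], which tends to 0 at both ends
    of the contour. *)
Lemma hankel_by_parts H g g1 : subexp g -> (forall u, cder g u (g1 u)) ->
  admissible (fun u => g1 u + g u * Cexp u) -> hankel H (fun u => g1 u + g u * Cexp u) = 0.
Proof.
intros Hg Dg Hn.
assert (lim0 : forall s, is_sign s -> sector_lim (fun u => g u * kern u) s 0).
{ intros s Hs kappa eta Hk He.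
  destruct (Hg PI (kappa / 2)%R) as [B [HB HgB]]; [lra|].
  exists (Rmax 1 (2 * B / (kappa * eta))). intros u Hu Hi Hc.
  assert (M1 := Rmax_l 1 (2 * B / (kappa * eta))); assert (M2 := Rmax_r 1 (2 * B / (kappa * eta))).
  set (r := Re u) in *. assert (PIpos := PI_RGT_0).
  replace (g u * kern u - 0) with (g u * kern u) by ring. rewrite Cmod_mult, Cmod_kern.
  specialize (HgB u ltac:(fold r; lra) ltac:(apply Rabs_le; destruct Hs as [-> | ->]; lra)). fold r in HgB |- *.
  apply Rle_trans with (B * exp (kappa / 2 * exp r) * exp (exp r * - kappa))%R.
  - apply Rmult_le_compat; [apply Cmod_ge_0 | left; apply exp_pos | exact HgB |].
    apply exp_le, Rmult_le_compat_l; [left; apply exp_pos | exact Hc].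
  - rewrite Rmult_assoc, <- exp_plus.
    replace (kappa / 2 * exp r + exp r * - kappa)%R with (- (kappa / 2 * exp r))%R by field.
    assert (Y := exp_ge_1x (kappa / 2 * exp r)). assert (Er := exp_ge_1x r). rewrite exp_Ropp.
    apply Rmult_le_reg_r with (exp (kappa / 2 * exp r)); [apply exp_pos|].
    rewrite Rmult_assoc, Rinv_l by (apply Rgt_not_eq, exp_pos).
    assert (X2 : (2 * B <= kappa * eta * r)%R).
    { apply Rmult_le_reg_r with (/ (kappa * eta))%R; [apply Rinv_0_lt_compat, Rmult_lt_0_compat; auto|].
      replace (kappa * eta * r * / (kappa * eta))%R with r by (field; lra). unfold Rdiv in M2; lra. }
    assert (kappa * eta * r <= kappa * eta * exp r)%R by (apply Rmult_le_compat_l; [left; apply Rmult_lt_0_compat; auto | lra]).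
    nra. }
rewrite (hankel_value H _ (fun u => g u * kern u) 0 0 Hn); [ring | | apply lim0; left; reflexivity | apply lim0; right; reflexivity].
intros u. apply deriv_eq with (g1 u * kern u + g u * (kern u * Cexp u)); [ring|].
apply (deriv_mult g kern); [apply Dg | apply cder_kern].
Qed.

Lemma Cexp_edge s r : is_sign s -> Cexp (edge s r) = RtoC (- exp r).
Proof.
intros Hs. unfold Cexp, edge; simpl. rewrite cos_sPI by auto.
assert (S : sin (s * PI) = 0%R).
{ destruct Hs as [-> | ->]; [rewrite Rmult_1_l; apply sin_PI|].
  replace (-1 * PI)%R with (- PI)%R by ring. rewrite sin_neg, sin_PI; ring. }
rewrite S. apply C_eq; simpl; ring.
Qed.

(** If the integrand has the primitive [F x + c log x] with [F] single valued, the
    two limits of the primitive differ by the jump [2 i PI c] of [c log x]. *)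
Lemma hankel_single_valued H g (F : C -> C) c : admissible g ->
  (forall u, cder (fun u => F (Cexp u)) u (g u * kern u - c)) -> hankel H g = 2 * PI * Ci * c.
Proof.
intros Hg HF.
set (P := fun u => F (Cexp u) + c * u).
assert (HP : forall u, cder P u (g u * kern u)).
{ intros u. apply deriv_eq with ((g u * kern u - c) + c * 1); [ring|].
  apply deriv_plus; [apply HF | apply deriv_scal, cder_id]. }
destruct (sector_lim_exists g P 1 (or_introl eq_refl) (admissible_subexp g Hg) HP) as [Lp H1].
destruct (sector_lim_exists g P (-1) (or_intror eq_refl) (admissible_subexp g Hg) HP) as [Lm H2].
rewrite (hankel_value H g P Lp Lm Hg HP H1 H2).
destruct (Ceq_dec (Lp - Lm) (2 * PI * Ci * c)) as [E|E]; [exact E | exfalso].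
assert (D : Lp - Lm - 2 * PI * Ci * c <> 0) by (intros Z; apply E; replace (Lp - Lm) with ((Lp - Lm - 2 * PI * Ci * c) + 2 * PI * Ci * c) by ring; rewrite Z; ring).
apply Cmod_gt_0 in D. set (d := Cmod (Lp - Lm - 2 * PI * Ci * c)) in *.
destruct (H1 1%R (d / 4)%R) as [N1 K1]; [lra | lra |].
destruct (H2 1%R (d / 4)%R) as [N2 K2]; [lra | lra |].
set (r := Rmax N1 N2).
assert (S1 : is_sign 1) by (left; reflexivity). assert (S2 : is_sign (-1)) by (right; reflexivity).
assert (C1 : forall s, is_sign s -> (cos (Im (edge s r)) <= - (1))%R) by (intros s Hs; simpl; rewrite cos_sPI by auto; lra).
specialize (K1 (edge 1 r) (Rmax_l _ _) (edge_range _ _ S1) (C1 _ S1)).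
specialize (K2 (edge (-1) r) (Rmax_r _ _) (edge_range _ _ S2) (C1 _ S2)).
assert (Z : P (edge 1 r) - P (edge (-1) r) = 2 * PI * Ci * c).
{ unfold P. rewrite !Cexp_edge by auto.
  replace (F (RtoC (- exp r)) + c * edge 1 r - (F (RtoC (- exp r)) + c * edge (-1) r)) with (c * (edge 1 r - edge (-1) r)) by ring.
  rewrite Cmult_comm. f_equal. unfold edge. apply C_eq; simpl; ring. }
assert (T := Cmod_triangle (P (edge (-1) r) - Lm) (- (P (edge 1 r) - Lp))). rewrite Cmod_opp in T.
replace (P (edge (-1) r) - Lm + - (P (edge 1 r) - Lp)) with (Lp - Lm - (P (edge 1 r) - P (edge (-1) r))) in T by ring.
rewrite Z in T. fold d in T. lra.
Qed.

(** * Differentiation under the Hankel integral *)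

(** The integrands of the Borel transforms, as functions of [w = log z] and
    [u = log x], lie in the algebra generated by [w], [u], their exponentials and
    power series in [z x] and in [z^2 / x]; this algebra is closed under both
    partial derivatives.  The growth conditions are the weakest that give
    convergence when [x] is large. *)
Inductive tame : (C -> C -> C) -> Prop :=
| tame_const c : tame (fun _ _ => c)
| tame_w : tame (fun w _ => w)
| tame_u : tame (fun _ u => u)
| tame_expw : tame (fun w _ => Cexp w)
| tame_expu : tame (fun _ u => Cexp u)
| tame_expnu : tame (fun _ u => Cexp (- u))
| tame_I c : min_type c -> tame (fun w u => pser c (Cexp (w + u)))
| tame_E c : exp_type c -> tame (fun w u => pser c (Cexp (2 * w - u)))
| tame_plus g h : tame g -> tame h -> tame (fun w u => g w u + h w u)
| tame_mult g h : tame g -> tame h -> tame (fun w u => g w u * h w u)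
| tame_ext g h : (forall w u, g w u = h w u) -> tame g -> tame h.

Lemma tame_dw g : tame g -> exists gw, tame gw /\ forall w u, cder (fun v => g v u) w (gw w u).
Proof.
induction 1 as [c | | | | | | c Hc | c Hc | g h _ [g' [Tg Dg]] _ [h' [Th Dh]] | g h Hg [g' [Tg Dg]] Hh [h' [Th Dh]] | g h E _ [g' [Tg Dg]]].
- exists (fun _ _ => RtoC 0); split; [constructor | intros; apply deriv_const].
- exists (fun _ _ => RtoC 1); split; [constructor | intros; apply cder_id].
- exists (fun _ _ => RtoC 0); split; [constructor | intros; apply deriv_const].
- exists (fun w _ => Cexp w); split; [constructor | intros; apply cder_Cexp].
- exists (fun _ _ => RtoC 0); split; [constructor | intros; apply deriv_const].
- exists (fun _ _ => RtoC 0); split; [constructor | intros; apply deriv_const].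
- exists (fun w u => pser (theta c) (Cexp (w + u))); split; [constructor; apply min_type_theta, Hc|].
  intros w u. apply deriv_eq with ((1 + 0) * pser (theta c) (Cexp (w + u))); [ring|].
  apply (cder_pser_exp c (fun v => v + u)); [apply min_type_exp_type, Hc|].
  apply deriv_plus; [apply cder_id | apply deriv_const].
- exists (fun w u => 2 * pser (theta c) (Cexp (2 * w - u))); split.
  + exact (tame_mult _ _ (tame_const 2) (tame_E _ (exp_type_theta c Hc))).
  + intros w u. apply deriv_eq with ((2 * 1 - 0) * pser (theta c) (Cexp (2 * w - u))); [ring|].
    apply (cder_pser_exp c (fun v => 2 * v - u)); [exact Hc|].
    apply deriv_minus; [apply deriv_scal, cder_id | apply deriv_const].
- exists (fun w u => g' w u + h' w u); split; [constructor; auto | intros; apply deriv_plus; auto].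
- exists (fun w u => g' w u * h w u + g w u * h' w u); split.
  + apply tame_plus; apply tame_mult; auto.
  + intros w u. apply (deriv_mult (fun v => g v u) (fun v => h v u)); auto.
- exists g'; split; [auto|]. intros w u; apply deriv_ext with (fun v => g v u); auto.
Qed.

Lemma tame_du g : tame g -> exists gu, tame gu /\ forall w u, cder (g w) u (gu w u).
Proof.
induction 1 as [c | | | | | | c Hc | c Hc | g h _ [g' [Tg Dg]] _ [h' [Th Dh]] | g h Hg [g' [Tg Dg]] Hh [h' [Th Dh]] | g h E _ [g' [Tg Dg]]].
- exists (fun _ _ => RtoC 0); split; [constructor | intros; apply deriv_const].
- exists (fun _ _ => RtoC 0); split; [constructor | intros; apply deriv_const].
- exists (fun _ _ => RtoC 1); split; [constructor | intros; apply cder_id].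
- exists (fun _ _ => RtoC 0); split; [constructor | intros; apply deriv_const].
- exists (fun _ u => Cexp u); split; [constructor | intros; apply cder_Cexp].
- exists (fun _ u => - (1) * Cexp (- u)); split; [apply tame_mult; constructor|].
  intros w u. apply deriv_eq with (Cexp (- u) * (- (1))); [ring|].
  apply (cder_Cexp_comp (fun u => - u)), deriv_opp, cder_id.
- exists (fun w u => pser (theta c) (Cexp (w + u))); split; [constructor; apply min_type_theta, Hc|].
  intros w u. apply deriv_eq with ((0 + 1) * pser (theta c) (Cexp (w + u))); [ring|].
  apply (cder_pser_exp c (fun v => w + v)); [apply min_type_exp_type, Hc|].
  apply deriv_plus; [apply deriv_const | apply cder_id].
- exists (fun w u => - (1) * pser (theta c) (Cexp (2 * w - u))); split.
  + exact (tame_mult _ _ (tame_const (- (1))) (tame_E _ (exp_type_theta c Hc))).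
  + intros w u. apply deriv_eq with ((0 - 1) * pser (theta c) (Cexp (2 * w - u))); [ring|].
    apply (cder_pser_exp c (fun v => 2 * w - v)); [exact Hc|].
    apply deriv_minus; [apply deriv_const | apply cder_id].
- exists (fun w u => g' w u + h' w u); split; [constructor; auto | intros; apply deriv_plus; auto].
- exists (fun w u => g' w u * h w u + g w u * h' w u); split.
  + apply tame_plus; apply tame_mult; auto.
  + intros w u. apply (deriv_mult (g w) (h w)); auto.
- exists g'; split; [auto|]. intros w u; apply deriv_ext with (g w); auto.
Qed.

Lemma lin_le_exp d x : (0 < d)%R -> (x <= / d * exp (d * x))%R.
Proof.
intros Hd. assert (H := exp_ge_1x (d * x)). apply Rmult_le_reg_l with d; [auto|].
rewrite <- Rmult_assoc, Rinv_r by lra. lra.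
Qed.

Lemma exp_ge_1 x : (0 <= x)%R -> (1 <= exp x)%R.
Proof. intros H; assert (A := exp_ge_1x x); lra. Qed.

(** Besides the growth in [u], the bound controls [w] when [Re w] tends to minus
    infinity in a horizontal strip: there [g] grows more slowly than any
    [exp (del |w|)], hence than any negative power of [|z|]. *)
Definition tame_bd (g : C -> C -> C) : Prop := forall rho eps del, (0 < eps)%R -> (0 < del)%R ->
  exists A, (0 <= A)%R /\ forall w u, (Re w <= rho)%R -> (Rabs (Im w) <= rho)%R ->
    (- rho <= Re u)%R -> (Rabs (Im u) <= rho)%R ->
    (Cmod (g w u) <= A * (exp (del * Cmod w) * exp (eps * exp (Re u))))%R.

Lemma tame_bound g : tame g -> tame_bd g.
Proof.
(* Most generators are bounded by the second weight alone. *)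
assert (W1 : forall g, (forall rho eps, (0 < eps)%R -> exists A, (0 <= A)%R /\ forall w u, (Re w <= rho)%R ->
  (- rho <= Re u)%R -> (Rabs (Im u) <= rho)%R -> (Cmod (g w u) <= A * exp (eps * exp (Re u)))%R) -> tame_bd g).
{ intros g0 H rho eps del He Hd. destruct (H rho eps He) as [A [HA B]]. exists A; split; [auto|].
  intros w u H1 H2 H3 H4. eapply Rle_trans; [apply B; auto|]. apply Rmult_le_compat_l; [auto|].
  assert (X := exp_ge_1 (del * Cmod w) ltac:(apply Rmult_le_pos; [lra | apply Cmod_ge_0])).
  assert (Y := exp_pos (eps * exp (Re u))). nra. }
assert (one : forall eps u, (0 < eps)%R -> (1 <= exp (eps * exp (Re u)))%R).
{ intros eps u He. apply exp_ge_1. apply Rmult_le_pos; [lra | left; apply exp_pos]. }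
induction 1 as [c | | | | | | c Hc | c Hc | g h _ IHg _ IHh | g h _ IHg _ IHh | g h E _ IHg].
- apply W1. intros rho eps He; exists (Cmod c); split; [apply Cmod_ge_0|]; intros w u _ _ _.
  assert (X := one eps u He). assert (P := Cmod_ge_0 c). nra.
- intros rho eps del He Hd. exists (/ del)%R; split; [left; apply Rinv_0_lt_compat; auto|].
  intros w u _ _ _ _. assert (X := one eps u He). assert (Y := lin_le_exp del (Cmod w) Hd).
  assert (P := Cmod_ge_0 w). rewrite <- Rmult_assoc. nra.
- apply W1. intros rho eps He; exists (/ eps + 2 * Rabs rho)%R.
  assert (I := Rinv_0_lt_compat _ He). assert (Pr := Rabs_pos rho).
  split; [lra|]; intros w u _ H1 H2. assert (X := one eps u He).
  assert (Y := lin_le_exp eps (exp (Re u)) He). assert (Z := exp_ge_1x (Re u)). assert (Zp := exp_pos (Re u)).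
  assert (Q := Rle_abs rho).
  eapply Rle_trans; [apply Cmod_le_ReIm|].
  assert (T : (Rabs (Re u) <= exp (Re u) + Rabs rho)%R) by (apply Rabs_le; lra). nra.
- apply W1. intros rho eps He; exists (exp rho); split; [left; apply exp_pos|]; intros w u H1 _ _.
  rewrite Cmod_Cexp. assert (X := one eps u He). assert (Y := exp_le _ _ H1). assert (Z := exp_pos rho). nra.
- apply W1. intros rho eps He; exists (/ eps)%R; split; [left; apply Rinv_0_lt_compat; auto|]; intros w u _ _ _.
  rewrite Cmod_Cexp. apply (lin_le_exp eps (exp (Re u)) He).
- apply W1. intros rho eps He; exists (exp rho); split; [left; apply exp_pos|]; intros w u _ H1 _.
  rewrite Cmod_Cexp. change (Re (- u)) with (- Re u)%R.
  assert (X := one eps u He). assert (Y := exp_le (- Re u) rho ltac:(lra)). assert (Z := exp_pos rho). nra.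
- apply W1. intros rho eps He. set (K := (eps * exp (- rho))%R).
  assert (HK : (0 < K)%R) by (apply Rmult_lt_0_compat; [auto | apply exp_pos]).
  destruct (Hc K HK) as [A [HA B]]. exists (2 * A)%R; split; [lra|]. intros w u H1 H2 H3.
  eapply Rle_trans; [apply (pser_bound A K c); auto; lra|].
  rewrite Rmult_assoc. apply Rmult_le_compat_l; [lra|]. apply Rmult_le_compat_l; [auto|]. apply exp_le.
  rewrite Cmod_Cexp. change (Re (w + u)) with (Re w + Re u)%R. unfold K. rewrite Rmult_assoc, <- exp_plus.
  apply Rmult_le_compat_l; [lra|]. apply exp_le; lra.
- apply W1. intros rho eps He. destruct Hc as [A [K [HA [HK B]]]].
  exists (2 * (A * exp (K * exp (3 * rho))))%R.
  assert (P := exp_pos (K * exp (3 * rho))).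
  split; [nra|]. intros w u H1 H2 H3. assert (X := one eps u He).
  eapply Rle_trans; [apply (pser_bound A K c); auto|].
  assert (Y : (exp (K * Cmod (Cexp (2 * w - u))) <= exp (K * exp (3 * rho)))%R).
  { apply exp_le, Rmult_le_compat_l; [auto|]. rewrite Cmod_Cexp. apply exp_le.
    replace (Re (2 * w - u)) with (2 * Re w - Re u)%R by (unfold Re; simpl; ring). lra. }
  assert (Y2 : (A * exp (K * Cmod (Cexp (2 * w - u))) <= A * exp (K * exp (3 * rho)))%R) by (apply Rmult_le_compat_l; auto).
  assert (Y3 : (0 <= A * exp (K * exp (3 * rho)))%R) by (apply Rmult_le_pos; lra). nra.
- intros rho eps del He Hd. destruct (IHg rho eps del He Hd) as [A [HA BA]]. destruct (IHh rho eps del He Hd) as [B [HB BB]].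
  exists (A + B)%R; split; [lra|]. intros w u H1 H2 H3 H4. specialize (BA w u H1 H2 H3 H4). specialize (BB w u H1 H2 H3 H4).
  eapply Rle_trans; [apply Cmod_triangle|]. lra.
- intros rho eps del He Hd. destruct (IHg rho (eps/2)%R (del/2)%R) as [A [HA BA]]; [lra|lra|].
  destruct (IHh rho (eps/2)%R (del/2)%R) as [B [HB BB]]; [lra|lra|].
  exists (A * B)%R; split; [apply Rmult_le_pos; auto|]. intros w u H1 H2 H3 H4. specialize (BA w u H1 H2 H3 H4). specialize (BB w u H1 H2 H3 H4).
  rewrite Cmod_mult.
  replace (eps * exp (Re u))%R with (eps / 2 * exp (Re u) + eps / 2 * exp (Re u))%R by field.
  replace (del * Cmod w)%R with (del / 2 * Cmod w + del / 2 * Cmod w)%R by field.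
  rewrite !exp_plus.
  set (X := exp (eps / 2 * exp (Re u))) in *. set (Y := exp (del / 2 * Cmod w)) in *.
  replace (A * B * (Y * Y * (X * X)))%R with (A * (Y * X) * (B * (Y * X)))%R by ring.
  apply Rmult_le_compat; auto; apply Cmod_ge_0.
- intros rho eps del He Hd. destruct (IHg rho eps del He Hd) as [A [HA BA]]. exists A; split; [auto|].
  intros w u; rewrite <- E; apply BA.
Qed.

Lemma tame_subexp g w : tame g -> subexp (g w).
Proof.
intros Hg rho eps He.
destruct (tame_bound g Hg (Rabs rho + Cmod w)%R eps 1%R He Rlt_0_1) as [A [HA B]].
exists (A * exp (1 * Cmod w))%R. split; [apply Rmult_le_pos; [auto | left; apply exp_pos]|].
intros u H1 H2. rewrite Rmult_assoc. assert (Q := Rle_abs rho). assert (Q2 := Rabs_pos rho). assert (P := Cmod_ge_0 w).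
assert (R1 := re_le_Cmod w). assert (R2 := Rle_abs (Re w)). assert (R3 := Im_le_Cmod w).
apply B; lra.
Qed.

Lemma tame_admissible g w : tame g -> admissible (g w).
Proof.
intros Hg. destruct (tame_du g Hg) as [g1 [T1 D1]]. destruct (tame_du g1 T1) as [g2 [T2 D2]].
exists (g1 w), (g2 w). repeat split; auto; apply tame_subexp; auto.
Qed.

Lemma hankel_tame_lin H (a b : C) f g w : tame f -> tame g ->
  hankel H (fun u => a * f w u + b * g w u) = a * hankel H (f w) + b * hankel H (g w).
Proof. intros Hf Hg; apply hankel_lin; apply tame_admissible; auto. Qed.

Lemma tame_scal c g : tame g -> tame (fun w u => c * g w u).
Proof. intros H. exact (tame_mult _ _ (tame_const c) H). Qed.

Lemma tame_lin (a b : C) f g : tame f -> tame g -> tame (fun w u => a * f w u + b * g w u).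
Proof. intros; apply tame_plus; apply tame_scal; auto. Qed.

Lemma tame_minus g h : tame g -> tame h -> tame (fun w u => g w u - h w u).
Proof.
intros Hg Hh. apply tame_ext with (fun w u => 1 * g w u + - (1) * h w u); [intros; ring|].
apply tame_lin; auto.
Qed.

(** Taylor's formula in [w] bounds the remainder uniformly along the contour by
    the square of the increment times [exp (e^(Re u) / 2)], a weight for which
    the Hankel functional is bounded. *)
Lemma hankel_dw H g gw : tame g -> tame gw -> (forall w u, cder (fun v => g v u) w (gw w u)) ->
  forall w, cder (fun v => hankel H (g v)) w (hankel H (gw w)).
Proof.
intros Hg Hgw D w eps He.
destruct (tame_dw gw Hgw) as [gww [Hgww D2]].
set (rho := (Cmod w + 1 + PI)%R). assert (PIpos := PI_RGT_0). assert (Pw := Cmod_ge_0 w).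
destruct (tame_bound gww Hgww rho (1/2)%R 1%R) as [A [HA B]]; [lra | lra |].
set (M := (A * exp (Cmod w + 1))%R).
assert (HM : (0 <= M)%R) by (apply Rmult_le_pos; [auto | left; apply exp_pos]).
assert (HN := hankel_norm_pos).
set (K := (hankel_norm * (4 * M) + 1)%R).
assert (HK : (0 < K)%R) by (unfold K; nra).
exists (Rmin 1 (eps / K)). split; [apply Rmin_pos; [lra | apply Rdiv_lt_0_compat; auto]|].
intros y Hy.  use_Rmin.
set (h := Cmod (y - w)) in *. assert (Hh : (0 <= h)%R) by apply Cmod_ge_0.
assert (N1 := tame_admissible g y Hg). assert (N2 := tame_admissible g w Hg). assert (N3 := tame_admissible gw w Hgw).
assert (E : hankel H (fun u => 1 * (1 * g y u + - (1) * g w u) + - (y - w) * gw w u) =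
  hankel H (g y) - hankel H (g w) - (y - w) * hankel H (gw w)).
{ rewrite (hankel_lin H 1 _ (fun u => 1 * g y u + - (1) * g w u)), hankel_lin; auto using admissible_lin. ring. }
rewrite <- E.
eapply Rle_trans; [apply (hankel_bound H _ (4 * M * h ^ 2)%R)|].
- auto using admissible_lin.
- assert (0 <= h ^ 2)%R by (apply pow2_ge_0). nra.
- intros u HRe HIm.
  replace (1 * (1 * g y u + - (1) * g w u) + - (y - w) * gw w u) with (g y u - g w u - (y - w) * gw w u) by ring.
  eapply Rle_trans; [apply (cder_taylor (fun v => g v u) (fun v => gw v u) (fun v => gww v u) w y (M * exp (1/2 * exp (Re u))))|].
  + intros; apply D.
  + intros; apply D2.
  + intros t Ht. set (v := seg w y t).
    assert (Hv : (Cmod v <= Cmod w + 1)%R).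
    { unfold v, seg. eapply Rle_trans; [apply Cmod_triangle|]. rewrite Cmod_mult, Cmod_R, Rabs_pos_eq by lra. fold h. nra. }
    assert (R1 := re_le_Cmod v). assert (R2 := Rle_abs (Re v)). assert (R3 := Im_le_Cmod v).
    eapply Rle_trans; [apply B; unfold rho; lra|].
    unfold M. rewrite Rmult_assoc. apply Rmult_le_compat_l; [auto|].
    apply Rmult_le_compat_r; [left; apply exp_pos|]. apply exp_le; lra.
  + fold h. right; ring.
- replace (hankel_norm * (4 * M * h ^ 2))%R with (hankel_norm * (4 * M) * h * h)%R by ring.
  apply Rmult_le_compat_r; [auto|].
  apply Rle_trans with (K * (eps / K))%R; [|right; field; lra].
  apply Rmult_le_compat; [nra | auto | unfold K; lra | lra].
Qed.

(** * From the Hankel integral to the scalar equation *)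

(** Let [theta1] and [theta2] differentiate the first factor of the integrand, with
    respect to the logarithm of its argument and divided by 2, and the second one,
    so that [theta = theta1 + 2 theta2].  The functions are the integral [F] and
    its images under [theta1], [theta2] and [theta1 theta2].  The equations
    rewrite [theta1^2 F = z (theta2 - theta1) F] and
    [theta2 (theta2 - theta1) F = z^2 F]. *)
Definition system (F F1 F2 F12 : C -> C) : Prop := forall w, let z := Cexp w in
  cder F w (F1 w + 2 * F2 w) /\
  cder F1 w (z * (F2 w - F1 w) + 2 * F12 w) /\
  cder F2 w (3 * F12 w + 2 * z ^ 2 * F w) /\
  cder F12 w (3 * z ^ 3 * F w + 2 * z ^ 2 * F1 w).

(** The powers [theta^k F] for [k <= 4], reduced by the equations of [system]. *)
Definition theta_power (F F1 F2 F12 : C -> C) (k : nat) (w : C) : C := let z := Cexp w in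
  match k with
  | 0 => F w
  | 1 => F1 w + 2 * F2 w
  | 2 => 4 * z ^ 2 * F w - z * F1 w + z * F2 w + 8 * F12 w
  | 3 => (26 * z ^ 3 + 8 * z ^ 2) * F w + (21 * z ^ 2 - z) * F1 w + (7 * z ^ 2 + z) * F2 w + z * F12 w
  | _ => (78 * z ^ 3 + 16 * z ^ 2) * F w + (26 * z ^ 3 + 8 * z ^ 2) * (F1 w + 2 * F2 w)
    + (42 * z ^ 2 - z) * F1 w + (21 * z ^ 2 - z) * (z * (F2 w - F1 w) + 2 * F12 w)
    + (14 * z ^ 2 + z) * F2 w + (7 * z ^ 2 + z) * (3 * F12 w + 2 * z ^ 2 * F w)
    + z * F12 w + z * (3 * z ^ 3 * F w + 2 * z ^ 2 * F1 w)
  end.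

Lemma theta_power_derive F F1 F2 F12 : system F F1 F2 F12 -> forall k w, (k < 4)%nat ->
  cder (theta_power F F1 F2 F12 k) w (theta_power F F1 F2 F12 (S k) w).
Proof.
intros HS k w Hk. destruct (HS w) as [D [D1 [D2 D12]]]; simpl in D, D1, D2, D12.
assert (DE := cder_Cexp w).
assert (E2 : RtoC (INR 2) = 2) by (simpl; f_equal; ring). assert (E3 : RtoC (INR 3) = 3) by (simpl; f_equal; ring).
destruct k as [|[|[|[|k]]]]; [| | | | lia]; unfold theta_power; cbv zeta; derivative;
  rewrite ?E2, ?E3; simpl; ring.
Qed.

Lemma theta_power_ode F F1 F2 F12 w : let T := theta_power F F1 F2 F12 in let z := Cexp w in
  (283 * z - 24) * T 4%nat w
      + (283 * z ^ 2 - 590 * z + 24) * T 3%nat w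
      + z * (- (2264) * z ^ 2 + 192 * z + 3) * T 2%nat w
      - 4 * z ^ 2 * (2547 * z ^ 2 + 350 * z - 104) * T 1%nat w
      + z ^ 2 * (- (3113) * z ^ 3 - 9924 * z ^ 2 + 1476 * z + 192) * T 0%nat w
      = 0.
Proof. cbv zeta. unfold theta_power. generalize (Cexp w) (F w) (F1 w) (F2 w) (F12 w); intros. ring. Qed.

Lemma system_master F F1 F2 F12 : system F F1 F2 F12 -> master_space_P F.
Proof.
intros HS; split.
- intros w; exists (F1 w + 2 * F2 w). apply cder_is_derive, HS.
- exists (theta_power F F1 F2 F12). split; [reflexivity|split].
  + intros k w Hk; apply cder_is_derive, theta_power_derive; auto.
  + intros w; apply theta_power_ode.
Qed.

Lemma system_lin a b F F1 F2 F12 G G1 G2 G12 : system F F1 F2 F12 -> system G G1 G2 G12 ->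
  system (fun w => a * F w + b * G w) (fun w => a * F1 w + b * G1 w)
       (fun w => a * F2 w + b * G2 w) (fun w => a * F12 w + b * G12 w).
Proof.
intros HF HG w z. destruct (HF w) as [A1 [A2 [A3 A4]]]. destruct (HG w) as [B1 [B2 [B3 B4]]].
fold z in A1, A2, A3, A4, B1, B2, B3, B4.
repeat split; (eapply deriv_eq; [|apply deriv_plus; apply deriv_scal; eassumption]); simpl; ring.
Qed.

Lemma system_ext F F1 F2 F12 G G1 G2 G12 : (forall w, F w = G w) -> (forall w, F1 w = G1 w) ->
  (forall w, F2 w = G2 w) -> (forall w, F12 w = G12 w) -> system F F1 F2 F12 -> system G G1 G2 G12.
Proof.
intros E E1 E2 E12 HS w z. destruct (HS w) as [A1 [A2 [A3 A4]]]. fold z in A1, A2, A3, A4.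
rewrite <- (E w), <- (E1 w), <- (E2 w), <- (E12 w).
repeat split; eapply deriv_ext; eassumption.
Qed.

(** Integrands whose Hankel integrals satisfy [system].  Here [g1], [g2], [g12]
    are the images of [g] under [theta1], [theta2], [theta1 theta2]; as functions
    of [w] and [u] the derivations are [theta1 + 2 theta2] and
    [theta1 - theta2].  The relation [theta1^2 = z x] is part of the derivatives,
    and [theta2 = z^2 / x] holds up to the remainders [r] and [r1]. *)
Record hankel_family (g g1 g2 g12 r r1 : C -> C -> C) : Prop := HankelFamily {
  hf_tame : tame g; hf_tame1 : tame g1; hf_tame2 : tame g2; hf_tame12 : tame g12;
  hf_tame_r : tame r; hf_tame_r1 : tame r1;
  hf_der : exists g22 g122, tame g22 /\ tame g122 /\ forall w u,
    cder (fun v => g v u) w (g1 w u + 2 * g2 w u) /\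
    cder (g w) u (g1 w u - g2 w u) /\
    cder (fun v => g1 v u) w (Cexp w * Cexp u * g w u + 2 * g12 w u) /\
    cder (fun v => g2 v u) w (g12 w u + 2 * g22 w u) /\
    cder (g2 w) u (g12 w u - g22 w u) /\
    cder (fun v => g12 v u) w (Cexp w * Cexp u * g2 w u + 2 * g122 w u) /\
    cder (g12 w) u (Cexp w * Cexp u * g2 w u - g122 w u);
  hf_r : forall w u, Cexp u * g2 w u = Cexp w ^ 2 * g w u + r w u;
  hf_r1 : forall w u, Cexp u * g12 w u = Cexp w ^ 2 * g1 w u + r1 w u }.

(** Integration by parts gives [x g = (theta2 - theta1) g] under the integral, for
    every [g]; with the two relations on the integrand, and provided that the
    integrals of the remainders vanish, this is [system]. *)
Lemma hankel_family_sys H g g1 g2 g12 r r1 : hankel_family g g1 g2 g12 r r1 ->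
  (forall w, hankel H (r w) = 0) -> (forall w, hankel H (r1 w) = 0) ->
  system (fun w => hankel H (g w)) (fun w => hankel H (g1 w)) (fun w => hankel H (g2 w)) (fun w => hankel H (g12 w)).
Proof.
intros [t t1 t2 t12 tr tr1 [g22 [g122 [t22 [t122 D]]]] Er Er1] Hr Hr1 w z.
assert (X : tame (fun w _ => Cexp w)) by constructor.
assert (U : tame (fun _ u => Cexp u)) by constructor.
assert (XU : tame (fun w u => Cexp w * Cexp u)) by (apply (tame_mult _ _ X U)).
assert (N : forall f, tame f -> admissible (f w)) by (intros f Hf; apply tame_admissible, Hf).
assert (Lin := fun a b f h => hankel_tame_lin H a b f h w).
assert (by_parts : forall f a b, tame f -> tame a -> tame b -> (forall u, cder (f w) u (a w u - b w u)) ->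
   hankel H (fun u => Cexp u * f w u) = hankel H (b w) - hankel H (a w)).
{ intros f a b Hf Ha Hb Df.
  assert (TU : tame (fun w u => Cexp u * f w u)) by (apply (tame_mult _ _ U Hf)).
  assert (TD : tame (fun w u => a w u - b w u)) by (apply tame_minus; auto).
  assert (Z := hankel_by_parts H (f w) (fun u => a w u - b w u) (tame_subexp f w Hf) Df).
  assert (Z' : hankel H (fun u => 1 * (1 * a w u + - (1) * b w u) + 1 * (Cexp u * f w u)) = 0).
  { transitivity (hankel H (fun u => a w u - b w u + f w u * Cexp u)); [apply hankel_ext; intros; ring|].
    apply Z. apply (tame_admissible (fun w u => a w u - b w u + f w u * Cexp u)). apply tame_plus; [auto | apply (tame_mult _ _ Hf U)]. }
  rewrite (Lin 1 1 (fun w u => 1 * a w u + - (1) * b w u) (fun w u => Cexp u * f w u)) in Z'; auto.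
  - rewrite Lin in Z' by auto.
    transitivity ((1 * (1 * hankel H (a w) + - (1) * hankel H (b w)) + 1 * hankel H (fun u => Cexp u * f w u)) + hankel H (b w) - hankel H (a w)); [ring | rewrite Z'; ring].
  - apply tame_plus; apply tame_scal; auto. }
set (F := hankel H (g w)). set (F1 := hankel H (g1 w)). set (F2 := hankel H (g2 w)). set (F12 := hankel H (g12 w)).
assert (I1 : hankel H (fun u => Cexp u * g w u) = F2 - F1).
{ apply by_parts; auto. intros u; apply D. }
assert (I2 : hankel H (fun u => Cexp u * g2 w u) = z ^ 2 * F).
{ transitivity (hankel H (fun u => z ^ 2 * g w u + 1 * r w u)); [apply hankel_ext; intros; rewrite Er; unfold z; ring|].
  rewrite Lin, Hr by auto. unfold F; ring. }
assert (I22 : hankel H (g22 w) = F12 + z ^ 2 * F).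
{ rewrite <- I2, (by_parts g2 g12 g22); auto; [unfold F12; ring | intros u; apply D]. }
assert (I12 : hankel H (fun u => Cexp u * g12 w u) = z ^ 2 * F1).
{ transitivity (hankel H (fun u => z ^ 2 * g1 w u + 1 * r1 w u)); [apply hankel_ext; intros; rewrite Er1; unfold z; ring|].
  rewrite Lin, Hr1 by auto. unfold F1; ring. }
assert (Ux : forall f, tame f -> hankel H (fun u => Cexp w * Cexp u * f w u) = z * hankel H (fun u => Cexp u * f w u)).
{ intros f Hf. rewrite <- hankel_scal; [apply hankel_ext; intros; unfold z; ring|].
  apply (tame_admissible (fun w u => Cexp u * f w u)), (tame_mult _ _ U Hf). }
assert (I122 : hankel H (g122 w) = z ^ 3 * F + z ^ 2 * F1).
{ assert (T3 := tame_mult _ _ XU t2). cbv beta in T3.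
  rewrite <- I12, (by_parts g12 (fun w u => Cexp w * Cexp u * g2 w u) g122); auto; [|intros u; apply D].
  rewrite (Ux g2 t2), I2; ring. }
assert (dl : forall f f1 f2, tame f -> tame f1 -> tame f2 ->
  (forall w u, cder (fun v => f v u) w (1 * f1 w u + 2 * f2 w u)) ->
  cder (fun v => hankel H (f v)) w (hankel H (f1 w) + 2 * hankel H (f2 w))).
{ intros f f1 f2 Hf Hf1 Hf2 Df.
  eapply deriv_eq; [|apply (hankel_dw H f (fun w u => 1 * f1 w u + 2 * f2 w u) Hf); [apply tame_plus; apply tame_scal; auto | exact Df]].
  rewrite Lin by auto. ring. }
repeat split.
- apply dl; auto. intros w' u'; eapply deriv_eq; [|apply (D w' u')]. ring.
- rewrite <- I1, <- (Ux g t). apply (dl g1 (fun w u => Cexp w * Cexp u * g w u) g12); auto.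
  + apply (tame_mult _ _ XU t).
  + intros w' u'; eapply deriv_eq; [|apply (D w' u')]. ring.
- eapply deriv_eq; [|apply (dl g2 g12 g22); auto].
  + rewrite I22. fold F12 F. ring.
  + intros w' u'; eapply deriv_eq; [|apply (D w' u')]. ring.
- eapply deriv_eq; [|apply (dl g12 (fun w u => Cexp w * Cexp u * g2 w u) g122); auto].
  + rewrite (Ux g2 t2), I2, I122. fold F F1. simpl; ring.
  + apply (tame_mult _ _ XU t2).
  + intros w' u'; eapply deriv_eq; [|apply (D w' u')]. ring.
Qed.

Lemma hankel_family_lin (a b : C) g g1 g2 g12 r r1 h h1 h2 h12 s s1 :
  hankel_family g g1 g2 g12 r r1 -> hankel_family h h1 h2 h12 s s1 ->
  hankel_family (fun w u => a * g w u + b * h w u) (fun w u => a * g1 w u + b * h1 w u)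
   (fun w u => a * g2 w u + b * h2 w u) (fun w u => a * g12 w u + b * h12 w u)
   (fun w u => a * r w u + b * s w u) (fun w u => a * r1 w u + b * s1 w u).
Proof.
intros [t t1 t2 t12 tr tr1 [g22 [g122 [t22 [t122 D]]]] Er Er1] [t' t1' t2' t12' tr' tr1' [h22 [h122 [t22' [t122' D']]]] Es Es1].
constructor; try (apply tame_plus; apply tame_scal; assumption).
- exists (fun w u => a * g22 w u + b * h22 w u), (fun w u => a * g122 w u + b * h122 w u).
  split; [apply tame_plus; apply tame_scal; assumption|].
  split; [apply tame_plus; apply tame_scal; assumption|]. intros w u.
  destruct (D w u) as [A1 [A2 [A3 [A4 [A5 [A6 A7]]]]]]. destruct (D' w u) as [B1 [B2 [B3 [B4 [B5 [B6 B7]]]]]].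
  repeat split; (eapply deriv_eq; [|apply deriv_plus; apply deriv_scal; eassumption]); ring.
- intros w u.
  transitivity (a * (Cexp u * g2 w u) + b * (Cexp u * h2 w u)); [ring | rewrite Er, Es; ring].
- intros w u.
  transitivity (a * (Cexp u * g12 w u) + b * (Cexp u * h12 w u)); [ring | rewrite Er1, Es1; ring].
Qed.

(** * Products of two factors *)

Definition first_arg (w u : C) : C := (w + u) / 2.
Definition second_arg (w u : C) : C := 2 * w - u.
Definition factors (p q : C -> C) (w u : C) : C := p (first_arg w u) * q (second_arg w u).

(** A solution of [theta1^2 p = e^(2 a) p], with [p1 = theta1 p]; the argument of
    the first factor has [e^(2 a) = z x]. *)
Record first_factor (p p1 : C -> C) : Prop := FirstFactor {
  ff_der : forall a, cder p a (2 * p1 a);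
  ff_der1 : forall a, cder p1 a (2 * (Cexp (2 * a) * p a));
  ff_tame : tame (fun w u => p (first_arg w u));
  ff_tame1 : tame (fun w u => p1 (first_arg w u)) }.

Definition dfactor (q rho : C -> C) (b : C) : C := Cexp b * q b + rho b.

(** A solution of [q' = e^b q + rho]; the argument of the second factor has
    [e^b = z^2 / x]. *)
Record second_factor (q rho : C -> C) : Prop := SecondFactor {
  sf_der : forall b, cder q b (dfactor q rho b);
  sf_rho : exists rho1, (forall b, cder rho b (rho1 b)) /\ tame (fun w u => rho1 (second_arg w u));
  sf_tame : tame (fun w u => q (second_arg w u));
  sf_tame_rho : tame (fun w u => rho (second_arg w u)) }.

Lemma tame_exp_second : tame (fun w u => Cexp (second_arg w u)).
Proof.
apply tame_ext with (fun w u => Cexp w * Cexp w * Cexp (- u)).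
- intros w u. rewrite <- !Cexp_plus. f_equal; unfold second_arg; ring.
- exact (tame_mult _ _ (tame_mult _ _ tame_expw tame_expw) tame_expnu).
Qed.

Lemma tame_dfactor q rho : second_factor q rho -> tame (fun w u => dfactor q rho (second_arg w u)).
Proof. intros Q. exact (tame_plus _ _ (tame_mult _ _ tame_exp_second (sf_tame _ _ Q)) (sf_tame_rho _ _ Q)). Qed.

Lemma hankel_family_factors p p1 q rho : first_factor p p1 -> second_factor q rho ->
  hankel_family (factors p q) (factors p1 q) (factors p (dfactor q rho)) (factors p1 (dfactor q rho))
    (fun w u => Cexp u * factors p rho w u) (fun w u => Cexp u * factors p1 rho w u).
Proof.
intros [Dp Dp1 Tp Tp1] Q. assert (TY := tame_exp_second). assert (Tq1 := tame_dfactor q rho Q).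
destruct Q as [Dq [rho1 [Dr Tr1]] Tq Tr].
set (q1 := dfactor q rho) in *.
set (q2 := fun b => Cexp b * q b + Cexp b * q1 b + rho1 b).
assert (Tq2 : tame (fun w u => q2 (second_arg w u))).
{ unfold q2. apply tame_plus; [apply tame_plus|exact Tr1]; [apply (tame_mult _ _ TY Tq) | apply (tame_mult _ _ TY Tq1)]. }
assert (Dq1 : forall b, cder q1 b (q2 b)).
{ intros b. apply (deriv_plus (fun b => Cexp b * q b) rho); [|apply Dr]. apply (deriv_mult Cexp q); [apply cder_Cexp | apply Dq]. }
assert (aw : forall f f1 : C -> C, (forall a, cder f a (2 * f1 a)) -> forall w u, cder (fun v => f (first_arg v u)) w (f1 (first_arg w u))).
{ intros f f1 Df w u. apply deriv_eq with (2 * f1 (first_arg w u) * (/ 2 * (1 + 0))); [field|].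
  apply (deriv_comp f (fun v => first_arg v u)); [|apply Df].
  apply deriv_ext with (fun v => / 2 * (v + u)); [intros; unfold first_arg, Cdiv; ring|].
  apply deriv_scal, deriv_plus; [apply cder_id | apply deriv_const]. }
assert (au : forall f f1 : C -> C, (forall a, cder f a (2 * f1 a)) -> forall w u, cder (fun v => f (first_arg w v)) u (f1 (first_arg w u))).
{ intros f f1 Df w u. apply deriv_eq with (2 * f1 (first_arg w u) * (/ 2 * (0 + 1))); [field|].
  apply (deriv_comp f (fun v => first_arg w v)); [|apply Df].
  apply deriv_ext with (fun v => / 2 * (w + v)); [intros; unfold first_arg, Cdiv; ring|].
  apply deriv_scal, deriv_plus; [apply deriv_const | apply cder_id]. }
assert (bw : forall f f1 : C -> C, (forall a, cder f a (f1 a)) -> forall w u, cder (fun v => f (second_arg v u)) w (2 * f1 (second_arg w u))).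
{ intros f f1 Df w u. apply deriv_eq with (f1 (second_arg w u) * (2 * 1 - 0)); [ring|].
  apply (deriv_comp f (fun v => second_arg v u)); [|apply Df]. apply deriv_minus; [apply deriv_scal, cder_id | apply deriv_const]. }
assert (bu : forall f f1 : C -> C, (forall a, cder f a (f1 a)) -> forall w u, cder (fun v => f (second_arg w v)) u (- f1 (second_arg w u))).
{ intros f f1 Df w u. apply deriv_eq with (f1 (second_arg w u) * (0 - 1)); [ring|].
  apply (deriv_comp f (fun v => second_arg w v)); [|apply Df]. apply deriv_minus; [apply deriv_const | apply cder_id]. }
assert (mw : forall f f1 h h1 : C -> C, (forall a, cder f a (2 * f1 a)) -> (forall b, cder h b (h1 b)) -> forall w u,
  cder (fun v => factors f h v u) w (factors f1 h w u + 2 * factors f h1 w u)).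
{ intros f f1 h h1 Hf Hh w u. eapply deriv_eq; [|exact (deriv_mult _ _ _ _ _ (aw f f1 Hf w u) (bw h h1 Hh w u))].
  unfold factors; ring. }
assert (mu : forall f f1 h h1 : C -> C, (forall a, cder f a (2 * f1 a)) -> (forall b, cder h b (h1 b)) -> forall w u,
  cder (factors f h w) u (factors f1 h w u - factors f h1 w u)).
{ intros f f1 h h1 Hf Hh w u. eapply deriv_eq; [|exact (deriv_mult _ _ _ _ _ (au f f1 Hf w u) (bu h h1 Hh w u))].
  unfold factors; ring. }
assert (xy : forall w u, Cexp u * Cexp (second_arg w u) = Cexp w ^ 2).
{ intros w u. simpl. rewrite Cmult_1_r, <- !Cexp_plus. f_equal; unfold second_arg; ring. }
assert (zx : forall w u, Cexp (2 * first_arg w u) = Cexp w * Cexp u).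
{ intros w u. rewrite <- Cexp_plus. f_equal; unfold first_arg; field. }
assert (U : tame (fun _ u => Cexp u)) by constructor.
constructor; try (apply tame_mult; assumption).
- exact (tame_mult _ _ U (tame_mult _ _ Tp Tr)).
- exact (tame_mult _ _ U (tame_mult _ _ Tp1 Tr)).
- exists (factors p q2), (factors p1 q2).
  split; [apply tame_mult; assumption|]. split; [apply tame_mult; assumption|]. intros w u.
  repeat split.
  + apply mw; auto.
  + apply mu; auto.
  + eapply deriv_eq; [|apply (mw p1 _ q q1 Dp1 Dq w u)]. unfold factors; rewrite zx; ring.
  + apply mw; auto.
  + apply mu; auto.
  + eapply deriv_eq; [|apply (mw p1 _ q1 q2 Dp1 Dq1 w u)]. unfold factors; rewrite zx; ring.
  + eapply deriv_eq; [|apply (mu p1 _ q1 q2 Dp1 Dq1 w u)]. unfold factors; rewrite zx; ring.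
- intros w u. unfold q1, dfactor, factors. rewrite <- (xy w u). ring.
- intros w u. unfold q1, dfactor, factors. rewrite <- (xy w u). ring.
Qed.

(** * Hankel integrals of single valued functions *)

Lemma cder_unique f x l m : cder f x l -> cder f x m -> l = m.
Proof.
intros H1 H2. apply cder_is_derive in H1; apply cder_is_derive in H2.
rewrite <- (is_C_derive_unique _ _ _ H1). apply is_C_derive_unique, H2.
Qed.

Lemma cder_zero_const (f : C -> C) : (forall x, cder f x 0) -> forall x y, f x = f y.
Proof.
intros H x y.
assert (A := cder_mean_value f (fun _ => 0) y x 0 (fun t _ => H _) (fun t _ => Req_le _ _ Cmod_0)).
assert (B : Cmod (f x - f y) = 0%R) by (assert (P := Cmod_ge_0 (f x - f y)); lra).
apply Cmod_eq_0 in B. replace (f x) with ((f x - f y) + f y) by ring. rewrite B; ring.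
Qed.

Lemma dcoef_coef_e k : dcoef coef_e k = coef_e k.
Proof.
unfold dcoef, unshift. rewrite theta_coef_e. reflexivity.
Qed.

Lemma pser_coef_e x : pser coef_e x = Cexp x.
Proof.
assert (D : forall y, cder (fun y => pser coef_e y * Cexp (- y)) y 0).
{ intros y. apply deriv_eq with (pser (dcoef coef_e) y * Cexp (- y) + pser coef_e y * (Cexp (- y) * - (1))).
  - rewrite (pser_ext (dcoef coef_e) coef_e y dcoef_coef_e exp_type_coef_e). ring.
  - apply (deriv_mult (pser coef_e) (fun y => Cexp (- y))); [apply cder_pser, exp_type_coef_e|].
    apply (cder_Cexp_comp (fun y => - y)), deriv_opp, cder_id. }
assert (E := cder_zero_const _ D x 0). cbv beta in E.
replace (- (0)) with (RtoC 0) in E by ring.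
rewrite Cexp_0, (pser_unshift coef_e 0) in E by apply exp_type_coef_e.
replace (coef_e O) with 1%R in E by (unfold coef_e; simpl; field).
transitivity (pser coef_e x * Cexp (- x) * Cexp x); [rewrite <- Cmult_assoc, Cexp_opp; ring | rewrite E; ring].
Qed.

(** The series [d] is a primitive of [(exp x - 1) / x], and [exp x / x] has the
    primitive [d x + log x]. *)
Lemma hankel_one H : hankel H (fun _ => 1) = 2 * PI * Ci.
Proof.
set (d := fun k => (/ INR k * coef_e k)%R).
assert (Ed : exp_type d).
{ apply (exp_type_intro _ 1); [lra|]. intros k; unfold d, coef_e.
  assert (I := Rinv_0_lt_compat _ (INR_fact_pos k)). rewrite pow1, Rabs_mult, (Rabs_pos_eq (/ INR (fact k))) by lra.
  apply Rmult_le_compat_r; [lra|]. destruct k as [|k]; [simpl; rewrite Rinv_0, Rabs_R0; lra|].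
  assert (B := inv_INR_S_le1 k). rewrite Rabs_pos_eq; lra. }
assert (Edc : forall k, dcoef d k = unshift coef_e k).
{ intros k. unfold dcoef, unshift, theta, d. field. apply not_0_INR; lia. }
rewrite (hankel_single_valued H (fun _ => 1) (pser d) 1); [ring | |].
- apply (tame_admissible (fun _ _ => 1) 0). constructor.
- intros u. apply deriv_eq with (pser (dcoef d) (Cexp u) * Cexp u).
  + rewrite (pser_ext (dcoef d) (unshift coef_e) _ Edc (exp_type_unshift _ exp_type_coef_e)). unfold kern. rewrite <- (pser_coef_e (Cexp u)).
    rewrite (pser_unshift coef_e (Cexp u)) by apply exp_type_coef_e.
    replace (coef_e O) with 1%R by (unfold coef_e; simpl; field). ring.
  + apply (deriv_comp (pser d) Cexp); [apply cder_Cexp | apply cder_pser, Ed].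
Qed.

Lemma pser_bounded_disc c rho : exp_type c -> exists M, (0 <= M)%R /\ forall y, (Cmod y <= rho)%R -> (Cmod (pser c y) <= M)%R.
Proof.
intros [A [K [HA [HK B]]]]. exists (2 * (A * exp (K * rho)))%R. assert (P := exp_pos (K * rho)).
split; [assert (0 <= A * exp (K * rho))%R by (apply Rmult_le_pos; lra); lra|].
intros y Hy. eapply Rle_trans; [apply (pser_bound A K c); auto|].
apply Rmult_le_compat_l; [lra|]. apply Rmult_le_compat_l; [auto|]. apply exp_le, Rmult_le_compat_l; auto.
Qed.

(** The factor [x] cancels [dx / x], so that the integrand is entire. *)
Lemma hankel_x_pser H c w : min_type c -> hankel H (fun u => Cexp u * pser c (Cexp (w + u))) = 0.
Proof.
intros Hc. assert (Ec := min_type_exp_type _ Hc). set (z := Cexp w).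
set (G := fun x => pser c (z * x) * Cexp x).
assert (Dp : forall e x, exp_type e -> cder (fun x => pser e (z * x)) x (pser (dcoef e) (z * x) * z)).
{ intros e x He. apply (deriv_comp (pser e) (fun x => z * x)).
  - apply deriv_eq with (z * 1); [ring | apply deriv_scal, cder_id].
  - apply cder_pser, He. }
assert (Ed : exp_type (dcoef c)) by (apply exp_type_unshift, exp_type_theta, Ec).
assert (Edd : exp_type (dcoef (dcoef c))) by (apply exp_type_unshift, exp_type_theta, Ed).
destruct (plane_primitive G (fun x => (pser (dcoef c) (z * x) * z + pser c (z * x)) * Cexp x)
  (fun x => (pser (dcoef (dcoef c)) (z * x) * z * z + 2 * (pser (dcoef c) (z * x) * z) + pser c (z * x)) * Cexp x)) as [P HP].
- intros x. apply deriv_eq with (pser (dcoef c) (z * x) * z * Cexp x + pser c (z * x) * Cexp x); [ring|].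
  apply (deriv_mult (fun x => pser c (z * x)) Cexp); [apply Dp, Ec | apply cder_Cexp].
- intros x. apply deriv_eq with ((z * (pser (dcoef (dcoef c)) (z * x) * z) + pser (dcoef c) (z * x) * z) * Cexp x + (pser (dcoef c) (z * x) * z + pser c (z * x)) * Cexp x); [ring|].
  apply (deriv_mult (fun x => pser (dcoef c) (z * x) * z + pser c (z * x)) Cexp); [|apply cder_Cexp].
  apply deriv_plus; [|apply Dp, Ec].
  apply deriv_ext with (fun x => z * pser (dcoef c) (z * x)); [intros; ring | apply deriv_scal, Dp, Ed].
- intros rho. set (zr := (Cmod z * Rabs rho)%R).
  destruct (pser_bounded_disc c zr Ec) as [M0 [P0 B0]].
  destruct (pser_bounded_disc (dcoef c) zr Ed) as [M1 [P1' B1]].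
  destruct (pser_bounded_disc (dcoef (dcoef c)) zr Edd) as [M2 [P2' B2]].
  assert (Pz := Cmod_ge_0 z).
  exists ((M2 * Cmod z * Cmod z + 2 * (M1 * Cmod z) + M0) * exp rho)%R.
  intros x Hx. assert (Qr := Rle_abs rho). assert (Px := Cmod_ge_0 x).
  assert (Hzx : (Cmod (z * x) <= zr)%R) by (rewrite Cmod_mult; apply Rmult_le_compat_l; lra).
  specialize (B0 _ Hzx); specialize (B1 _ Hzx); specialize (B2 _ Hzx).
  rewrite Cmod_mult, Cmod_Cexp. apply Rmult_le_compat; [apply Cmod_ge_0 | left; apply exp_pos | |].
  + eapply Rle_trans; [apply Cmod_triangle|]. apply Rplus_le_compat; [|exact B0].
    eapply Rle_trans; [apply Cmod_triangle|]. rewrite !Cmod_mult, Cmod_R, (Rabs_pos_eq 2) by lra.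
    apply Rplus_le_compat.
    * repeat apply Rmult_le_compat_r; auto.
    * apply Rmult_le_compat_l; [lra|]. apply Rmult_le_compat_r; auto.
  + apply exp_le. assert (R1 := re_le_Cmod x). assert (R2 := Rle_abs (Re x)). lra.
- rewrite (hankel_single_valued H _ P 0); [ring | |].
  + apply (tame_admissible (fun w u => Cexp u * pser c (Cexp (w + u))) w).
    apply (tame_mult (fun _ u => Cexp u)); constructor; exact Hc.
  + intros u. apply deriv_eq with (G (Cexp u) * Cexp u).
    * unfold G, kern, z. rewrite <- Cexp_plus. ring.
    * apply (deriv_comp P Cexp); [apply cder_Cexp | apply HP].
Qed.

(** * The two factors of the integrand *)

(** [ups1] and [ups2] are the functions Upsilon; [ups1_theta] and [ups2'] are
    their images under half the derivation. *)
Definition ups1 a := pser coef_I (Cexp (2 * a)).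
Definition ups2_tail a := pser coef_IH (Cexp (2 * a)).
Definition ups1_theta a := pser (theta coef_I) (Cexp (2 * a)).
Definition ups2_tail_theta a := pser (theta coef_IH) (Cexp (2 * a)).
Definition ups2 a := a * ups1 a - ups2_tail a.
Definition ups2' a := / 2 * ups1 a + a * ups1_theta a - ups2_tail_theta a.

Lemma cder_pser_2 c a : exp_type c -> cder (fun a => pser c (Cexp (2 * a))) a (2 * pser (theta c) (Cexp (2 * a))).
Proof.
intros H. apply (cder_pser_exp c (fun a => 2 * a)); [exact H|].
apply deriv_eq with (2 * 1); [ring | apply deriv_scal, cder_id].
Qed.

Lemma cder_ups1 a : cder ups1 a (2 * ups1_theta a).
Proof. exact (cder_pser_2 coef_I a (min_type_exp_type _ min_type_coef_I)). Qed.
Lemma cder_ups2_tail a : cder ups2_tail a (2 * ups2_tail_theta a).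
Proof. exact (cder_pser_2 coef_IH a (min_type_exp_type _ min_type_coef_IH)). Qed.
Lemma cder_ups1_theta a : cder ups1_theta a (2 * (Cexp (2 * a) * ups1 a)).
Proof. apply deriv_eq with (2 * pser (theta (theta coef_I)) (Cexp (2 * a))); [rewrite pser_theta2_coef_I; reflexivity|].
exact (cder_pser_2 (theta coef_I) a (min_type_exp_type _ (min_type_theta _ min_type_coef_I))). Qed.
Lemma cder_ups2_tail_theta a : cder ups2_tail_theta a (2 * (Cexp (2 * a) * ups2_tail a + ups1_theta a)).
Proof. apply deriv_eq with (2 * pser (theta (theta coef_IH)) (Cexp (2 * a))); [rewrite pser_theta2_coef_IH; reflexivity|].
exact (cder_pser_2 (theta coef_IH) a (min_type_exp_type _ (min_type_theta _ min_type_coef_IH))). Qed.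

Lemma cder_ups2 a : cder ups2 a (2 * ups2' a).
Proof.
assert (HI := cder_ups1 a). assert (HJ := cder_ups2_tail a).
unfold ups2, ups2'; derivative; field.
Qed.

Lemma cder_ups2' a : cder ups2' a (2 * (Cexp (2 * a) * ups2 a)).
Proof.
assert (HI := cder_ups1 a). assert (HtI := cder_ups1_theta a). assert (HtJ := cder_ups2_tail_theta a).
unfold ups2, ups2'; derivative; field.
Qed.

(** Up to the factor [1 / Gamma (1 + s)], the function of [s] whose derivatives at
    0 are the functions E is the sum of [exp ((m + s) b) / ((1 + s) ... (m + s))];
    these are its value and its first two derivatives at [s = 0]. *)
Definition explog0 b := pser coef_e (Cexp b).
Definition explog1 b := b * explog0 b - pser coef_eH (Cexp b).
Definition explog2 b := b * b * explog0 b - 2 * b * pser coef_eH (Cexp b) + pser coef_eHH (Cexp b).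

Lemma cder_pser_1 c b : exp_type c -> cder (fun b => pser c (Cexp b)) b (pser (theta c) (Cexp b)).
Proof.
intros H. apply deriv_eq with (1 * pser (theta c) (Cexp b)); [ring|].
apply (cder_pser_exp c (fun b => b)); [exact H | apply cder_id].
Qed.

Lemma cder_explog0 b : cder explog0 b (Cexp b * explog0 b).
Proof. apply deriv_eq with (pser (theta coef_e) (Cexp b)); [apply pser_theta_coef_e | exact (cder_pser_1 coef_e b exp_type_coef_e)]. Qed.

Lemma cder_explog1 b : cder explog1 b (Cexp b * explog1 b + 1).
Proof.
assert (H0 := cder_explog0 b). assert (Hk := cder_pser_1 coef_eH b exp_type_coef_eH).
unfold explog1; derivative. rewrite pser_theta_coef_eH; unfold explog0; ring.
Qed.

Lemma cder_explog2 b : cder explog2 b (Cexp b * explog2 b + 2 * b).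
Proof.
assert (H0 := cder_explog0 b). assert (Hk := cder_pser_1 coef_eH b exp_type_coef_eH). assert (Hl := cder_pser_1 coef_eHH b exp_type_coef_eHH).
unfold explog2; derivative. rewrite pser_theta_coef_eH, pser_theta_coef_eHH; unfold explog0; ring.
Qed.

(** Leibniz' rule, where [g1] and [g2] stand for the first two derivatives of
    [1 / Gamma (1 + s)] at [s = 0]. *)
Definition calE1 (g1 b : C) := g1 * explog0 b + explog1 b.
Definition calE2 (g1 g2 b : C) := g2 * explog0 b + 2 * g1 * explog1 b + explog2 b.

Lemma cder_calE1 g1 b : cder (calE1 g1) b (Cexp b * calE1 g1 b + 1).
Proof.
assert (H0 := cder_explog0 b). assert (H1 := cder_explog1 b). unfold calE1; derivative; ring.
Qed.

Lemma cder_calE2 g1 g2 b : cder (calE2 g1 g2) b (Cexp b * calE2 g1 g2 b + 2 * (b + g1)).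
Proof.
assert (H0 := cder_explog0 b). assert (H1 := cder_explog1 b). assert (H2 := cder_explog2 b). unfold calE2; derivative; ring.
Qed.

Lemma tame_first_arg : tame first_arg.
Proof.
apply tame_ext with (fun w u => / 2 * w + / 2 * u); [intros; unfold first_arg; field|].
apply tame_lin; constructor.
Qed.

Lemma tame_second_arg : tame second_arg.
Proof. exact (tame_minus _ _ (tame_scal 2 _ tame_w) tame_u). Qed.

Lemma exp_first_arg w u : Cexp (2 * first_arg w u) = Cexp (w + u).
Proof. unfold first_arg; f_equal; field. Qed.

Lemma tame_pser_first c : min_type c -> tame (fun w u => pser c (Cexp (2 * first_arg w u))).
Proof.
intros H. apply tame_ext with (fun w u => pser c (Cexp (w + u))); [|constructor; exact H].
intros w u; rewrite exp_first_arg; reflexivity.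
Qed.

Lemma tame_pser_second c : exp_type c -> tame (fun w u => pser c (Cexp (second_arg w u))).
Proof. exact (tame_E c). Qed.

Lemma first_factor_1 : first_factor ups1 ups1_theta.
Proof.
split; [exact cder_ups1 | exact cder_ups1_theta | exact (tame_pser_first coef_I min_type_coef_I) |
  exact (tame_pser_first (theta coef_I) (min_type_theta _ min_type_coef_I))].
Qed.

Lemma first_factor_2 : first_factor ups2 ups2'.
Proof.
assert (TI := tame_pser_first coef_I min_type_coef_I). assert (TJ := tame_pser_first coef_IH min_type_coef_IH).
assert (TtI := tame_pser_first (theta coef_I) (min_type_theta _ min_type_coef_I)). assert (TtJ := tame_pser_first (theta coef_IH) (min_type_theta _ min_type_coef_IH)).
split; [exact cder_ups2 | exact cder_ups2' | |].
- exact (tame_minus _ _ (tame_mult _ _ tame_first_arg TI) TJ).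
- exact (tame_minus _ _ (tame_plus _ _ (tame_scal (/ 2) _ TI) (tame_mult _ _ tame_first_arg TtI)) TtJ).
Qed.

Lemma tame_explog0 : tame (fun w u => explog0 (second_arg w u)).
Proof. exact (tame_pser_second coef_e exp_type_coef_e). Qed.

Lemma tame_explog1 : tame (fun w u => explog1 (second_arg w u)).
Proof. exact (tame_minus _ _ (tame_mult _ _ tame_second_arg tame_explog0) (tame_pser_second coef_eH exp_type_coef_eH)). Qed.

Lemma tame_explog2 : tame (fun w u => explog2 (second_arg w u)).
Proof.
assert (T := tame_second_arg).
exact (tame_plus _ _ (tame_minus _ _ (tame_mult _ _ (tame_mult _ _ T T) tame_explog0)
  (tame_mult _ _ (tame_scal 2 _ T) (tame_pser_second coef_eH exp_type_coef_eH))) (tame_pser_second coef_eHH exp_type_coef_eHH)).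
Qed.

(** The defects of the equations [q' = e^b q]. *)
Definition rho0 : C -> C := fun _ => 0.
Definition rho1 : C -> C := fun _ => 1.
Definition rho2 (g1 b : C) : C := 2 * (b + g1).

Lemma second_factor_0 : second_factor explog0 rho0.
Proof.
split; [| |exact tame_explog0 | exact (tame_const 0)].
- intros b; apply deriv_eq with (Cexp b * explog0 b); [unfold dfactor, rho0; ring | apply cder_explog0].
- exists (fun _ => 0); split; [intros b; apply deriv_const | exact (tame_const 0)].
Qed.

Lemma second_factor_1 g1 : second_factor (calE1 g1) rho1.
Proof.
split; [exact (cder_calE1 g1) | | exact (tame_plus _ _ (tame_scal g1 _ tame_explog0) tame_explog1) | exact (tame_const 1)].
exists (fun _ => 0); split; [intros b; apply deriv_const | exact (tame_const 0)].
Qed.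

Lemma second_factor_2 g1 g2 : second_factor (calE2 g1 g2) (rho2 g1).
Proof.
split; [exact (cder_calE2 g1 g2) | | |].
- exists (fun _ => 2); split; [|exact (tame_const 2)].
  intros b; apply deriv_eq with (2 * (1 + 0)); [ring|]. apply deriv_scal, deriv_plus; [apply cder_id | apply deriv_const].
- exact (tame_plus _ _ (tame_plus _ _ (tame_scal g2 _ tame_explog0) (tame_scal (2 * g1) _ tame_explog1)) tame_explog2).
- exact (tame_scal 2 _ (tame_plus _ _ tame_second_arg (tame_const g1))).
Qed.

(** * Four solutions *)

Lemma hankel_zero H : hankel H (fun _ => 0) = 0.
Proof.
transitivity (hankel H (fun u => 0 * (fun _ => 1) u)); [apply hankel_ext; intros; ring|].
rewrite hankel_scal; [ring | exact (tame_admissible _ 0 (tame_const 1))].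
Qed.

Lemma x_pser_tame c : min_type c -> tame (fun w u => Cexp u * pser c (Cexp (w + u))).
Proof. intros Hc. exact (tame_mult _ _ tame_expu (tame_I c Hc)). Qed.

Lemma hankel_x_pser_lin H (a b : C) c d w : min_type c -> min_type d ->
  hankel H (fun u => a * (Cexp u * pser c (Cexp (w + u))) + b * (Cexp u * pser d (Cexp (w + u)))) = 0.
Proof.
intros Hc Hd. rewrite (hankel_tame_lin H a b _ _ w (x_pser_tame c Hc) (x_pser_tame d Hd)), !hankel_x_pser by auto. ring.
Qed.

Lemma factors_sys H p p1 q rho : first_factor p p1 -> second_factor q rho ->
  (forall w, hankel H (fun u => Cexp u * factors p rho w u) = 0) ->
  (forall w, hankel H (fun u => Cexp u * factors p1 rho w u) = 0) ->
  system (fun w => hankel H (factors p q w)) (fun w => hankel H (factors p1 q w))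
    (fun w => hankel H (factors p (dfactor q rho) w)) (fun w => hankel H (factors p1 (dfactor q rho) w)).
Proof. intros P Q. exact (hankel_family_sys H _ _ _ _ _ _ (hankel_family_factors _ _ _ _ P Q)). Qed.

Lemma system_10 H : system (fun w => hankel H (factors ups1 explog0 w)) (fun w => hankel H (factors ups1_theta explog0 w))
  (fun w => hankel H (factors ups1 (dfactor explog0 rho0) w)) (fun w => hankel H (factors ups1_theta (dfactor explog0 rho0) w)).
Proof.
apply (factors_sys H _ _ _ _ first_factor_1 second_factor_0);
  intros w; rewrite <- (hankel_zero H); apply hankel_ext; intros u; unfold factors, rho0; ring.
Qed.

Lemma system_20 H : system (fun w => hankel H (factors ups2 explog0 w)) (fun w => hankel H (factors ups2' explog0 w))
  (fun w => hankel H (factors ups2 (dfactor explog0 rho0) w)) (fun w => hankel H (factors ups2' (dfactor explog0 rho0) w)).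
Proof.
apply (factors_sys H _ _ _ _ first_factor_2 second_factor_0);
  intros w; rewrite <- (hankel_zero H); apply hankel_ext; intros u; unfold factors, rho0; ring.
Qed.

Lemma system_11 H g1 : system (fun w => hankel H (factors ups1 (calE1 g1) w)) (fun w => hankel H (factors ups1_theta (calE1 g1) w))
  (fun w => hankel H (factors ups1 (dfactor (calE1 g1) rho1) w)) (fun w => hankel H (factors ups1_theta (dfactor (calE1 g1) rho1) w)).
Proof.
apply (factors_sys H _ _ _ _ first_factor_1 (second_factor_1 g1)); intros w.
- rewrite <- (hankel_x_pser H coef_I w min_type_coef_I). apply hankel_ext; intros u; unfold factors, rho1, ups1; rewrite exp_first_arg; ring.
- rewrite <- (hankel_x_pser H (theta coef_I) w (min_type_theta _ min_type_coef_I)). apply hankel_ext; intros u; unfold factors, rho1, ups1_theta; rewrite exp_first_arg; ring.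
Qed.

(** The integrand of the fourth function, and its images under [theta1],
    [theta2] and [theta1 theta2]. *)
Definition sol4 g1 g2 w u := 4 * factors ups2 (calE1 g1) w u + 1 * factors ups1 (calE2 g1 g2) w u.
Definition sol4_1 g1 g2 w u := 4 * factors ups2' (calE1 g1) w u + 1 * factors ups1_theta (calE2 g1 g2) w u.
Definition sol4_2 g1 g2 w u := 4 * factors ups2 (dfactor (calE1 g1) rho1) w u + 1 * factors ups1 (dfactor (calE2 g1 g2) (rho2 g1)) w u.
Definition sol4_12 g1 g2 w u := 4 * factors ups2' (dfactor (calE1 g1) rho1) w u + 1 * factors ups1_theta (dfactor (calE2 g1 g2) (rho2 g1)) w u.

Lemma hankel_family_4 g1 g2 : hankel_family (sol4 g1 g2) (sol4_1 g1 g2) (sol4_2 g1 g2) (sol4_12 g1 g2)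
  (fun w u => 4 * (Cexp u * factors ups2 rho1 w u) + 1 * (Cexp u * factors ups1 (rho2 g1) w u))
  (fun w u => 4 * (Cexp u * factors ups2' rho1 w u) + 1 * (Cexp u * factors ups1_theta (rho2 g1) w u)).
Proof.
exact (hankel_family_lin 4 1 _ _ _ _ _ _ _ _ _ _ _ _ (hankel_family_factors _ _ _ _ first_factor_2 (second_factor_1 g1))
  (hankel_family_factors _ _ _ _ first_factor_1 (second_factor_2 g1 g2))).
Qed.

(** Neither of the two terms satisfies [system].  The remainder is [x] times
    [4 ups2 a + 2 (b + g1) ups1 a], where [a = (w + u) / 2] and [b = 2 w - u]; the
    coefficient 4 is the one for which [u = log x] cancels in [4 a + 2 b = 6 w].
    What is left is entire in [x]. *)
Lemma system_4 H g1 g2 : system (fun w => hankel H (sol4 g1 g2 w)) (fun w => hankel H (sol4_1 g1 g2 w))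
  (fun w => hankel H (sol4_2 g1 g2 w)) (fun w => hankel H (sol4_12 g1 g2 w)).
Proof.
assert (FI := min_type_coef_I). assert (FJ := min_type_coef_IH). assert (FtI := min_type_theta _ FI). assert (FtJ := min_type_theta _ FJ).
apply (hankel_family_sys H _ _ _ _ _ _ (hankel_family_4 g1 g2)); intros w.
- rewrite <- (hankel_x_pser_lin H (6 * w + 2 * g1) (- (4)) coef_I coef_IH w FI FJ). apply hankel_ext; intros u.
  unfold factors, rho1, rho2, ups2, ups1, ups2_tail. rewrite exp_first_arg. unfold first_arg, second_arg. field.
- transitivity (hankel H (fun u => 1 * (2 * (Cexp u * pser coef_I (Cexp (w + u))) + 0 * (Cexp u * pser coef_I (Cexp (w + u))))
    + 1 * ((6 * w + 2 * g1) * (Cexp u * pser (theta coef_I) (Cexp (w + u))) + - (4) * (Cexp u * pser (theta coef_IH) (Cexp (w + u)))))).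
  + apply hankel_ext; intros u. unfold factors, rho1, rho2, ups2', ups1, ups1_theta, ups2_tail_theta. rewrite exp_first_arg.
    unfold first_arg, second_arg. field.
  + assert (T := fun a b c d (Hc : min_type c) (Hd : min_type d) => tame_lin a b _ _ (x_pser_tame c Hc) (x_pser_tame d Hd)).
    rewrite (hankel_tame_lin H 1 1 _ _ w (T 2 0 coef_I coef_I FI FI) (T (6 * w + 2 * g1) (- (4)) _ _ FtI FtJ)).
    rewrite !hankel_x_pser_lin by auto. ring.
Qed.

(** * Linear independence *)

(** The leading term as [z] tends to 0, with a remainder that is [z] times an
    integrand of the same class, of which the Hankel integral grows more slowly
    than any negative power of [|z|]. *)
Definition leading (g : C -> C -> C) (c : C) : Prop :=
  exists t, tame t /\ forall w u, g w u = c + Cexp w * t w u.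

Lemma leading_plus g h c d : leading g c -> leading h d -> leading (fun w u => g w u + h w u) (c + d).
Proof.
intros [t [T E]] [s [S F]]. exists (fun w u => t w u + s w u); split; [apply tame_plus; auto|].
intros; rewrite E, F; ring.
Qed.

Lemma leading_scal a g c : leading g c -> leading (fun w u => a * g w u) (a * c).
Proof.
intros [t [T E]]. exists (fun w u => a * t w u); split; [apply tame_scal; auto|].
intros; rewrite E; ring.
Qed.

Lemma leading_0_mult g h : leading g 0 -> tame h -> leading (fun w u => g w u * h w u) 0.
Proof.
intros [t [T E]] Hh. exists (fun w u => t w u * h w u); split; [apply tame_mult; auto|].
intros; rewrite E; ring.
Qed.

Lemma leading_tame g c : leading g c -> tame g.
Proof.
intros [t [T E]]. apply tame_ext with (fun w u => c + Cexp w * t w u); [intros; rewrite E; reflexivity|].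
apply (tame_plus (fun _ _ => c)); [constructor|]. apply (tame_mult (fun w _ => Cexp w)); [constructor | exact T].
Qed.

Lemma leading_mult g h c d : leading g c -> leading h d -> leading (fun w u => g w u * h w u) (c * d).
Proof.
intros Hg Hh. assert (Th := leading_tame _ _ Hh). destruct Hg as [t [T E]]. destruct Hh as [s [S F]].
exists (fun w u => c * s w u + t w u * h w u); split.
- apply tame_plus; [apply tame_scal, S | apply tame_mult; auto].
- intros. rewrite E, F. ring.
Qed.

Lemma leading_eq g c d : c = d -> leading g c -> leading g d.
Proof. intros ->; auto. Qed.

Lemma leading_pser_first c : min_type c -> leading (fun w u => pser c (Cexp (2 * first_arg w u))) (RtoC (c O)).
Proof.
intros Hc. exists (fun w u => Cexp u * pser (unshift c) (Cexp (w + u))); split.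
- apply (tame_mult (fun _ u => Cexp u)); constructor. apply min_type_unshift, Hc.
- intros w u. rewrite exp_first_arg, pser_unshift by (apply min_type_exp_type, Hc). rewrite (Cexp_plus w u) at 1. ring.
Qed.

Lemma leading_ups1 : leading (fun w u => ups1 (first_arg w u)) 1.
Proof. apply leading_eq with (RtoC (coef_I 0)); [unfold coef_I; simpl; f_equal; field | exact (leading_pser_first coef_I min_type_coef_I)]. Qed.
Lemma leading_ups1_theta : leading (fun w u => ups1_theta (first_arg w u)) 0.
Proof. apply leading_eq with (RtoC (theta coef_I 0)); [unfold theta; simpl; f_equal; ring | exact (leading_pser_first (theta coef_I) (min_type_theta _ min_type_coef_I))]. Qed.
Lemma leading_ups2_tail_theta : leading (fun w u => ups2_tail_theta (first_arg w u)) 0.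
Proof. apply leading_eq with (RtoC (theta coef_IH 0)); [unfold theta; simpl; f_equal; ring | exact (leading_pser_first (theta coef_IH) (min_type_theta _ min_type_coef_IH))]. Qed.

Lemma leading_ups2' : leading (fun w u => ups2' (first_arg w u)) (/ 2).
Proof.
apply leading_eq with (/ 2 * 1 + 0 + - (1) * 0); [ring|].
destruct (leading_plus _ _ _ _ (leading_plus _ _ _ _ (leading_scal (/ 2) _ _ leading_ups1) (leading_0_mult _ _ leading_ups1_theta tame_first_arg)) (leading_scal (- (1)) _ _ leading_ups2_tail_theta)) as [t [T E]].
exists t; split; [exact T|]. intros w u. rewrite <- E. unfold ups2'. ring.
Qed.

Lemma leading_y : leading (fun w u => Cexp (second_arg w u)) 0.
Proof.
exists (fun w u => Cexp w * Cexp (- u)); split; [apply (tame_mult (fun w _ => Cexp w)); constructor|].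
intros w u. rewrite <- !Cexp_plus, Cplus_0_l. f_equal; unfold second_arg; ring.
Qed.

Lemma leading_explog0 : leading (fun w u => explog0 (second_arg w u)) 1.
Proof.
destruct (leading_0_mult _ _ leading_y (tame_pser_second _ (exp_type_unshift _ exp_type_coef_e))) as [t [T E]].
exists t; split; [exact T|]. intros w u. unfold explog0. rewrite pser_unshift by apply exp_type_coef_e. rewrite E.
replace (coef_e O) with 1%R by (unfold coef_e; simpl; field). ring.
Qed.

Lemma leading_dfactor q rho c : tame (fun w u => q (second_arg w u)) -> leading (fun w u => rho (second_arg w u)) c ->
  leading (fun w u => dfactor q rho (second_arg w u)) c.
Proof.
intros Tq Hr. apply leading_eq with (0 + c); [ring|].
exact (leading_plus _ _ _ _ (leading_0_mult _ _ leading_y Tq) Hr).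
Qed.

Lemma leading_const c : leading (fun _ _ => c) c.
Proof. exists (fun _ _ => 0); split; [constructor | intros; ring]. Qed.

Lemma two_i_pi_neq0 : 2 * PI * Ci <> 0.
Proof.
intros E. assert (A := f_equal Im E). unfold Im in A; simpl in A. assert (P := PI_RGT_0). lra.
Qed.

(** The integral equals [2 i PI c + O(|z|^(1/2))] along the negative real axis in
    [w = log z]. *)
Lemma leading_zero H g c : leading g c -> (forall r : R, (r <= -5)%R -> hankel H (g (RtoC r)) = 0) -> c = 0.
Proof.
intros [t [T E]] Hz. destruct (Ceq_dec c 0) as [Z|Z]; [exact Z | exfalso].
set (d := Cmod (2 * PI * Ci * c)).
assert (Hd : (0 < d)%R) by (apply Cmod_gt_0, Cmult_neq_0; [apply two_i_pi_neq0 | exact Z]).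
destruct (tame_bound t T PI (1/2)%R (1/2)%R) as [A [HA B]]; [lra | lra |].
assert (HN := hankel_norm_pos).
set (K := (hankel_norm * A)%R). assert (HK : (0 <= K)%R) by (apply Rmult_le_pos; lra).
assert (main : forall r, (r <= -5)%R -> (d <= K * exp (r / 2))%R).
{ intros r Hr. specialize (Hz r Hr).
  assert (Nt := tame_admissible t (RtoC r) T).
  assert (X : hankel H (g (RtoC r)) = 2 * PI * Ci * c + Cexp r * hankel H (t (RtoC r))).
  { transitivity (hankel H (fun u => c * (fun _ => 1) u + Cexp r * t (RtoC r) u)); [apply hankel_ext; intros; rewrite E; ring|].
    rewrite (hankel_lin H c _ (fun _ => 1) (t (RtoC r)) (tame_admissible _ r (tame_const 1)) Nt), hankel_one. ring. }
  rewrite Hz in X.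
  assert (Y : 2 * PI * Ci * c = - (Cexp r * hankel H (t (RtoC r)))).
  { transitivity (2 * PI * Ci * c + Cexp r * hankel H (t (RtoC r)) - Cexp r * hankel H (t (RtoC r))); [ring | rewrite <- X; ring]. }
  unfold d. rewrite Y, Cmod_opp, Cmod_mult, Cmod_Cexp. change (Re r) with r.
  assert (W : (Cmod (hankel H (t (RtoC r))) <= hankel_norm * (A * exp (- (r / 2))))%R).
  { apply hankel_bound; [exact Nt | apply Rmult_le_pos; [auto | left; apply exp_pos] |].
    intros u H1 H2. rewrite Rmult_assoc. assert (P := PI_RGT_0).
    eapply Rle_trans; [apply B|].
    - change (r <= PI)%R; lra.
    - change (Rabs 0 <= PI)%R; rewrite Rabs_R0; lra.
    - lra.
    - exact H2.
    - rewrite Cmod_R, Rabs_left by lra. replace (1 / 2 * - r)%R with (- (r / 2))%R by field. lra. }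
  apply Rle_trans with (exp r * (hankel_norm * (A * exp (- (r / 2)))))%R.
  - apply Rmult_le_compat_l; [left; apply exp_pos | exact W].
  - replace (exp r) with (exp (r / 2) * exp (r / 2))%R by (rewrite <- exp_plus; f_equal; field).
    rewrite exp_Ropp. right. unfold K. field. apply Rgt_not_eq, exp_pos. }
set (r := Rmin (-5) (- (2 * (K / d)))%R).
assert (R1 := Rmin_l _ _ : (r <= -5)%R). assert (R2 := Rmin_r _ _ : (r <= - (2 * (K / d)))%R).
specialize (main r R1).
assert (V := exp_ge_1x (- (r / 2))). rewrite exp_Ropp in V. assert (Q := exp_pos (r / 2)).
assert (V2 : ((1 + K / d) * exp (r / 2) <= 1)%R).
{ apply Rle_trans with (/ exp (r / 2) * exp (r / 2))%R; [apply Rmult_le_compat_r; lra | rewrite Rinv_l; lra]. }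
assert (V3 : (d * ((1 + K / d) * exp (r / 2)) <= d * 1)%R) by (apply Rmult_le_compat_l; lra).
replace (d * ((1 + K / d) * exp (r / 2)))%R with (d * exp (r / 2) + K * exp (r / 2))%R in V3 by (field; lra).
assert (0 < d * exp (r / 2))%R by (apply Rmult_lt_0_compat; auto). lra.
Qed.

Lemma leading_combination H c1 c2 c3 c4 f1 f2 f3 f4 l1 l2 l3 l4 :
  leading f1 l1 -> leading f2 l2 -> leading f3 l3 -> leading f4 l4 ->
  (forall r : R, (r <= -5)%R ->
     c1 * hankel H (f1 r) + c2 * hankel H (f2 r) + (c3 * hankel H (f3 r) + c4 * hankel H (f4 r)) = 0) ->
  c1 * l1 + c2 * l2 + (c3 * l3 + c4 * l4) = 0.
Proof.
intros L1 L2 L3 L4 Hz.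
apply (leading_zero H (fun w u => (c1 * f1 w u + c2 * f2 w u) + (c3 * f3 w u + c4 * f4 w u))).
- repeat apply leading_plus; apply leading_scal; assumption.
- intros r Hr. rewrite <- (Hz r Hr).
  assert (N1 := tame_admissible _ r (leading_tame _ _ L1)). assert (N2 := tame_admissible _ r (leading_tame _ _ L2)).
  assert (N3 := tame_admissible _ r (leading_tame _ _ L3)). assert (N4 := tame_admissible _ r (leading_tame _ _ L4)).
  rewrite (hankel_plus H (fun u => c1 * f1 r u + c2 * f2 r u)), !hankel_lin by auto using admissible_lin. reflexivity.
Qed.

(** * The solution space has dimension at most four *)

Definition ode_coef (k : nat) (z : C) : C :=
  match k with
  | 0 => z ^ 2 * (- (3113) * z ^ 3 - 9924 * z ^ 2 + 1476 * z + 192)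
  | 1 => - (4 * z ^ 2 * (2547 * z ^ 2 + 350 * z - 104))
  | 2 => z * (- (2264) * z ^ 2 + 192 * z + 3)
  | _ => 283 * z ^ 2 - 590 * z + 24
  end.

(** A solution of the scalar equation with its derivatives. *)
Definition tower (T : nat -> C -> C) : Prop :=
  (forall k w, (k < 4)%nat -> cder (T k) w (T (S k) w)) /\
  (forall w, let z := Cexp w in
    (283 * z - 24) * T 4%nat w + ode_coef 3 z * T 3%nat w + ode_coef 2 z * T 2%nat w
    + ode_coef 1 z * T 1%nat w + ode_coef 0 z * T 0%nat w = 0).

Lemma tower_lin a b T S' : tower T -> tower S' -> tower (fun k w => a * T k w + b * S' k w).
Proof.
intros [D E] [D' E']; split.
- intros k w Hk. apply deriv_plus; apply deriv_scal; auto.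
- intros w z. specialize (E w); specialize (E' w). cbv zeta in E, E'. fold z in E, E'.
  transitivity (a * ((283 * z - 24) * T 4%nat w + ode_coef 3 z * T 3%nat w + ode_coef 2 z * T 2%nat w
    + ode_coef 1 z * T 1%nat w + ode_coef 0 z * T 0%nat w) + b * ((283 * z - 24) * S' 4%nat w + ode_coef 3 z * S' 3%nat w + ode_coef 2 z * S' 2%nat w
    + ode_coef 1 z * S' 1%nat w + ode_coef 0 z * S' 0%nat w)); [ring | rewrite E, E'; ring].
Qed.

Lemma is_derive_sq x t l : is_derive x t l -> is_derive (fun s => x s ^ 2)%R t (2 * x t * l)%R.
Proof.
intros H. apply (is_derive_ext (fun s => x s * x s)%R); [intros; simpl; ring|].
replace (2 * x t * l)%R with (l * x t + x t * l)%R by ring.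
apply (is_derive_mult (K := R_AbsRing) x x t l l H H). intros; apply Rmult_comm.
Qed.

Lemma gronwall_zero (E dE : R -> R) K : (forall t, (0 <= t <= 1)%R -> is_derive E t (dE t)) ->
  (forall t, (0 <= t <= 1)%R -> (dE t <= K * E t)%R) -> E 0%R = 0%R -> (E 1%R <= 0)%R.
Proof.
intros HD HK H0.
assert (M := mono_le (fun t => - (E t * exp (- K * t)))%R (fun t => (K * E t - dE t) * exp (- K * t))%R 0 1 Rle_0_1).
assert (M' : (- (E 0 * exp (- K * 0)) <= - (E 1 * exp (- K * 1)))%R).
{ apply M.
  - intros t Ht.
    replace ((K * E t - dE t) * exp (- K * t))%R with (opp (dE t * exp (- K * t) + E t * (- K * exp (- K * t))))%R
      by (unfold opp; simpl; ring).
    apply (is_derive_opp (V := R_NormedModule)).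
    apply (is_derive_mult (K := R_AbsRing) E (fun t => exp (- K * t))%R); [auto | | intros; apply Rmult_comm].
    auto_derive; [exact I | ring].
  - intros t Ht. specialize (HK t Ht). assert (P := exp_pos (- K * t)). apply Rmult_le_pos; lra. }
rewrite H0 in M'. assert (P := exp_pos (- K * 1)). nra.
Qed.

Lemma rder_Cmod_bounded (f f' : R -> C) : (forall t, (0 <= t <= 1)%R -> rder f t (f' t)) ->
  exists M, forall t, (0 <= t <= 1)%R -> (Cmod (f t) <= M)%R.
Proof.
intros H.
set (sq := fun t => (Re (f t) ^ 2 + Im (f t) ^ 2)%R).
destruct (continuity_ab_maj sq 0 1 Rle_0_1) as [Mx [HM _]].
- intros t Ht. apply continuity_pt_filterlim, (ex_derive_continuous (V := R_NormedModule)).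
  eexists. apply (is_derive_plus (V := R_NormedModule)); apply is_derive_sq; [apply rder_Re | apply rder_Im]; apply H, Ht.
- exists (1 + sq Mx)%R. intros t Ht. specialize (HM t Ht). unfold sq in HM at 1. rewrite <- Cmod2_alt in HM.
  assert (P := Cmod_ge_0 (f t)). nra.
Qed.

(** The derivative of the energy of a solution along a segment of length [L], where
    [x0, ..., x4] are the moduli of the solution and its derivatives. *)
Lemma energy_bound (x0 x1 x2 x3 x4 L M : R) : (0 <= x0)%R -> (0 <= x1)%R -> (0 <= x2)%R -> (0 <= x3)%R -> (0 <= x4)%R ->
  (0 <= L)%R -> (0 <= M)%R ->
  (x4 <= M * (x0 + x1 + x2 + x3))%R ->
  (2 * (x0 * (x1 * L)) + 2 * (x1 * (x2 * L)) + 2 * (x2 * (x3 * L)) + 2 * (x3 * (x4 * L))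
   <= (L * (2 + 5 * M)) * (x0 ^ 2 + x1 ^ 2 + x2 ^ 2 + x3 ^ 2))%R.
Proof.
intros H0 H1 H2 H3 H4 HL HM H.
assert (A : (2 * (x0 * x1) + 2 * (x1 * x2) + 2 * (x2 * x3) <= 2 * (x0 ^ 2 + x1 ^ 2 + x2 ^ 2 + x3 ^ 2))%R).
{ assert (Q1 := pow2_ge_0 (x0 - x1)). assert (Q2 := pow2_ge_0 (x1 - x2)). assert (Q3 := pow2_ge_0 (x2 - x3)). 
  assert (0 <= x0 ^ 2)%R by apply pow2_ge_0. assert (0 <= x3 ^ 2)%R by apply pow2_ge_0. nra. }
assert (B : (2 * (x3 * (x0 + x1 + x2 + x3)) <= 5 * (x0 ^ 2 + x1 ^ 2 + x2 ^ 2 + x3 ^ 2))%R).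
{ assert (Q1 := pow2_ge_0 (x0 - x3)). assert (Q2 := pow2_ge_0 (x1 - x3)). assert (Q3 := pow2_ge_0 (x2 - x3)).
  assert (0 <= x0 ^ 2)%R by apply pow2_ge_0. assert (0 <= x1 ^ 2)%R by apply pow2_ge_0. assert (0 <= x2 ^ 2)%R by apply pow2_ge_0. nra. }
assert (D : (2 * (x3 * x4) <= M * (2 * (x3 * (x0 + x1 + x2 + x3))))%R).
{ assert (x3 * x4 <= x3 * (M * (x0 + x1 + x2 + x3)))%R by (apply Rmult_le_compat_l; auto). lra. }
set (S := (x0 ^ 2 + x1 ^ 2 + x2 ^ 2 + x3 ^ 2)%R) in *.
assert (D2 : (M * (2 * (x3 * (x0 + x1 + x2 + x3))) <= M * (5 * S))%R) by (apply Rmult_le_compat_l; auto).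
assert (F : (L * (2 * (x0 * x1) + 2 * (x1 * x2) + 2 * (x2 * x3) + 2 * (x3 * x4)) <= L * (2 * S + M * (5 * S)))%R)
  by (apply Rmult_le_compat_l; lra).
lra.
Qed.

Lemma ode_quotient_derivable k : exists d, forall w, 283 * Cexp w - 24 <> 0 ->
  cder (fun w => ode_coef k (Cexp w) * / (283 * Cexp w - 24)) w (d w).
Proof.
assert (Y : exists p, forall z, cder (ode_coef k) z (p z)).
{ destruct k as [|[|[|k]]]; eexists; intros z; unfold ode_coef; deriv_rules. }
destruct Y as [p Hp]. eexists; intros w Hw.
apply (deriv_mult (fun w => ode_coef k (Cexp w)) (fun w => / (283 * Cexp w - 24))).
- apply (deriv_comp (ode_coef k) Cexp); [apply cder_Cexp | apply Hp].
- apply (cder_inv_comp (fun w => 283 * Cexp w - 24)); [exact Hw | deriv_rules].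
Qed.

(** Gronwall's inequality for the energy [sum of |T k|^2] over [k < 4], along a
    segment without singular points. *)
Lemma tower_segment T a b : tower T ->
  (forall t, (0 <= t <= 1)%R -> 283 * Cexp (seg a b t) - 24 <> 0) ->
  (forall k, (k < 4)%nat -> T k a = 0) -> T 0%nat b = 0.
Proof.
intros [D E] Hns H0.
set (v := seg a b). set (kap := fun k w => ode_coef k (Cexp w) * / (283 * Cexp w - 24)).
assert (Dv : forall t, rder v t (b - a)) by (intros t; apply rder_line).
assert (Bk : forall k, exists M, forall t, (0 <= t <= 1)%R -> (Cmod (kap k (v t)) <= M)%R).
{ intros k. destruct (ode_quotient_derivable k) as [dk Hdk].
  apply rder_Cmod_bounded with (fun t => dk (v t) * (b - a)). intros t Ht.
  apply (deriv_comp (kap k) v); [apply Dv | apply Hdk, Hns, Ht]. }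
destruct (Bk 0%nat) as [M0 B0]. destruct (Bk 1%nat) as [M1 B1]. destruct (Bk 2%nat) as [M2 B2]. destruct (Bk 3%nat) as [M3 B3].
set (M := (Rabs M0 + Rabs M1 + Rabs M2 + Rabs M3)%R).
assert (Q0 := Rabs_pos M0). assert (Q1 := Rabs_pos M1). assert (Q2 := Rabs_pos M2). assert (Q3 := Rabs_pos M3).
assert (R0 := Rle_abs M0). assert (R1 := Rle_abs M1). assert (R2 := Rle_abs M2). assert (R3 := Rle_abs M3).
set (x := fun k t => Cmod (T k (v t))).
assert (Px : forall k t, (0 <= x k t)%R) by (intros; apply Cmod_ge_0).
assert (B4 : forall t, (0 <= t <= 1)%R -> (x 4%nat t <= M * (x 0%nat t + x 1%nat t + x 2%nat t + x 3%nat t))%R).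
{ intros t Ht. specialize (E (v t)). cbv zeta in E. assert (N := Hns t Ht). fold v in N.
  assert (E4 : T 4%nat (v t) = - (kap 3%nat (v t) * T 3%nat (v t) + kap 2%nat (v t) * T 2%nat (v t) + kap 1%nat (v t) * T 1%nat (v t) + kap 0%nat (v t) * T 0%nat (v t))).
  { unfold kap. apply (f_equal (fun c => c * / (283 * Cexp (v t) - 24))) in E.
    transitivity (T 4%nat (v t) - 0 * / (283 * Cexp (v t) - 24)); [ring|]. rewrite <- E. field. exact N. }
  unfold x at 1. rewrite E4, Cmod_opp.
  eapply Rle_trans; [apply Cmod_triangle|]. rewrite Cmod_mult.
  eapply Rle_trans; [apply Rplus_le_compat_r; eapply Rle_trans; [apply Cmod_triangle|]; rewrite Cmod_mult; apply Rplus_le_compat_r, Cmod_triangle|].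
  rewrite !Cmod_mult. fold (x 0%nat t) (x 1%nat t) (x 2%nat t) (x 3%nat t).
  specialize (B0 t Ht); specialize (B1 t Ht); specialize (B2 t Ht); specialize (B3 t Ht).
  assert (W : forall k m, (Cmod (kap k (v t)) <= m)%R -> (m <= M)%R -> (Cmod (kap k (v t)) * x k t <= M * x k t)%R).
  { intros k m Hm HmM. apply Rmult_le_compat_r; [apply Px | lra]. }
  assert (W0 := W 0%nat M0 B0 ltac:(unfold M; lra)). assert (W1 := W 1%nat M1 B1 ltac:(unfold M; lra)).
  assert (W2 := W 2%nat M2 B2 ltac:(unfold M; lra)). assert (W3 := W 3%nat M3 B3 ltac:(unfold M; lra)). lra. }
set (L := Cmod (b - a)). assert (HL : (0 <= L)%R) by apply Cmod_ge_0.
set (e := fun k t => (Re (T k (v t)) ^ 2 + Im (T k (v t)) ^ 2)%R).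
set (de := fun k t => (2 * Re (T k (v t)) * Re (T (S k) (v t) * (b - a)) + 2 * Im (T k (v t)) * Im (T (S k) (v t) * (b - a)))%R).
assert (De : forall k t, (k < 4)%nat -> is_derive (e k) t (de k t)).
{ intros k t Hk. assert (R := deriv_comp (T k) v t _ _ (Dv t) (D k (v t) Hk)).
  apply (is_derive_plus (V := R_NormedModule)); apply is_derive_sq; [apply (rder_Re _ _ _ R) | apply (rder_Im _ _ _ R)]. }
assert (ex : forall k t, e k t = (x k t ^ 2)%R) by (intros k t; unfold e, x; rewrite Cmod2_alt; reflexivity).
assert (CS : forall c d : C, (Re c * Re d + Im c * Im d <= Cmod c * Cmod d)%R).
{ intros c d. assert (A := re_le_Cmod (c * Cconj d)). rewrite Cmod_mult, Cmod_conj in A.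
  replace (Re (c * Cconj d)) with (Re c * Re d + Im c * Im d)%R in A by (unfold Re, Im; simpl; ring).
  eapply Rle_trans; [apply Rle_abs | exact A]. }
assert (deb : forall k t, (de k t <= 2 * (x k t * (x (S k) t * L)))%R).
{ intros k t. unfold de, x, L. rewrite <- Cmod_mult. assert (A := CS (T k (v t)) (T (S k) (v t) * (b - a))). lra. }
assert (G := gronwall_zero (fun t => e 0%nat t + e 1%nat t + e 2%nat t + e 3%nat t)%R
  (fun t => de 0%nat t + de 1%nat t + de 2%nat t + de 3%nat t)%R (L * (2 + 5 * M))%R).
assert (Z : (e 0%nat 1 + e 1%nat 1 + e 2%nat 1 + e 3%nat 1 <= 0)%R).
{ apply G.
  - intros t Ht. apply (is_derive_plus (V := R_NormedModule)); [|apply De; lia].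
    apply (is_derive_plus (V := R_NormedModule)); [|apply De; lia].
    apply (is_derive_plus (V := R_NormedModule)); apply De; lia.
  - intros t Ht. rewrite !ex.
    assert (X := energy_bound (x 0%nat t) (x 1%nat t) (x 2%nat t) (x 3%nat t) (x 4%nat t) L M
      (Px _ _) (Px _ _) (Px _ _) (Px _ _) (Px _ _) HL ltac:(unfold M; lra) (B4 t Ht)).
    assert (Y0 := deb 0%nat t). assert (Y1 := deb 1%nat t). assert (Y2 := deb 2%nat t). assert (Y3 := deb 3%nat t). lra.
  - rewrite !ex. unfold x.
    replace (v 0%R) with a by (unfold v, seg; ring).
    rewrite !H0 by lia. rewrite Cmod_0. ring. }
rewrite !ex in Z. assert (P1 := pow2_ge_0 (x 0%nat 1%R)). assert (P2 := pow2_ge_0 (x 1%nat 1%R)).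
assert (P3 := pow2_ge_0 (x 2%nat 1%R)). assert (P4 := pow2_ge_0 (x 3%nat 1%R)).
assert (X0 : (x 0%nat 1 = 0)%R) by (assert (Y := Px 0%nat 1%R); nra).
unfold x in X0. replace (v 1%R) with b in X0 by (unfold v, seg; ring). apply Cmod_eq_0, X0.
Qed.

(** The singular points are those with [283 e^w = 24]; they lie on the vertical line
    [Re w = ln (24 / 283)].  The base point, where [283 e^w = - 24], is a regular
    point of this line, so that a segment from it to a point off the line avoids
    the singular points. *)
Definition base_pt : C := (ln (24 / 283), PI)%R.

(** The points of the singular line are reached by continuity. *)
Lemma tower_unique T : tower T -> (forall k, (k < 4)%nat -> T k base_pt = 0) -> forall w, T 0%nat w = 0.
Proof.
intros HT H0.
assert (off : forall w, Re w <> ln (24 / 283) -> T 0%nat w = 0).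
{ intros w Hw. apply (tower_segment T base_pt w HT); [|exact H0].
  intros t Ht Hz.
  assert (Ez : Cexp (seg base_pt w t) = RtoC (24 / 283)).
  { rewrite RtoC_div by lra. apply (f_equal (fun c => (c + 24) / 283)) in Hz.
    transitivity (((283 * Cexp (seg base_pt w t) - 24) + 24) / 283); [field; intros Z; apply (f_equal Re) in Z; simpl in Z; lra|].
    rewrite Hz. rewrite Cplus_0_l. reflexivity. }
  assert (Em := f_equal Cmod Ez). rewrite Cmod_Cexp, Cmod_R, Rabs_pos_eq in Em by lra.
  assert (Er : Re (seg base_pt w t) = ln (24 / 283)) by (rewrite <- Em, ln_exp; reflexivity).
  assert (Er' : Re (seg base_pt w t) = (ln (24 / 283) + t * (Re w - ln (24 / 283)))%R) by (unfold seg, Re, base_pt; simpl; ring).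
  assert (Et : t = 0%R).
  { rewrite Er in Er'. assert (Q : (t * (Re w - ln (24 / 283)) = 0)%R) by lra.
    apply Rmult_integral in Q. destruct Q as [Q|Q]; [exact Q | lra]. }
  subst t. replace (seg base_pt w 0) with base_pt in Ez by (unfold seg; ring).
  apply (f_equal Re) in Ez. unfold Cexp, base_pt, Re in Ez; simpl in Ez. rewrite exp_ln, cos_PI in Ez by lra. lra. }
intros w. destruct (Req_dec (Re w) (ln (24 / 283))) as [Hw|Hw]; [|apply off, Hw].
destruct HT as [D _]. destruct (deriv_lip _ _ _ (D 0%nat w ltac:(lia))) as [K [d [HK [Hd L]]]].
apply Cmod_eq_0. assert (P := Cmod_ge_0 (T 0%nat w)).
destruct (Req_dec (Cmod (T 0%nat w)) 0) as [Z|Z]; [exact Z | exfalso].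
set (h := Rmin (d / 2) (Cmod (T 0%nat w) / (2 * K))).
assert (Hh : (0 < h)%R) by (apply Rmin_pos; [lra | apply Rdiv_lt_0_compat; lra]).
assert (A1 := Rmin_l (d / 2) (Cmod (T 0%nat w) / (2 * K))). assert (A2 := Rmin_r (d / 2) (Cmod (T 0%nat w) / (2 * K))). fold h in A1, A2.
specialize (L (w + RtoC h)). replace (w + RtoC h - w) with (RtoC h) in L by ring.
rewrite Cmod_R, Rabs_pos_eq in L by lra. specialize (L ltac:(lra)).
rewrite (off (w + RtoC h)) in L by (replace (Re (w + RtoC h)) with (Re w + h)%R by (unfold Re; simpl; ring); lra).
replace (0 - T 0%nat w) with (- T 0%nat w) in L by ring. rewrite Cmod_opp in L.
assert (K * h <= K * (Cmod (T 0%nat w) / (2 * K)))%R by (apply Rmult_le_compat_l; lra).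
replace (K * (Cmod (T 0%nat w) / (2 * K)))%R with (Cmod (T 0%nat w) / 2)%R in H by (field; lra). lra.
Qed.

Definition skip (p j : nat) : nat := if Nat.ltb j p then j else S j.

Lemma psum_ext f g n : (forall j, (j < n)%nat -> f j = g j) -> psum f n = psum g n.
Proof. intros H; induction n as [|n IH]; simpl; [reflexivity | rewrite IH, H by auto; reflexivity]. Qed.

Lemma psum_skip f n p : (p <= n)%nat -> psum f (S n) = f p + psum (fun j => f (skip p j)) n.
Proof.
induction n as [|n IH]; intros Hp.
- replace p with 0%nat by lia. simpl. ring.
- destruct (Nat.eq_dec p (S n)) as [->|N].
  + change (psum f (S (S n))) with (psum f (S n) + f (S n)). rewrite Cplus_comm. f_equal.
    apply psum_ext. intros j Hj. unfold skip. replace (Nat.ltb j (S n)) with true; [reflexivity|].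
    symmetry; apply Nat.ltb_lt, Hj.
  + change (psum f (S (S n))) with (psum f (S n) + f (S n)). rewrite IH by lia. simpl.
    replace (skip p n) with (S n); [ring|]. unfold skip. replace (Nat.ltb n p) with false; [reflexivity|].
    symmetry; apply Nat.ltb_ge; lia.
Qed.

Lemma psum_lin a b f g n : psum (fun j => a * f j + b * g j) n = a * psum f n + b * psum g n.
Proof. induction n as [|n IH]; simpl; [ring | rewrite IH; ring]. Qed.

(** Gaussian elimination, by induction on the number of equations: an unknown [p]
    with nonzero coefficient in the last equation is eliminated, and [skip p]
    enumerates the other ones. *)
Lemma homogeneous_system n : forall A : nat -> nat -> C, exists x : nat -> C,
  (exists j, (j <= n)%nat /\ x j <> 0) /\ forall i, (i < n)%nat -> psum (fun j => A i j * x j) (S n) = 0.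
Proof.
induction n as [|n IH]; intros A.
- exists (fun _ => 1); split; [exists 0%nat; split; [lia|] | intros; lia].
  intros Z; apply (f_equal Re) in Z; simpl in Z; lra.
- destruct (classic (exists p, (p <= S n)%nat /\ A n p <> 0)) as [[p [Hp Ha]] | Hno].
  + destruct (IH (fun i j => A i (skip p j) + - (A i p / A n p) * A n (skip p j))) as [x [[j0 [Hj0 Hx0]] Hx]].
    set (s := psum (fun j => A n (skip p j) * x j) (S n)).
    set (y := fun j => if Nat.eqb j p then - s / A n p else if Nat.ltb j p then x j else x (pred j)).
    assert (Yp : y p = - s / A n p) by (unfold y; rewrite Nat.eqb_refl; reflexivity).
    assert (Ys : forall j, y (skip p j) = x j).
    { intros j. unfold y, skip. destruct (Nat.ltb j p) eqn:E.
      - assert (E' := E); apply Nat.ltb_lt in E'. replace (Nat.eqb j p) with false by (symmetry; apply Nat.eqb_neq; lia). rewrite E. reflexivity.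
      - apply Nat.ltb_ge in E. replace (Nat.eqb (S j) p) with false by (symmetry; apply Nat.eqb_neq; lia).
        replace (Nat.ltb (S j) p) with false by (symmetry; apply Nat.ltb_ge; lia). reflexivity. }
    assert (Sum : forall i, psum (fun j => A i j * y j) (S (S n)) = A i p * (- s / A n p) + psum (fun j => A i (skip p j) * x j) (S n)).
    { intros i. rewrite (psum_skip _ (S n) p Hp), Yp. f_equal. apply psum_ext. intros j _. rewrite Ys. reflexivity. }
    exists y; split.
    * exists (skip p j0); split; [unfold skip; destruct (Nat.ltb j0 p); lia | rewrite Ys; exact Hx0].
    * intros i Hi. rewrite Sum. destruct (Nat.eq_dec i n) as [->|N].
      -- fold s. field; exact Ha.
      -- specialize (Hx i ltac:(lia)).
         rewrite (psum_ext _ (fun j => 1 * (A i (skip p j) * x j) + - (A i p / A n p) * (A n (skip p j) * x j))) in Hx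
           by (intros; ring).
         rewrite psum_lin in Hx. fold s in Hx. rewrite <- Hx. field; exact Ha.
  + destruct (IH A) as [x [[j0 [Hj0 Hx0]] Hx]].
    set (y := fun j => if Nat.leb j n then x j else 0).
    exists y; split.
    * exists j0; split; [lia|]. unfold y. replace (Nat.leb j0 n) with true by (symmetry; apply Nat.leb_le; lia). exact Hx0.
    * intros i Hi. change (psum (fun j => A i j * y j) (S n) + A i (S n) * y (S n) = 0).
      replace (y (S n)) with (RtoC 0) by (unfold y; replace (Nat.leb (S n) n) with false by (symmetry; apply Nat.leb_gt; lia); reflexivity).
      destruct (Nat.eq_dec i n) as [->|N].
      -- rewrite (psum_ext _ (fun _ => 0 * 0 + 0 * 0)).
         ++ rewrite (psum_lin 0 0 (fun _ => 0) (fun _ => 0)). ring.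
         ++ intros j Hj. destruct (Ceq_dec (A n j) 0) as [Z|Z]; [rewrite Z; ring|].
            exfalso; apply Hno; exists j; split; [lia | exact Z].
      -- rewrite (psum_ext _ (fun j => A i j * x j)); [rewrite Hx by lia; ring|].
         intros j Hj. unfold y. replace (Nat.leb j n) with true by (symmetry; apply Nat.leb_le; lia). reflexivity.
Qed.

Lemma theta_power_tower F F1 F2 F12 : system F F1 F2 F12 -> tower (theta_power F F1 F2 F12).
Proof.
intros HS; split; [intros; apply theta_power_derive; auto|]. intros w z. unfold z.
rewrite <- (theta_power_ode F F1 F2 F12 w). cbv zeta. unfold ode_coef. ring.
Qed.

Lemma master_tower Phi : master_space_P Phi -> exists T, (forall w, T 0%nat w = Phi w) /\ tower T.
Proof.
intros [_ [T [H0 [HD HE]]]]. exists T; split; [exact H0|split].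
- intros k w Hk. apply cder_is_derive, HD, Hk.
- intros w z. rewrite <- (HE w). cbv zeta. fold z. unfold ode_coef. ring.
Qed.

(** Four linear conditions at the base point, for five unknown coefficients, have a
    nontrivial solution; by uniqueness it is a linear relation between the five
    functions. *)
Lemma spanning (T1 T2 T3 T4 : nat -> C -> C) : tower T1 -> tower T2 -> tower T3 -> tower T4 ->
  (forall c1 c2 c3 c4, (forall w, c1 * T1 0%nat w + c2 * T2 0%nat w + c3 * T3 0%nat w + c4 * T4 0%nat w = 0) ->
     c1 = 0 /\ c2 = 0 /\ c3 = 0 /\ c4 = 0) ->
  forall T, tower T -> exists c1 c2 c3 c4, forall w,
    T 0%nat w = c1 * T1 0%nat w + c2 * T2 0%nat w + c3 * T3 0%nat w + c4 * T4 0%nat w.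
Proof.
intros H1 H2 H3 H4 Hind T HT.
destruct (homogeneous_system 4 (fun k j => match j with 0 => T1 k base_pt | 1 => T2 k base_pt | 2 => T3 k base_pt
  | 3 => T4 k base_pt | _ => T k base_pt end)) as [x [[j0 [Hj0 Hx0]] Hx]].
set (c1 := x 0%nat) in *. set (c2 := x 1%nat) in *. set (c3 := x 2%nat) in *. set (c4 := x 3%nat) in *. set (c := x 4%nat) in *.
assert (TW := tower_lin 1 c _ _ (tower_lin 1 c4 _ _ (tower_lin 1 c3 _ _ (tower_lin c1 c2 _ _ H1 H2) H3) H4) HT).
assert (Z := tower_unique _ TW). cbv beta in Z.
assert (Z' : forall w, c1 * T1 0%nat w + c2 * T2 0%nat w + c3 * T3 0%nat w + c4 * T4 0%nat w + c * T 0%nat w = 0).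
{ intros w. rewrite <- Z with (w := w); [ring|].
  intros k Hk. rewrite <- (Hx k Hk). simpl. fold c1 c2 c3 c4 c. ring. }
destruct (Ceq_dec c 0) as [Ec | Ec].
- exfalso. destruct (Hind c1 c2 c3 c4) as [E1 [E2 [E3 E4]]].
  { intros w. rewrite <- (Z' w), Ec. ring. }
  destruct j0 as [|[|[|[|[|j0]]]]]; try lia; apply Hx0; assumption.
- exists (- c1 / c), (- c2 / c), (- c3 / c), (- c4 / c). intros w.
  transitivity ((c1 * T1 0%nat w + c2 * T2 0%nat w + c3 * T3 0%nat w + c4 * T4 0%nat w + c * T 0%nat w) / c
    + - c1 / c * T1 0%nat w + - c2 / c * T2 0%nat w + - c3 / c * T3 0%nat w + - c4 / c * T4 0%nat w); [field; exact Ec|].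
  rewrite Z'. field; exact Ec.
Qed.

(** * The reciprocal of the Gamma function *)

Definition clim (u : nat -> C) (l : C) : Prop := forall eps, (0 < eps)%R -> exists N, forall n, (N <= n)%nat -> (Cmod (u n - l) < eps)%R.

Lemma clim_CLim u l : clim u l -> CLim_seq u = l.
Proof.
intros H. unfold CLim_seq.
assert (K : forall p : C -> R, (forall c, (Rabs (p c) <= Cmod c)%R) -> (forall c d, p (c - d) = (p c - p d)%R) -> Lim_seq (fun n => p (u n)) = Finite (p l)).
{ intros p Hp Hl. apply is_lim_seq_unique, is_lim_seq_spec. intros eps. destruct (H eps (cond_pos eps)) as [N HN].
  exists N; intros n Hn. specialize (HN n Hn). rewrite <- Hl. eapply Rle_lt_trans; [apply Hp | exact HN]. }
rewrite (K Re re_le_Cmod), (K Im Im_le_Cmod) by (intros; unfold Re, Im; simpl; ring). destruct l; reflexivity.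
Qed.

Lemma clim_ext_S u v l : (forall n, u (S n) = v (S n)) -> clim u l -> clim v l.
Proof.
intros E H eps He. destruct (H eps He) as [N HN]. exists (S N). intros [|n] Hn; [lia|]. rewrite <- E. apply HN; lia.
Qed.

Lemma clim_comp f l d u : cder f l d -> clim u l -> clim (fun n => f (u n)) (f l).
Proof.
intros D H eps He. destruct (deriv_lip _ _ _ D) as [K [r [HK [Hr L]]]].
destruct (H (Rmin r (eps / (2 * K)))) as [N HN]; [apply Rmin_pos; [auto | apply Rdiv_lt_0_compat; lra]|].
exists N; intros n Hn. specialize (HN n Hn).
use_Rmin.
specialize (L (u n) ltac:(lra)). eapply Rle_lt_trans; [exact L|].
apply Rle_lt_trans with (K * (eps / (2 * K)))%R; [apply Rmult_le_compat_l; lra|].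
replace (K * (eps / (2 * K)))%R with (eps / 2)%R by (field; lra). lra.
Qed.

Lemma clim_plus u v l m : clim u l -> clim v m -> clim (fun n => u n + v n) (l + m).
Proof.
intros H1 H2 eps He. destruct (H1 (eps/2)%R) as [N1 K1]; [lra|]. destruct (H2 (eps/2)%R) as [N2 K2]; [lra|].
exists (max N1 N2); intros n Hn. specialize (K1 n ltac:(lia)); specialize (K2 n ltac:(lia)).
replace (u n + v n - (l + m)) with ((u n - l) + (v n - m)) by ring. eapply Rle_lt_trans; [apply Cmod_triangle|]; lra.
Qed.

Lemma clim_const c : clim (fun _ => c) c.
Proof. intros eps He; exists 0%nat; intros n _. replace (c - c) with (RtoC 0) by ring. rewrite Cmod_0; auto. Qed.

Lemma clim_scal c u l : clim u l -> clim (fun n => c * u n) (c * l).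
Proof. apply (clim_comp (fun z => c * z) l (c * 1)). apply deriv_scal, cder_id. Qed.

Lemma clim_eq u l m : l = m -> clim u l -> clim u m.
Proof. intros ->; auto. Qed.

Lemma clim_mult u v l m : clim u l -> clim v m -> clim (fun n => u n * v n) (l * m).
Proof.
intros H1 H2.
assert (Z : clim (fun n => (u n - l) * (v n - m)) 0).
{ intros eps He. destruct (H1 eps He) as [N1 K1]. destruct (H2 1%R Rlt_0_1) as [N2 K2].
  exists (max N1 N2); intros n Hn. specialize (K1 n ltac:(lia)); specialize (K2 n ltac:(lia)).
  replace ((u n - l) * (v n - m) - 0) with ((u n - l) * (v n - m)) by ring. rewrite Cmod_mult.
  assert (P1 := Cmod_ge_0 (u n - l)). assert (P2 := Cmod_ge_0 (v n - m)). nra. }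
assert (Y := clim_plus _ _ _ _ Z (clim_plus _ _ _ _ (clim_scal l _ _ H2) (clim_scal m _ _ H1))).
assert (X := clim_plus _ _ _ _ Y (clim_const (- (l * m)))).
apply clim_eq with (0 + (l * m + m * l) + - (l * m)); [ring|].
revert X. apply clim_ext_S. intros n; ring.
Qed.

Lemma psum_clim a l : csum a l -> clim (psum a) l.
Proof.
intros [H1 H2] eps He.
assert (R1 : forall n, Re (psum a (S n)) = sum_n (fun n => Re (a n)) n).
{ induction n as [|n IH]; [rewrite sum_O; unfold Re; simpl; ring|]. rewrite sum_Sn, <- IH. reflexivity. }
assert (I1 : forall n, Im (psum a (S n)) = sum_n (fun n => Im (a n)) n).
{ induction n as [|n IH]; [rewrite sum_O; unfold Im; simpl; ring|]. rewrite sum_Sn, <- IH. reflexivity. }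
assert (He2 : (0 < eps / 2)%R) by lra.
destruct (proj1 (filterlim_locally _ _) H1 (mkposreal _ He2)) as [N1 K1].
destruct (proj1 (filterlim_locally _ _) H2 (mkposreal _ He2)) as [N2 K2].
exists (S (max N1 N2)). intros [|n] Hn; [lia|]. specialize (K1 n ltac:(lia)). specialize (K2 n ltac:(lia)).
rewrite <- R1 in K1. rewrite <- I1 in K2.
change (Rabs (Re (psum a (S n)) - Re l) < eps / 2)%R in K1. change (Rabs (Im (psum a (S n)) - Im l) < eps / 2)%R in K2.
eapply Rle_lt_trans; [apply Cmod_le_ReIm|].
replace (Re (psum a (S n) - l)) with (Re (psum a (S n)) - Re l)%R by (unfold Re; simpl; ring).
replace (Im (psum a (S n) - l)) with (Im (psum a (S n)) - Im l)%R by (unfold Im; simpl; ring). lra.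
Qed.

Lemma series_inv_sq : ex_series (fun n => / INR (S n) ^ 2)%R.
Proof.
apply (ex_series_le (K := R_AbsRing) (V := R_CompleteNormedModule)) with (fun n => 2 * (/ INR (S n) - / INR (S (S n))))%R.
- intros n. change (Rabs (/ INR (S n) ^ 2) <= 2 * (/ INR (S n) - / INR (S (S n))))%R.
  rewrite (S_INR (S n)). set (m := INR (S n)). assert (Hm : (1 <= m)%R) by (unfold m; rewrite S_INR; assert (P := pos_INR n); lra).
  rewrite Rabs_pos_eq by (left; apply Rinv_0_lt_compat; nra).
  replace (2 * (/ m - / (m + 1)))%R with (2 / (m * (m + 1)))%R by (field; lra).
  apply Rmult_le_reg_r with (m ^ 2 * (m * (m + 1)))%R; [apply Rmult_lt_0_compat; nra|].
  replace (/ m ^ 2 * (m ^ 2 * (m * (m + 1))))%R with (m * (m + 1))%R by (field; lra).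
  replace (2 / (m * (m + 1)) * (m ^ 2 * (m * (m + 1))))%R with (2 * m ^ 2)%R by (field; lra). nra.
- assert (X : is_series (fun n => / INR (S n) - / INR (S (S n)))%R 1%R).
  { assert (E : forall n, sum_n (fun n => / INR (S n) - / INR (S (S n)))%R n = (1 - / INR (S (S n)))%R).
    { induction n as [|n IH]; [rewrite sum_O; simpl; field|].
      rewrite sum_Sn, IH. unfold plus; simpl plus. change ((1 - / INR (S (S n)) + (/ INR (S (S n)) - / INR (S (S (S n)))))%R = (1 - / INR (S (S (S n))))%R). ring. }
    apply (is_lim_seq_ext (fun n => 1 - / INR (S (S n)))%R _ 1%R); [intros n; rewrite E; reflexivity|].
    replace (Finite 1) with (Rbar_minus 1 0) by (simpl; f_equal; ring).
    apply is_lim_seq_minus'; [apply is_lim_seq_const|].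
    apply (is_lim_seq_ext (fun n => / INR (n + 2))%R); [intros n; do 2 f_equal; lia|].
    apply (is_lim_seq_incr_n (fun n => / INR n)%R 2).
    replace (Finite 0) with (Rbar_inv p_infty) by reflexivity.
    apply is_lim_seq_inv; [apply is_lim_seq_INR | discriminate]. }
  exists (2 * 1)%R. apply (is_series_scal_l (K := R_AbsRing) 2%R _ _ X).
Qed.

Definition idx (n : nat) : R := INR (S n).
Lemma idx_ge1 n : (1 <= idx n)%R.
Proof. unfold idx; rewrite S_INR; assert (P := pos_INR n); lra. Qed.

(** Weierstrass' product: the logarithm of [1 / Gamma (1 + s)] is the sum over
    [n >= 1] of [log (1 + s / n) - s log (1 + 1 / n)], where the second terms
    telescope into the power [n^s] of Gauss' formula. *)
Definition log_factor (n : nat) (s : C) : C := Clog (1 + s / idx n) - s * ln (1 + / idx n)%R.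
Definition dlog_factor (n : nat) (s : C) : C := / (idx n + s) - ln (1 + / idx n)%R.
Definition ddlog_factor (n : nat) (s : C) : C := - / ((idx n + s) * (idx n + s)).

Lemma idx_shift_ge n s : (Cmod s < 1/2)%R -> (idx n / 2 <= Cmod (idx n + s))%R.
Proof.
intros Hs. assert (P := idx_ge1 n). assert (A := Cmod_sub_ge (idx n) (idx n + s)).
replace (idx n + s - idx n) with s in A by ring.
rewrite (Cmod_R (idx n)), (Rabs_pos_eq (idx n)) in A by lra. lra.
Qed.

Lemma idx_shift_neq0 n (s : C) : (Cmod s < 1/2)%R -> idx n + s <> 0.
Proof. intros Hs. apply Cmod_gt_0. assert (A := idx_shift_ge n s Hs). assert (P := idx_ge1 n); lra. Qed.

Lemma idx_neq0 n : RtoC (idx n) <> 0.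
Proof. intros Z; apply RtoC_inj in Z; assert (P := idx_ge1 n); lra. Qed.

Lemma slit_1s n s : (Cmod s < 1/2)%R -> slit (1 + s / idx n).
Proof.
intros Hs. left. assert (P := idx_ge1 n). assert (A := re_le_Cmod (s / idx n)).
rewrite Cmod_div, Cmod_R, (Rabs_pos_eq (idx n)) in A by (try apply idx_neq0; lra).
assert (B : (Cmod s / idx n <= Cmod s)%R).
{ apply Rmult_le_reg_r with (idx n); [lra|]. replace (Cmod s / idx n * idx n)%R with (Cmod s) by (field; lra).
  assert (Q := Cmod_ge_0 s). nra. }
apply Rcomplements.Rabs_le_between in A.
change (Re (1 + s / idx n)) with (1 + Re (s / idx n))%R. lra.
Qed.

Lemma cder_log_factor n s : (Cmod s < 1/2)%R -> cder (log_factor n) s (dlog_factor n s).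
Proof.
intros Hs. assert (N := idx_neq0 n). assert (N2 := idx_shift_neq0 n s Hs).
apply deriv_eq with (/ (1 + s / idx n) * (0 + / idx n * 1) - ln (1 + / idx n)%R * 1).
- unfold dlog_factor. field. split; [exact N | split; [exact N2 | exact N]] || (repeat split; auto).
- apply deriv_minus.
  + apply (deriv_comp Clog (fun s => 1 + s / idx n)); [|apply cder_Clog, slit_1s, Hs].
    apply deriv_plus; [apply deriv_const|]. apply deriv_ext with (fun s => / idx n * s); [intros; unfold Cdiv; ring|].
    apply deriv_scal, cder_id.
  + apply deriv_ext with (fun s => ln (1 + / idx n)%R * s); [intros; ring|]. apply deriv_scal, cder_id.
Qed.

Lemma cder_dlog_factor n s : (Cmod s < 1/2)%R -> cder (dlog_factor n) s (ddlog_factor n s).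
Proof.
intros Hs. assert (N2 := idx_shift_neq0 n s Hs).
apply deriv_eq with (- / ((idx n + s) * (idx n + s)) * (0 + 1) - 0); [unfold ddlog_factor; ring|].
apply deriv_minus; [|apply deriv_const].
apply (cder_inv_comp (fun s => idx n + s)); [exact N2|]. apply deriv_plus; [apply deriv_const | apply cder_id].
Qed.

(** The three bounds give termwise differentiation for [|s| < 1/4]; the condition
    [|s| < 1/2] keeps [idx n + s] away from 0. *)
Lemma ddlog_factor_bound n s : (Cmod s < 1/2)%R -> (Cmod (ddlog_factor n s) <= 4 * / idx n ^ 2)%R.
Proof.
intros Hs. assert (N2 := idx_shift_neq0 n s Hs). assert (A := idx_shift_ge n s Hs). assert (P := idx_ge1 n).
unfold ddlog_factor. rewrite Cmod_opp, Cmod_inv, Cmod_mult by (apply Cmult_neq_0; auto).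
replace (4 * / idx n ^ 2)%R with (/ (idx n / 2 * (idx n / 2)))%R by (field; lra).
apply Rinv_le_contravar; [apply Rmult_lt_0_compat; lra | apply Rmult_le_compat; lra].
Qed.

Lemma ln_1p_bound x : (0 < x)%R -> (0 <= x - ln (1 + x) <= x ^ 2)%R.
Proof.
intros Hx. split.
- assert (A := exp_ge_1x x). assert (B := ln_exp x).
  assert (ln (1 + x) <= ln (exp x))%R by (apply Rcomplements.ln_le; lra). lra.
- assert (A : (/ (1 + x) <= exp (- (x / (1 + x))))%R).
  { replace (/ (1 + x))%R with (1 + - (x / (1 + x)))%R by (field; lra). apply exp_ge_1x. }
  assert (B : (ln (/ (1 + x)) <= - (x / (1 + x)))%R).
  { rewrite <- (ln_exp (- (x / (1 + x)))). apply Rcomplements.ln_le; [apply Rinv_0_lt_compat; lra | exact A]. }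
  rewrite ln_Rinv in B by lra.
  assert (D : (x - x / (1 + x) <= x ^ 2)%R).
  { replace (x - x / (1 + x))%R with (x ^ 2 * / (1 + x))%R by (field; lra).
    assert (I : (/ (1 + x) <= 1)%R) by (rewrite <- Rinv_1; apply Rinv_le_contravar; lra).
    assert (Q := pow2_ge_0 x). nra. }
  lra.
Qed.

Lemma dlog_factor_bound n s : (Cmod s < 1/2)%R -> (Cmod (dlog_factor n s) <= 2 * / idx n ^ 2)%R.
Proof.
intros Hs. assert (N2 := idx_shift_neq0 n s Hs). assert (A := idx_shift_ge n s Hs). assert (P := idx_ge1 n).
assert (N := idx_neq0 n).
replace (dlog_factor n s) with (- (s / ((idx n + s) * idx n)) + RtoC (/ idx n - ln (1 + / idx n))).
- eapply Rle_trans; [apply Cmod_triangle|].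
  assert (B := ln_1p_bound (/ idx n) ltac:(apply Rinv_0_lt_compat; lra)).
  rewrite Cmod_opp, Cmod_div, Cmod_mult, !Cmod_R, (Rabs_pos_eq (idx n)), Rabs_pos_eq by (try apply Cmult_neq_0; auto; lra).
  rewrite pow_inv in B.
  assert (X : (Cmod s / (Cmod (idx n + s) * idx n) <= / idx n ^ 2)%R).
  { apply Rle_trans with (1 / 2 / (idx n / 2 * idx n))%R; [|right; field; lra].
    apply Rmult_le_compat; [apply Cmod_ge_0 | left; apply Rinv_0_lt_compat, Rmult_lt_0_compat; lra | lra |].
    apply Rinv_le_contravar; [apply Rmult_lt_0_compat; lra | apply Rmult_le_compat_r; lra]. }
  lra.
- unfold dlog_factor. rewrite RtoC_minus, RtoC_inv by lra. field. split; auto.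
Qed.

Lemma log_factor_0 n : log_factor n 0 = 0.
Proof.
unfold log_factor. replace (1 + 0 / idx n) with (RtoC 1) by (unfold Cdiv; ring). rewrite Clog_1. ring.
Qed.

Lemma log_factor_bound n s : (Cmod s < 1/2)%R -> (Cmod (log_factor n s) <= 2 * / idx n ^ 2)%R.
Proof.
intros Hs. assert (P := idx_ge1 n).
assert (I : (0 < / idx n ^ 2)%R) by (apply Rinv_0_lt_compat; nra).
assert (Hseg : forall t, (0 <= t <= 1)%R -> (Cmod (seg 0 s t) < 1/2)%R).
{ intros t Ht. unfold seg. replace (0 + RtoC t * (s - 0)) with (RtoC t * s) by ring.
  rewrite Cmod_mult, Cmod_R, Rabs_pos_eq by lra. assert (Q := Cmod_ge_0 s). nra. }
assert (A := cder_mean_value (log_factor n) (dlog_factor n) 0 s (2 * / idx n ^ 2) (fun t Ht => cder_log_factor _ _ (Hseg t Ht)) (fun t Ht => dlog_factor_bound _ _ (Hseg t Ht))).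
rewrite log_factor_0 in A. replace (log_factor n s - 0) with (log_factor n s) in A by ring. replace (s - 0) with s in A by ring.
assert (Q := Cmod_ge_0 s). nra.
Qed.

Lemma series_scal_inv_sq a : ex_series (fun n => a * / idx n ^ 2)%R.
Proof. destruct series_inv_sq as [l Hl]. exists (a * l)%R. apply (is_series_scal_l (K := R_AbsRing) a _ _ Hl). Qed.

Definition log_rG (s : C) : C := CSeries (fun n => log_factor n s).
Definition dlog_rG (s : C) : C := CSeries (fun n => dlog_factor n s).
Definition ddlog_rG (s : C) : C := CSeries (fun n => ddlog_factor n s).

Lemma near_disc (s y : C) : (Cmod s < 1/4)%R -> (Cmod (y - s) < 1/4)%R -> (Cmod y < 1/2)%R.
Proof.
intros H1 H2. replace y with ((y - s) + s) by ring. eapply Rle_lt_trans; [apply Cmod_triangle|]. lra.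
Qed.

Lemma csum_log_factor s : (Cmod s < 1/2)%R -> csum (fun n => log_factor n s) (log_rG s).
Proof. intros Hs. apply csum_dom with (fun n => 2 * / idx n ^ 2)%R; [intros; apply log_factor_bound, Hs | apply series_scal_inv_sq]. Qed.
Lemma csum_dlog_factor s : (Cmod s < 1/2)%R -> csum (fun n => dlog_factor n s) (dlog_rG s).
Proof. intros Hs. apply csum_dom with (fun n => 2 * / idx n ^ 2)%R; [intros; apply dlog_factor_bound, Hs | apply series_scal_inv_sq]. Qed.
Lemma csum_ddlog_factor s : (Cmod s < 1/2)%R -> csum (fun n => ddlog_factor n s) (ddlog_rG s).
Proof. intros Hs. apply csum_dom with (fun n => 4 * / idx n ^ 2)%R; [intros; apply ddlog_factor_bound, Hs | apply series_scal_inv_sq]. Qed.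

Lemma cder_log_rG s : (Cmod s < 1/4)%R -> cder log_rG s (dlog_rG s).
Proof.
intros Hs. apply (cder_series log_factor dlog_factor (fun n => 2 * / idx n ^ 2)%R log_rG dlog_rG s (1/4)%R); [lra | | | apply series_scal_inv_sq | |].
- intros n y Hy; apply cder_log_factor, (near_disc s); auto.
- intros n y Hy; apply dlog_factor_bound, (near_disc s); auto.
- intros y Hy; apply csum_log_factor, (near_disc s); auto.
- apply csum_dlog_factor; lra.
Qed.

Lemma cder_dlog_rG s : (Cmod s < 1/4)%R -> cder dlog_rG s (ddlog_rG s).
Proof.
intros Hs. apply (cder_series dlog_factor ddlog_factor (fun n => 4 * / idx n ^ 2)%R dlog_rG ddlog_rG s (1/4)%R); [lra | | | apply series_scal_inv_sq | |].
- intros n y Hy; apply cder_dlog_factor, (near_disc s); auto.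
- intros n y Hy; apply ddlog_factor_bound, (near_disc s); auto.
- intros y Hy; apply csum_dlog_factor, (near_disc s); auto.
- apply csum_ddlog_factor; lra.
Qed.

Lemma log_rG_0 : log_rG 0 = 0.
Proof.
unfold log_rG. apply csum_unique. assert (A := csum_scal 0 _ _ (csum_log_factor 0 ltac:(rewrite Cmod_0; lra))).
apply csum_eq with (0 * log_rG 0); [ring|]. revert A. apply csum_ext. intros n; rewrite log_factor_0; ring.
Qed.

(** [1 / Gamma (1 + s)] near [s = 0]. *)
Definition rG (s : C) : C := Cexp (log_rG s).

Definition gauss (s : C) (n : nat) : C :=
  Cprod (fun j => s + INR j) (S n) / (INR (fact n) * Cexp (s * ln (INR n))).

Lemma exp_psum_log_factor s n : (Cmod s < 1/2)%R ->
  Cexp (psum (fun k => log_factor k s) n) = Cprod (fun j => 1 + s + INR j) n / INR (fact n) * Cexp (- (s * ln (INR (S n)))).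
Proof.
intros Hs. induction n as [|n IH].
- simpl. rewrite ln_1. replace (- (s * 0)) with (RtoC 0) by ring. rewrite Cexp_0. field.
- change (psum (fun k => log_factor k s) (S n)) with (psum (fun k => log_factor k s) n + log_factor n s).
  rewrite Cexp_plus, IH. unfold log_factor, Cminus. rewrite Cexp_plus, Cexp_Clog by (apply slit_1s, Hs).
  assert (P := idx_ge1 n). assert (N := idx_neq0 n).
  change (Cprod (fun j => 1 + s + INR j) (S n)) with (Cprod (fun j => 1 + s + INR j) n * (1 + s + INR n)).
  rewrite fact_simpl, mult_INR, RtoC_mult. fold (idx n).
  assert (E : ln (INR (S (S n))) = (ln (idx n) + ln (1 + / idx n))%R).
  { rewrite <- ln_mult; [|lra|assert (0 < / idx n)%R by (apply Rinv_0_lt_compat; lra); lra].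
    f_equal. rewrite S_INR. fold (idx n). field; lra. }
  rewrite E, RtoC_plus.
  replace (- (s * (ln (idx n) + ln (1 + / idx n)%R))) with (- (s * ln (idx n)) + - (s * ln (1 + / idx n)%R)) by ring.
  rewrite Cexp_plus. replace (1 + s + INR n) with (idx n + s) by (unfold idx; rewrite S_INR, RtoC_plus; ring).
  assert (Nf : RtoC (INR (fact n)) <> 0) by (intros Z; apply RtoC_inj in Z; apply (INR_fact_neq_0 n Z)).
  field. auto.
Qed.

Lemma Cexp_ln r : (0 < r)%R -> Cexp (RtoC (ln r)) = RtoC r.
Proof. intros Hr. rewrite Cexp_RtoC, exp_ln; auto. Qed.

Lemma clim_inv : clim (fun n => RtoC (/ INR n)) 0.
Proof.
intros eps He. destruct (archimed_cor1 eps He) as [N [HN HN0]].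
exists N; intros n Hn. replace (RtoC (/ INR n) - 0) with (RtoC (/ INR n)) by ring.
assert (Pn : (0 < INR n)%R) by (apply lt_0_INR; lia).
rewrite Cmod_R, Rabs_pos_eq by (left; apply Rinv_0_lt_compat; auto).
eapply Rle_lt_trans; [|exact HN]. apply Rinv_le_contravar; [apply lt_0_INR; lia | apply le_INR; lia].
Qed.

Lemma clim_dln : clim (fun n => RtoC (ln (INR (S n)) - ln (INR n))) 0.
Proof.
intros eps He. destruct (clim_inv eps He) as [N HN]. exists (S N). intros n Hn.
specialize (HN n ltac:(lia)). replace (RtoC (/ INR n) - 0) with (RtoC (/ INR n)) in HN by ring.
replace (RtoC (ln (INR (S n)) - ln (INR n)) - 0) with (RtoC (ln (INR (S n)) - ln (INR n))) by ring.
assert (Pn : (0 < INR n)%R) by (apply lt_0_INR; lia). assert (I := Rinv_0_lt_compat _ Pn).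
rewrite Cmod_R in HN |- *. rewrite Rabs_pos_eq in HN by lra.
replace (ln (INR (S n)) - ln (INR n))%R with (ln (1 + / INR n)).
- assert (B := ln_1p_bound (/ INR n) I).
  assert (0 <= ln (1 + / INR n))%R by (rewrite <- ln_1; apply Rcomplements.ln_le; lra).
  rewrite Rabs_pos_eq by auto. lra.
- rewrite <- Rcomplements.ln_div by (auto; apply lt_0_INR; lia). f_equal. rewrite S_INR. field; lra.
Qed.

(** The product of the first [n] Weierstrass factors differs from Gauss' expression
    by the power [s] of [(n + 1) / n] and by the last factor [1 + (1 + s) / n],
    both of which tend to 1. *)
Lemma gauss_lim s : (Cmod s < 1/2)%R -> clim (gauss (1 + s)) (rG s).
Proof.
intros Hs.
assert (A1 : clim (fun n => Cexp (psum (fun k => log_factor k s) n)) (rG s)).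
{ apply (clim_comp Cexp (log_rG s) (Cexp (log_rG s))); [apply cder_Cexp | apply psum_clim, csum_log_factor, Hs]. }
assert (A2 : clim (fun n => Cexp (s * RtoC (ln (INR (S n)) - ln (INR n)))) (Cexp (s * 0))).
{ apply (clim_comp (fun t => Cexp (s * t)) 0 (Cexp (s * 0) * (s * 1))); [|apply clim_dln].
  apply (cder_Cexp_comp (fun t => s * t)), deriv_scal, cder_id. }
assert (A3 : clim (fun n => 1 + (1 + s) * RtoC (/ INR n)) (1 + (1 + s) * 0)).
{ apply clim_plus; [apply clim_const | apply clim_scal, clim_inv]. }
assert (A := clim_mult _ _ _ _ (clim_mult _ _ _ _ A1 A2) A3).
replace (s * 0) with (RtoC 0) in A by ring. rewrite Cexp_0 in A.
apply clim_eq with (rG s * 1 * (1 + (1 + s) * 0)); [ring|].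
revert A. apply clim_ext_S. intros n. set (m := S n).
assert (Pm : (0 < INR m)%R) by (apply lt_0_INR; unfold m; lia).
rewrite exp_psum_log_factor by auto. unfold gauss.
change (Cprod (fun j => 1 + s + INR j) (S m)) with (Cprod (fun j => 1 + s + INR j) m * (1 + s + INR m)).
replace ((1 + s) * ln (INR m)) with (ln (INR m) + s * ln (INR m)) by ring.
rewrite Cexp_plus, Cexp_ln by auto. rewrite RtoC_minus.
replace (s * (ln (INR (S m)) - ln (INR m))) with (s * ln (INR (S m)) + - (s * ln (INR m))) by ring.
rewrite Cexp_plus, RtoC_inv by lra.
assert (E1 := Cexp_opp (s * ln (INR (S m)))). assert (E2 := Cexp_opp (s * ln (INR m))).
assert (N1 := Cexp_neq0 (s * ln (INR m))).
assert (Nm : RtoC (INR m) <> 0) by (intros Z; apply RtoC_inj in Z; lra).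
assert (Nf : RtoC (INR (fact m)) <> 0) by (intros Z; apply RtoC_inj in Z; apply (INR_fact_neq_0 m Z)).
set (e1 := Cexp (s * ln (INR (S m)))) in *. set (e1' := Cexp (- (s * ln (INR (S m))))) in *.
set (e2 := Cexp (s * ln (INR m))) in *. set (e2' := Cexp (- (s * ln (INR m)))) in *.
replace e2' with (/ e2) by (transitivity (e2' * e2 / e2); [rewrite E2; field; auto | field; auto]).
transitivity (Cprod (fun j => 1 + s + INR j) m / INR (fact m) * (e1' * e1) * / e2 * (1 + (1 + s) * / INR m)); [ring|].
rewrite E1. field. auto.
Qed.

Lemma Cprod_cons a n : Cprod a (S n) = a O * Cprod (fun j => a (S j)) n.
Proof.
induction n as [|n IH]; [simpl; ring|].
change (Cprod a (S (S n))) with (Cprod a (S n) * a (S n)). rewrite IH. simpl. ring.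
Qed.

Lemma Cprod_ext a b n : (forall j, a j = b j) -> Cprod a n = Cprod b n.
Proof. intros E; induction n as [|n IH]; simpl; [reflexivity | rewrite IH, E; reflexivity]. Qed.

(** The functional equation of the Gamma function, on Gauss' formula.  It gives the
    values at [1 + m + s] from the single limit above. *)
Lemma gauss_succ (s l : C) : s <> 0 -> clim (gauss s) l -> clim (gauss (s + 1)) (l / s).
Proof.
intros Hs H.
assert (A := clim_mult _ _ _ _ H (clim_scal (/ s) _ _ (clim_plus _ _ _ _ (clim_const 1) (clim_scal (s + 1) _ _ clim_inv)))).
apply clim_eq with (l * (/ s * (1 + (s + 1) * 0))); [field; auto|].
revert A. apply clim_ext_S. intros n. set (m := S n). unfold gauss.
assert (Pm : (0 < INR m)%R) by (apply lt_0_INR; unfold m; lia).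
replace ((s + 1) * ln (INR m)) with (s * ln (INR m) + ln (INR m)) by ring. rewrite Cexp_plus, Cexp_ln by auto.
assert (E := Cprod_cons (fun j => s + INR j) (S m)).
change (Cprod (fun j => s + INR j) (S (S m))) with (Cprod (fun j => s + INR j) (S m) * (s + INR (S m))) in E.
rewrite (Cprod_ext (fun j => s + INR (S j)) (fun j => s + 1 + INR j)) in E by (intros j; rewrite S_INR, RtoC_plus; ring).
change (INR 0) with 0%R in E. rewrite (S_INR m), RtoC_plus in E.
assert (N1 := Cexp_neq0 (s * ln (INR m))).
assert (Nm : RtoC (INR m) <> 0) by (intros Z; apply RtoC_inj in Z; lra).
assert (Nf : RtoC (INR (fact m)) <> 0) by (intros Z; apply RtoC_inj in Z; apply (INR_fact_neq_0 m Z)).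
rewrite RtoC_inv by lra.
set (X := Cprod (fun j => s + INR j) (S m)) in *. set (Y := Cprod (fun j => s + 1 + INR j) (S m)) in *.
assert (EY : Y = X * (s + (INR m + 1)) / s).
{ rewrite E. field. auto. }
rewrite EY. field. auto.
Qed.

Definition rpoch (m : nat) (s : C) : C := Cprod (fun j => / (idx j + s)) m.

Lemma rGamma_rpoch m s : (Cmod s < 1/2)%R -> rGamma (1 + INR m + s) = rG s * rpoch m s.
Proof.
intros Hs. apply (clim_CLim (gauss (1 + INR m + s))).
induction m as [|m IH].
- apply clim_eq with (rG s); [unfold rpoch; simpl; ring|]. change (INR 0) with 0%R.
  replace (1 + 0 + s) with (1 + s) by ring. apply gauss_lim, Hs.
- assert (E : 1 + INR m + s = idx m + s) by (unfold idx; rewrite S_INR, RtoC_plus; ring).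
  assert (N : 1 + INR m + s <> 0) by (rewrite E; apply idx_shift_neq0, Hs).
  replace (1 + INR (S m) + s) with (1 + INR m + s + 1) by (rewrite S_INR, RtoC_plus; ring).
  apply clim_eq with (rG s * rpoch m s / (1 + INR m + s)); [|apply gauss_succ; auto].
  rewrite E. unfold rpoch, Cdiv; simpl; ring.
Qed.

(** * The functions E *)

Definition inv_sum (m : nat) (s : C) : C := psum (fun j => / (idx j + s)) m.
Definition inv_sq_sum (m : nat) (s : C) : C := psum (fun j => / ((idx j + s) * (idx j + s))) m.
(** The derivatives of [rpoch], the product of the [1 / (idx j + s)], through its
    logarithmic derivative [- inv_sum]. *)
Definition drpoch m s := - (rpoch m s * inv_sum m s).
Definition ddrpoch m s := rpoch m s * (inv_sum m s * inv_sum m s + inv_sq_sum m s).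

Lemma cder_inv_sum m s : (Cmod s < 1/2)%R -> cder (inv_sum m) s (- inv_sq_sum m s).
Proof.
intros Hs. induction m as [|m IH].
- apply deriv_eq with (RtoC 0); [unfold inv_sq_sum; simpl; ring | apply deriv_const].
- apply deriv_eq with (- inv_sq_sum m s + - / ((idx m + s) * (idx m + s)) * (0 + 1)); [unfold inv_sq_sum; simpl; ring|].
  apply (deriv_plus (inv_sum m) (fun s => / (idx m + s))); [exact IH|].
  apply (cder_inv_comp (fun s => idx m + s)); [apply idx_shift_neq0, Hs|]. apply deriv_plus; [apply deriv_const | apply cder_id].
Qed.

Lemma cder_rpoch m s : (Cmod s < 1/2)%R -> cder (rpoch m) s (drpoch m s).
Proof.
intros Hs. induction m as [|m IH].
- apply deriv_eq with (RtoC 0); [unfold drpoch, inv_sum; simpl; ring | apply (deriv_const 1)].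
- assert (N := idx_shift_neq0 m s Hs).
  apply deriv_eq with (drpoch m s * / (idx m + s) + rpoch m s * (- / ((idx m + s) * (idx m + s)) * (0 + 1))).
  + unfold drpoch. change (inv_sum (S m) s) with (inv_sum m s + / (idx m + s)). change (rpoch (S m) s) with (rpoch m s * / (idx m + s)).
    field. exact N.
  + apply (deriv_mult (rpoch m) (fun s => / (idx m + s))); [exact IH|].
    apply (cder_inv_comp (fun s => idx m + s)); [exact N|]. apply deriv_plus; [apply deriv_const | apply cder_id].
Qed.

Lemma cder_drpoch m s : (Cmod s < 1/2)%R -> cder (drpoch m) s (ddrpoch m s).
Proof.
intros Hs. apply deriv_eq with (- (drpoch m s * inv_sum m s + rpoch m s * - inv_sq_sum m s)); [unfold ddrpoch, drpoch; ring|].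
apply deriv_opp, (deriv_mult (rpoch m) (inv_sum m)); [apply cder_rpoch, Hs | apply cder_inv_sum, Hs].
Qed.

Lemma inv_idx_bound n s : (Cmod s < 1/2)%R -> (Cmod (/ (idx n + s)) <= 2 / idx n)%R.
Proof.
intros Hs. assert (A := idx_shift_ge n s Hs). assert (P := idx_ge1 n). assert (N := idx_shift_neq0 n s Hs).
rewrite Cmod_inv by auto. replace (2 / idx n)%R with (/ (idx n / 2))%R by (field; lra).
apply Rinv_le_contravar; lra.
Qed.

Lemma inv_idx_bound2 n s : (Cmod s < 1/2)%R -> (Cmod (/ (idx n + s)) <= 2)%R.
Proof.
intros Hs. eapply Rle_trans; [apply inv_idx_bound, Hs|]. assert (P := idx_ge1 n).
apply Rmult_le_reg_r with (idx n); [lra|]. replace (2 / idx n * idx n)%R with 2%R by (field; lra). lra.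
Qed.

Lemma rpoch_bound m s : (Cmod s < 1/2)%R -> (Cmod (rpoch m s) <= 2 ^ m / INR (fact m))%R.
Proof.
intros Hs. induction m as [|m IH].
- unfold rpoch; simpl. rewrite Cmod_1. lra.
- change (rpoch (S m) s) with (rpoch m s * / (idx m + s)). rewrite Cmod_mult.
  assert (B := inv_idx_bound m s Hs). assert (P := idx_ge1 m).
  rewrite fact_simpl, mult_INR. fold (idx m). simpl pow.
  apply Rle_trans with (2 ^ m / INR (fact m) * (2 / idx m))%R.
  + apply Rmult_le_compat; auto; apply Cmod_ge_0.
  + right; field. split; [lra | apply INR_fact_neq_0] || (split; [apply INR_fact_neq_0 | lra]).
Qed.

Lemma inv_sum_bound m s : (Cmod s < 1/2)%R -> (Cmod (inv_sum m s) <= 2 * INR m)%R.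
Proof.
intros Hs. induction m as [|m IH].
- unfold inv_sum; simpl. rewrite Cmod_0. lra.
- change (inv_sum (S m) s) with (inv_sum m s + / (idx m + s)). rewrite S_INR.
  eapply Rle_trans; [apply Cmod_triangle|]. assert (B := inv_idx_bound2 m s Hs). lra.
Qed.

Lemma inv_sq_sum_bound m s : (Cmod s < 1/2)%R -> (Cmod (inv_sq_sum m s) <= 4 * INR m)%R.
Proof.
intros Hs. induction m as [|m IH].
- unfold inv_sq_sum; simpl. rewrite Cmod_0. lra.
- change (inv_sq_sum (S m) s) with (inv_sq_sum m s + / ((idx m + s) * (idx m + s))). rewrite S_INR.
  eapply Rle_trans; [apply Cmod_triangle|]. assert (B := inv_idx_bound2 m s Hs).
  assert (N := idx_shift_neq0 m s Hs).
  replace (/ ((idx m + s) * (idx m + s))) with (/ (idx m + s) * / (idx m + s)) by (field; auto).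
  rewrite Cmod_mult. assert (Q := Cmod_ge_0 (/ (idx m + s))). nra.
Qed.

Lemma drpoch_bound m s : (Cmod s < 1/2)%R -> (Cmod (drpoch m s) <= 2 * (4 ^ m / INR (fact m)))%R.
Proof.
intros Hs. unfold drpoch. rewrite Cmod_opp, Cmod_mult.
assert (A := rpoch_bound m s Hs). assert (B := inv_sum_bound m s Hs). assert (D := INR_le_pow2 m).
apply Rle_trans with (2 ^ m / INR (fact m) * (2 * 2 ^ m))%R.
- apply Rmult_le_compat; try apply Cmod_ge_0; lra.
- right. replace 4%R with (2 * 2)%R by ring. rewrite Rpow_mult_distr. field. apply INR_fact_neq_0.
Qed.

Lemma ddrpoch_bound m s : (Cmod s < 1/2)%R -> (Cmod (ddrpoch m s) <= 8 * (8 ^ m / INR (fact m)))%R.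
Proof.
intros Hs. unfold ddrpoch. rewrite Cmod_mult.
assert (A := rpoch_bound m s Hs). assert (B := inv_sum_bound m s Hs). assert (B2 := inv_sq_sum_bound m s Hs). assert (D := INR_le_pow2 m).
assert (X : (Cmod (inv_sum m s * inv_sum m s + inv_sq_sum m s) <= 8 * (2 ^ m * 2 ^ m))%R).
{ eapply Rle_trans; [apply Cmod_triangle|]. rewrite Cmod_mult.
  assert (Q := Cmod_ge_0 (inv_sum m s)). assert (One : (1 <= 2 ^ m)%R) by (apply pow_R1_Rle; lra).
  assert (Y : (Cmod (inv_sum m s) * Cmod (inv_sum m s) <= (2 * 2 ^ m) * (2 * 2 ^ m))%R) by (apply Rmult_le_compat; lra).
  nra. }
apply Rle_trans with (2 ^ m / INR (fact m) * (8 * (2 ^ m * 2 ^ m)))%R.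
- apply Rmult_le_compat; try apply Cmod_ge_0; lra.
- right. replace (8 ^ m)%R with (2 ^ m * 2 ^ m * 2 ^ m)%R by (rewrite <- !Rpow_mult_distr; f_equal; ring). field. apply INR_fact_neq_0.
Qed.

Definition shifted_exp (y s : C) : C := CSeries (fun m => y ^ m * rpoch m s).
Definition dshifted_exp (y s : C) : C := CSeries (fun m => y ^ m * drpoch m s).
Definition ddshifted_exp (y s : C) : C := CSeries (fun m => y ^ m * ddrpoch m s).

Lemma csum_Sgen (f : nat -> C -> C) A K y s : (forall m, (Cmod (f m s) <= A * (K ^ m / INR (fact m)))%R) ->
  forall n, (Cmod (y ^ n * f n s) <= A * ((K * Cmod y) ^ n / INR (fact n)))%R.
Proof.
intros H n. rewrite Cmod_mult, Cmod_pow, Rpow_mult_distr.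
apply Rle_trans with (Cmod y ^ n * (A * (K ^ n / INR (fact n))))%R.
- apply Rmult_le_compat_l; [apply pow_le, Cmod_ge_0 | apply H].
- right; field; apply INR_fact_neq_0.
Qed.

Lemma bd0 s : (Cmod s < 1/2)%R -> forall m, (Cmod (rpoch m s) <= 1 * (2 ^ m / INR (fact m)))%R.
Proof. intros Hs m; rewrite Rmult_1_l; apply rpoch_bound, Hs. Qed.

Lemma csum_shifted_exp y s : (Cmod s < 1/2)%R -> csum (fun m => y ^ m * rpoch m s) (shifted_exp y s).
Proof. intros Hs. eapply csum_dom; [apply (csum_Sgen rpoch _ _ y s (bd0 s Hs)) | eexists; apply exp_series_scal]. Qed.
Lemma csum_dshifted_exp y s : (Cmod s < 1/2)%R -> csum (fun m => y ^ m * drpoch m s) (dshifted_exp y s).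
Proof. intros Hs. eapply csum_dom; [apply (csum_Sgen drpoch _ _ y s (fun m => drpoch_bound m s Hs)) | eexists; apply exp_series_scal]. Qed.
Lemma csum_ddshifted_exp y s : (Cmod s < 1/2)%R -> csum (fun m => y ^ m * ddrpoch m s) (ddshifted_exp y s).
Proof. intros Hs. eapply csum_dom; [apply (csum_Sgen ddrpoch _ _ y s (fun m => ddrpoch_bound m s Hs)) | eexists; apply exp_series_scal]. Qed.

Lemma cder_shifted_exp y s : (Cmod s < 1/4)%R -> cder (shifted_exp y) s (dshifted_exp y s).
Proof.
intros Hs. apply (cder_series (fun m s => y ^ m * rpoch m s) (fun m s => y ^ m * drpoch m s)
  (fun n => 2 * ((4 * Cmod y) ^ n / INR (fact n)))%R (shifted_exp y) (dshifted_exp y) s (1/4)%R); [lra | | | eexists; apply exp_series_scal | |].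
- intros n v Hv; apply deriv_scal, cder_rpoch, (near_disc s); auto.
- intros n v Hv; apply (csum_Sgen drpoch _ _ y v (fun m => drpoch_bound m v (near_disc s v Hs Hv))).
- intros v Hv; apply csum_shifted_exp, (near_disc s); auto.
- apply csum_dshifted_exp; lra.
Qed.

Lemma cder_dshifted_exp y s : (Cmod s < 1/4)%R -> cder (dshifted_exp y) s (ddshifted_exp y s).
Proof.
intros Hs. apply (cder_series (fun m s => y ^ m * drpoch m s) (fun m s => y ^ m * ddrpoch m s)
  (fun n => 8 * ((8 * Cmod y) ^ n / INR (fact n)))%R (dshifted_exp y) (ddshifted_exp y) s (1/4)%R); [lra | | | eexists; apply exp_series_scal | |].
- intros n v Hv; apply deriv_scal, cder_drpoch, (near_disc s); auto.
- intros n v Hv; apply (csum_Sgen ddrpoch _ _ y v (fun m => ddrpoch_bound m v (near_disc s v Hs Hv))).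
- intros v Hv; apply csum_dshifted_exp, (near_disc s); auto.
- apply csum_ddshifted_exp; lra.
Qed.

Lemma rpoch_0 m : rpoch m 0 = RtoC (/ INR (fact m)).
Proof.
induction m as [|m IH]; [unfold rpoch; simpl; f_equal; field|].
change (rpoch (S m) 0) with (rpoch m 0 * / (idx m + 0)). rewrite IH, Cplus_0_r, fact_simpl, mult_INR. fold (idx m).
assert (P := idx_ge1 m). rewrite <- RtoC_inv by lra. rewrite <- RtoC_mult. f_equal. field.
split; [lra | apply INR_fact_neq_0] || (split; [apply INR_fact_neq_0 | lra]).
Qed.

Lemma inv_sum_0 m : inv_sum m 0 = RtoC (harmonic m).
Proof.
induction m as [|m IH]; [rewrite harmonic_0; reflexivity|].
change (inv_sum (S m) 0) with (inv_sum m 0 + / (idx m + 0)). rewrite IH, Cplus_0_r, harmonic_S. fold (idx m).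
assert (P := idx_ge1 m). rewrite RtoC_plus, RtoC_inv by lra. reflexivity.
Qed.

Lemma inv_sq_sum_0 m : inv_sq_sum m 0 = RtoC (harm2 m).
Proof.
induction m as [|m IH]; [rewrite harm2_0; reflexivity|].
change (inv_sq_sum (S m) 0) with (inv_sq_sum m 0 + / ((idx m + 0) * (idx m + 0))). rewrite IH, Cplus_0_r, harm2_S. fold (idx m).
assert (P := idx_ge1 m). rewrite RtoC_plus, RtoC_inv, RtoC_pow by (apply Rgt_not_eq; nra). simpl. rewrite Cmult_1_r. reflexivity.
Qed.

Lemma shifted_exp_0 y : shifted_exp y 0 = pser coef_e y.
Proof.
apply csum_unique. apply csum_ext with (fun k => RtoC (coef_e k) * y ^ k); [|apply pser_csum, exp_type_coef_e].
intros n; rewrite rpoch_0. unfold coef_e; ring.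
Qed.

Lemma dshifted_exp_0 y : dshifted_exp y 0 = - pser coef_eH y.
Proof.
apply csum_unique. apply csum_eq with (- (1) * pser coef_eH y); [ring|].
apply csum_ext with (fun k => - (1) * (RtoC (coef_eH k) * y ^ k)); [|apply csum_scal, pser_csum, exp_type_coef_eH].
intros n; unfold drpoch; rewrite rpoch_0, inv_sum_0. unfold coef_eH, Rdiv; rewrite RtoC_mult; ring.
Qed.

Lemma ddshifted_exp_0 y : ddshifted_exp y 0 = pser coef_eHH y.
Proof.
apply csum_unique. apply csum_ext with (fun k => RtoC (coef_eHH k) * y ^ k); [|apply pser_csum, exp_type_coef_eHH].
intros n; unfold ddrpoch; rewrite rpoch_0, inv_sum_0, inv_sq_sum_0. unfold coef_eHH, Rdiv; rewrite RtoC_mult, RtoC_plus, RtoC_pow. ring.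
Qed.

(** The factor [z^s / Gamma (1 + s)] common to all terms of the series of [Efun]. *)
Definition Eprefactor (w s : C) : C := Cexp (log_rG s + s * w).

Lemma Efun_factor s w : (Cmod s < 1/2)%R -> Efun s w = Eprefactor w s * shifted_exp (Cexp w) s.
Proof.
intros Hs. unfold Efun. apply csum_unique.
apply csum_ext with (fun m => Eprefactor w s * (Cexp w ^ m * rpoch m s)); [|apply csum_scal, csum_shifted_exp, Hs].
intros m. rewrite rGamma_rpoch by auto. unfold Eprefactor, rG. rewrite Cexp_pow, Cmult_plus_distr_r, !Cexp_plus. ring.
Qed.

Definition dEfun (w s : C) : C := Eprefactor w s * ((dlog_rG s + w) * shifted_exp (Cexp w) s + dshifted_exp (Cexp w) s).
Definition ddEfun (w s : C) : C := Eprefactor w s * ((dlog_rG s + w) * ((dlog_rG s + w) * shifted_exp (Cexp w) s + dshifted_exp (Cexp w) s)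
   + (ddlog_rG s * shifted_exp (Cexp w) s + (dlog_rG s + w) * dshifted_exp (Cexp w) s + ddshifted_exp (Cexp w) s)).

Lemma cder_Eprefactor w s : (Cmod s < 1/4)%R -> cder (Eprefactor w) s (Eprefactor w s * (dlog_rG s + w)).
Proof.
intros Hs. apply (cder_Cexp_comp (fun s => log_rG s + s * w)).
apply deriv_plus; [apply cder_log_rG, Hs|].
apply deriv_eq with (w * 1); [ring|]. apply deriv_ext with (fun s => w * s); [intros; ring | apply deriv_scal, cder_id].
Qed.

Lemma cder_Efun w s : (Cmod s < 1/4)%R -> cder (fun s => Efun s w) s (dEfun w s).
Proof.
intros Hs. apply (deriv_ext_loc (fun s => Eprefactor w s * shifted_exp (Cexp w) s) _ s _ (1/4)%R); [lra | |].
- intros y Hy. rewrite Efun_factor; [reflexivity | apply (near_disc s); auto].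
- apply deriv_eq with (Eprefactor w s * (dlog_rG s + w) * shifted_exp (Cexp w) s + Eprefactor w s * dshifted_exp (Cexp w) s); [unfold dEfun; ring|].
  apply (deriv_mult (Eprefactor w) (shifted_exp (Cexp w))); [apply cder_Eprefactor, Hs | apply cder_shifted_exp, Hs].
Qed.

Lemma cder_dEfun w s : (Cmod s < 1/4)%R -> cder (dEfun w) s (ddEfun w s).
Proof.
intros Hs.
apply deriv_eq with (Eprefactor w s * (dlog_rG s + w) * ((dlog_rG s + w) * shifted_exp (Cexp w) s + dshifted_exp (Cexp w) s)
  + Eprefactor w s * (((ddlog_rG s + 0) * shifted_exp (Cexp w) s + (dlog_rG s + w) * dshifted_exp (Cexp w) s) + ddshifted_exp (Cexp w) s)); [unfold ddEfun; ring|].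
apply (deriv_mult (Eprefactor w) (fun s => (dlog_rG s + w) * shifted_exp (Cexp w) s + dshifted_exp (Cexp w) s)); [apply cder_Eprefactor, Hs|].
apply deriv_plus; [|apply cder_dshifted_exp, Hs].
apply (deriv_mult (fun s => dlog_rG s + w) (shifted_exp (Cexp w))); [|apply cder_shifted_exp, Hs].
apply deriv_plus; [apply cder_dlog_rG, Hs | apply deriv_const].
Qed.

Lemma C_derive_cder f x l : cder f x l -> C_derive f x = l.
Proof. intros H; apply is_C_derive_unique, cder_is_derive, H. Qed.

Lemma zero_quarter : (Cmod 0 < 1/4)%R.
Proof. rewrite Cmod_0; lra. Qed.

Lemma Eprefactor_0 w : Eprefactor w 0 = 1.
Proof. unfold Eprefactor. rewrite log_rG_0. replace (0 + 0 * w) with (RtoC 0) by ring. apply Cexp_0. Qed.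

Lemma E0_eq w : E_ 0 w = explog0 w.
Proof.
unfold E_; simpl. rewrite Efun_factor by (rewrite Cmod_0; lra). rewrite Eprefactor_0, shifted_exp_0. unfold explog0; ring.
Qed.

Lemma E1_eq w : E_ 1 w = calE1 (dlog_rG 0) w.
Proof.
unfold E_; simpl. rewrite (C_derive_cder _ _ _ (cder_Efun w 0 zero_quarter)).
unfold dEfun. rewrite Eprefactor_0, shifted_exp_0, dshifted_exp_0. unfold calE1, explog1, explog0; ring.
Qed.

(** The second derivative needs the first one in a neighbourhood of 0. *)
Lemma E2_eq w : E_ 2 w = calE2 (dlog_rG 0) (ddlog_rG 0 + dlog_rG 0 * dlog_rG 0) w.
Proof.
unfold E_; simpl. rewrite (C_derive_cder _ _ (ddEfun w 0)).
- unfold ddEfun. rewrite Eprefactor_0, shifted_exp_0, dshifted_exp_0, ddshifted_exp_0. unfold calE2, explog2, explog1, explog0; ring.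
- apply (deriv_ext_loc (dEfun w) _ 0 _ (1/4)%R); [lra | |apply cder_dEfun, zero_quarter].
  intros y Hy. replace (y - 0) with y in Hy by ring. symmetry. apply C_derive_cder, cder_Efun, Hy.
Qed.

(** * The basis *)

Ltac nz := repeat split; let Z := fresh in intros Z; apply (f_equal Re) in Z; simpl in Z; lra.

(** If [F] vanishes, so do its derivatives, which for [k = 1, 2, 3] are linear
    combinations of [F1], [F2], [F12]; their determinant is a multiple of
    [z (24 - 283 z)], where [283 z - 24] is the leading coefficient of the scalar
    equation.
    For [r <= -5] one has [exp r < 24 / 283]. *)
Lemma system_cyclic F F1 F2 F12 : system F F1 F2 F12 -> (forall w, F w = 0) ->
  forall r : R, (r <= -5)%R -> F1 r = 0 /\ F2 r = 0 /\ F12 r = 0.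
Proof.
intros HS H0 r Hr.
assert (HT : forall k, (k < 4)%nat -> forall w, theta_power F F1 F2 F12 k w = 0).
{ induction k as [|k IH]; intros Hk w; [apply H0|].
  apply (cder_unique (fun _ => 0) w); [|apply deriv_const].
  apply deriv_ext with (theta_power F F1 F2 F12 k); [apply IH; lia | apply theta_power_derive; auto; lia]. }
assert (T0 := H0 r). assert (T1 := HT 1%nat ltac:(lia) r). assert (T2 := HT 2%nat ltac:(lia) r). assert (T3 := HT 3%nat ltac:(lia) r).
unfold theta_power in T1, T2, T3. rewrite T0 in T2, T3.
set (z := Cexp r) in *. set (a := F1 r) in *. set (b := F2 r) in *. set (c := F12 r) in *.
assert (Ea : a = - (2) * b) by (transitivity (a + 2 * b + - (2) * b); [ring | rewrite T1; ring]).
rewrite Ea in T2, T3 |- *.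
assert (Ec : c = - (3 * z * b) / 8).
{ transitivity ((4 * z ^ 2 * 0 - z * (- (2) * b) + z * b + 8 * c) / 8 + - (3 * z * b) / 8); [field|rewrite T2; field]; nz. }
rewrite Ec in T3 |- *.
assert (N8 : RtoC 8 <> 0) by (intros Z; apply (f_equal Re) in Z; simpl in Z; lra).
assert (E : b * (z * (24 - 283 * z)) = 0).
{ rewrite <- (Cmult_0_r 8), <- T3. field. }
assert (Nz : z <> 0) by apply Cexp_neq0.
assert (Nd : 24 - 283 * z <> 0).
{ unfold z. rewrite Cexp_RtoC. intros Z. apply (f_equal Re) in Z. simpl in Z.
  assert (B : (exp r < 24 / 283)%R).
  { apply Rle_lt_trans with (exp (- (5))); [apply exp_le; lra|]. rewrite exp_Ropp.
    assert (X : (16 < exp 5)%R).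
    { replace 5%R with (1 + 1 + 1 + 1 + 1)%R by ring. rewrite !exp_plus.
      assert (Y := exp_ineq1 1 ltac:(lra)). set (e := exp 1) in *.
      assert (e * e > 4)%R by nra. assert (e * e * e > 8)%R by nra. assert (e * e * e * e > 16)%R by nra. nra. }
    apply Rlt_trans with (/ 16)%R; [apply Rinv_lt_contravar; lra | lra]. }
  lra. }
assert (Eb : b = 0).
{ transitivity (b * (z * (24 - 283 * z)) / (z * (24 - 283 * z))); [field; auto | rewrite E; field; auto]. }
rewrite Eb. repeat split; [ring | field; exact N8].
Qed.

Theorem theorem5p1 (H : hankel_contour) :
  let alpha : C * C := (RtoC (-4), RtoC (1 / 2)) in
  let beta : C * C := (RtoC (- (1 / 2)), RtoC 1) in
  let B := borel_multitransform H alpha beta in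
  is_C_basis4 master_space_P
    (B Upsilon1 (E_ 0))
    (B Upsilon2 (E_ 0))
    (B Upsilon1 (E_ 1))
    (fun w => 4 * B Upsilon2 (E_ 1) w + B Upsilon1 (E_ 2) w).
Proof.
intros alpha beta B.
set (g1 := dlog_rG 0). set (g2 := ddlog_rG 0 + dlog_rG 0 * dlog_rG 0). set (k := / (2 * PI * Ci)).
assert (Nk : k <> 0).
{ intros Z. assert (A := Cinv_l _ two_i_pi_neq0). fold k in A. rewrite Z in A. apply (f_equal Re) in A; simpl in A; lra. }
assert (EB : forall P Q p q w, (forall a, P a = p a) -> (forall b, Q b = q b) -> B P Q w = k * hankel H (factors p q w)).
{ intros P Q p q w EP EQ. unfold B, borel_multitransform. fold k. f_equal. unfold hankel, factors. f_equal.
  apply functional_extensionality. intros x. rewrite EP, EQ.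
  unfold alpha, beta; cbn [fst snd].
  assert (Eh : RtoC (1 / 2) = / 2) by (rewrite RtoC_div by lra; field).
  assert (A1 : w / (RtoC (-4) * RtoC (- (1 / 2))) - RtoC (- (1 / 2)) * Clog x = first_arg w (Clog x)).
  { rewrite RtoC_opp, Eh. replace (RtoC (-4)) with (- RtoC 4) by (rewrite <- RtoC_opp; f_equal; ring).
    unfold first_arg; field. }
  assert (A2 : w / (RtoC (1 / 2) * RtoC 1) - RtoC 1 * Clog x = second_arg w (Clog x))
    by (rewrite Eh; unfold second_arg; field).
  rewrite A1, A2. reflexivity. }
assert (E1 : forall w, B Upsilon1 (E_ 0) w = k * hankel H (factors ups1 explog0 w))
  by (intros; apply EB; auto using Upsilon1_pser, E0_eq).
assert (E2 : forall w, B Upsilon2 (E_ 0) w = k * hankel H (factors ups2 explog0 w))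
  by (intros; apply EB; auto using Upsilon2_pser, E0_eq).
assert (E3 : forall w, B Upsilon1 (E_ 1) w = k * hankel H (factors ups1 (calE1 g1) w))
  by (intros; apply EB; auto using Upsilon1_pser, E1_eq).
assert (E4 : forall w, 4 * B Upsilon2 (E_ 1) w + B Upsilon1 (E_ 2) w = k * hankel H (sol4 g1 g2 w)).
{ intros w. rewrite (EB Upsilon2 (E_ 1) ups2 (calE1 g1)), (EB Upsilon1 (E_ 2) ups1 (calE2 g1 g2))
    by auto using Upsilon1_pser, Upsilon2_pser, E1_eq, E2_eq.
  unfold sol4. rewrite (hankel_tame_lin H 4 1 (factors ups2 (calE1 g1)) (factors ups1 (calE2 g1 g2))); [ring | |].
  - exact (hf_tame _ _ _ _ _ _ (hankel_family_factors _ _ _ _ first_factor_2 (second_factor_1 g1))).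
  - exact (hf_tame _ _ _ _ _ _ (hankel_family_factors _ _ _ _ first_factor_1 (second_factor_2 g1 g2))). }
assert (S1 := system_10 H). assert (S2 := system_20 H). assert (S3 := system_11 H g1). assert (S4 := system_4 H g1 g2).
assert (scaled : forall F F1 F2 F12 G, system F F1 F2 F12 -> (forall w, G w = k * F w) ->
  exists G1 G2 G12, system G G1 G2 G12).
{ intros F F1 F2 F12 G HS E. eexists _, _, _.
  eapply system_ext; [| | | |exact (system_lin k 0 _ _ _ _ _ _ _ _ HS HS)]; [|reflexivity ..].
  intros w; rewrite E; ring. }
destruct (scaled _ _ _ _ _ S1 E1) as [F11 [F12 [F112 Z1]]].
destruct (scaled _ _ _ _ _ S2 E2) as [F21 [F22 [F212 Z2]]].
destruct (scaled _ _ _ _ _ S3 E3) as [F31 [F32 [F312 Z3]]].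
destruct (scaled _ _ _ _ (fun w => 4 * B Upsilon2 (E_ 1) w + B Upsilon1 (E_ 2) w) S4 E4) as [F41 [F42 [F412 Z4]]].
assert (Ind : forall c1 c2 c3 c4, (forall w, c1 * B Upsilon1 (E_ 0) w + c2 * B Upsilon2 (E_ 0) w + c3 * B Upsilon1 (E_ 1) w
   + c4 * (4 * B Upsilon2 (E_ 1) w + B Upsilon1 (E_ 2) w) = 0) -> c1 = 0 /\ c2 = 0 /\ c3 = 0 /\ c4 = 0).
{ intros c1 c2 c3 c4 Hz.
  (* The combination of the four solutions vanishes together with its components
     [F1], [F2], [F12].  Their leading terms form a triangular system. *)
  assert (CY := system_cyclic _ _ _ _ (system_lin 1 1 _ _ _ _ _ _ _ _ (system_lin c1 c2 _ _ _ _ _ _ _ _ S1 S2)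
    (system_lin c3 c4 _ _ _ _ _ _ _ _ S3 S4))). cbv beta in CY.
  assert (HF : forall w, 1 * (c1 * hankel H (factors ups1 explog0 w) + c2 * hankel H (factors ups2 explog0 w))
    + 1 * (c3 * hankel H (factors ups1 (calE1 g1) w) + c4 * hankel H (sol4 g1 g2 w)) = 0).
  { intros w. specialize (Hz w). rewrite E1, E2, E3, E4 in Hz.
    transitivity (/ k * (c1 * (k * hankel H (factors ups1 explog0 w)) + c2 * (k * hankel H (factors ups2 explog0 w))
      + c3 * (k * hankel H (factors ups1 (calE1 g1) w)) + c4 * (k * hankel H (sol4 g1 g2 w)))); [field; exact Nk | rewrite Hz; ring]. }
  specialize (CY HF).
  assert (sum0 : forall x y : C, 1 * x + 1 * y = 0 -> x + y = 0) by (intros x y E; eapply eq_trans; [|exact E]; ring).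
  assert (T1 := sf_tame _ _ (second_factor_1 g1)). assert (T2 := tame_dfactor _ _ (second_factor_2 g1 g2)).
  assert (L0 := leading_dfactor _ rho0 _ tame_explog0 (leading_const 0)). assert (L1 := leading_dfactor _ rho1 _ T1 (leading_const 1)).
  (* [F12] has the leading terms 0, 0, 0, 2. *)
  assert (C4 : c4 = 0).
  { assert (D := leading_combination H c1 c2 c3 c4 _ _ _ _ _ _ _ _
      (leading_mult _ _ _ _ leading_ups1_theta L0) (leading_mult _ _ _ _ leading_ups2' L0) (leading_mult _ _ _ _ leading_ups1_theta L1)
      (leading_plus _ _ _ _ (leading_scal 4 _ _ (leading_mult _ _ _ _ leading_ups2' L1)) (leading_scal 1 _ _ (leading_0_mult _ _ leading_ups1_theta T2)))
      (fun r Hr => sum0 _ _ (proj2 (proj2 (CY r Hr))))).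
    transitivity (/ 2 * (c1 * (0 * 0) + c2 * (/ 2 * 0) + (c3 * (0 * 1) + c4 * (4 * (/ 2 * 1) + 1 * 0)))); [field | rewrite D; ring]. }
  subst c4.
  (* [F2] has the leading terms 0, 0, 1. *)
  assert (C3 : c3 = 0).
  { assert (LU : leading (factors ups2 (dfactor explog0 rho0)) 0).
    { destruct (leading_0_mult _ _ L0 (ff_tame _ _ first_factor_2)) as [t [T E]]. exists t; split; [exact T|].
      intros w u; rewrite <- E; apply Cmult_comm. }
    assert (D := leading_combination H c1 c2 c3 0 _ _ _ _ _ _ _ _
      (leading_mult _ _ _ _ leading_ups1 L0) LU (leading_mult _ _ _ _ leading_ups1 L1) (leading_const 0)).
    transitivity (c1 * (1 * 0) + c2 * 0 + (c3 * (1 * 1) + 0 * 0)); [ring | apply D].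
    intros r Hr. eapply eq_trans; [|exact (sum0 _ _ (proj1 (proj2 (CY r Hr))))]. unfold factors. ring. }
  subst c3.
  (* [F1] has the leading terms 0, 1/2. *)
  assert (C2 : c2 = 0).
  { assert (D := leading_combination H c1 c2 0 0 _ _ _ _ _ _ _ _
      (leading_mult _ _ _ _ leading_ups1_theta leading_explog0) (leading_mult _ _ _ _ leading_ups2' leading_explog0) (leading_const 0) (leading_const 0)).
    transitivity (2 * (c1 * (0 * 1) + c2 * (/ 2 * 1) + (0 * 0 + 0 * 0))); [field | rewrite D; [ring|]].
    intros r Hr. eapply eq_trans; [|exact (sum0 _ _ (proj1 (CY r Hr)))]. unfold factors. ring. }
  subst c2.
  (* [F] has the leading term 1. *)
  assert (C1 : c1 = 0).
  { assert (D := leading_combination H c1 0 0 0 _ _ _ _ _ _ _ _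
      (leading_mult _ _ _ _ leading_ups1 leading_explog0) (leading_const 0) (leading_const 0) (leading_const 0)).
    transitivity (c1 * (1 * 1) + 0 * 0 + (0 * 0 + 0 * 0)); [ring | apply D].
    intros r Hr. eapply eq_trans; [|exact (HF r)]. unfold factors. ring. }
  auto. }
split; [|split].
- split; [exact (system_master _ _ _ _ Z1)|]. split; [exact (system_master _ _ _ _ Z2)|].
  split; [exact (system_master _ _ _ _ Z3) | exact (system_master _ _ _ _ Z4)].
- intros c1 c2 c3 c4 Hz. apply Ind. exact Hz.
- intros Phi HPhi. destruct (master_tower Phi HPhi) as [T [T0 HT]].
  destruct (spanning _ _ _ _ (theta_power_tower _ _ _ _ Z1) (theta_power_tower _ _ _ _ Z2) (theta_power_tower _ _ _ _ Z3) (theta_power_tower _ _ _ _ Z4) Ind T HT)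
    as [c1 [c2 [c3 [c4 E]]]].
  exists c1, c2, c3, c4. intros w. rewrite <- (T0 w). apply E.
Qed.
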